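(* Let $\mathbb{X}$ be a Polish space and let $H(dx)=a\,\delta_{x_0}(dx)+(1-a)H^c(dx)$, where $a\in(0,1)$, $x_0\in\mathbb{X}$ and $H^c$ is a diffuse probability measure on $\mathbb{X}$. Let $\tilde\Pi$ be the random partition induced by a $gSSS(\mathfrak{q},H)$ and let $\Pi$ be an exchangeable random partition with EPPF $\mathfrak{q}$. If $\pi_n=[\pi_{1,n},\dots,\pi_{k,n}]$ is a partition of $[n]$ with $|\pi_{i,n}|=n_i$ $(i=1,\dots,k)$, then $$P\{\tilde\Pi_n=\pi_n\}=(1-a)^k\mathfrak{q}(n_1,\dots,n_k)+(1-a)^{k-1}\sum_{i=1}^k\mathfrak{q}(n_1,\dots,n_{i-1},n_{i+1},\dots,n_k)\sum_{r=1}^{n_i}a^r q_n(r\mid n_1,\dots,n_{i-1},n_{i+1},\dots,n_k),$$ where $q_n(r\mid n_1,\dots,n_{i-1},n_{i+1},\dots,n_k)$ denotes the probability that $\Pi_n$ has $k-1+r$ blocks, conditionally on the fact that $\Pi_{n-n_i}$ has $k-1$ blocks with sizes $n_1,\dots,n_{i-1},n_{i+1},\dots,n_k$. If in addition $\mathfrak{q}$ is of Gibbs type, $\mathfrak{q}(n_1,\dots,n_k)=V_{n,k}\prod_{j=1}^k(1-\sigma)_{n_j-1}$ (with $n=n_1+\dots+n_k$), then $$P\{\tilde\Pi_n=\pi_n\}=(1-a)^kV_{n,k}\prod_{j=1}^k(1-\sigma)_{n_j-1}+(1-a)^{k-1}\sum_{i=1}^k\ \prod_{j=1,\,j\ne 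i}^k(1-\sigma)_{n_j-1}\sum_{r=1}^{n_i}a^rV_{n,k-1+r}S_\sigma(n_i,r).$$
   Context: A partition of $[n]=\{1,\dots,n\}$ has its blocks listed in increasing order of smallest elements. A random partition of $\mathbb{N}$ is a sequence $\Pi=(\Pi_n)_{n\ge1}$ of random partitions of $[n]$ that are consistent under restriction; it is exchangeable if the law of each $\Pi_n$ is invariant under permutations of $[n]$. Its EPPF (exchangeable partition probability function) is the unique symmetric function $\mathfrak{q}$ on finite sequences of positive integers with $P\{\Pi_n=\pi_n\}=\mathfrak{q}(|\pi_{1,n}|,\dots,|\pi_{k,n}|)$ for each partition $\pi_n$ of $[n]$ with $k$ blocks. Kingman's correspondence is the bijection between EPPFs and laws of random ranked weights $p_1^\downarrow\ge p_2^\downarrow\ge\dots\ge0$, $\sum_jp_j^\downarrow\le1$, in which $p_j^\downarrow$ is the a.s. limit of the $j$-th largest block size of $\Pi_n$ divided by $n$. $(\xi_n)_{n\ge1}$ is a $gSSS(\mathfrak{q},H)$ (generalized species sampling sequence) if the $\xi_n$ are conditionally i.i.d. with law $P$ given a random probability measure $P$ distributed as $\sum_{j\ge1}p_j\delta_{Z_j}$, where $(Z_j)$ are i.i.d. with law $H$, $(p_j)$ are random weights in $[0,1]$ with $\sum_jp_j=1$ a.s., independent of $(Z_j)$, and the EPPF corresponding via Kingman to the decreasing rearrangement of $(p_j)$ is $\mathfrak{q}$. The random partition induced by $(\xi_n)$ is given by $i\sim j$ iff $\xi_i=\xi_j$. Diffuse means without atoms. Gibbs type: $\sigma<1$; $(x)_n=x(x+1)\cdots(x+n-1)$,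 $(x)_0=1$; $V_{n,k}$ are positive reals with $V_{1,1}=1$ and $(n-\sigma k)V_{n+1,k}+V_{n+1,k+1}=V_{n,k}$ for $n\ge1$, $1\le k\le n$. The generalized Stirling number of the first kind is $$S_\sigma(n,k)=\sum\prod_{j=1}^n[(1-\sigma)_{j-1}]^{\lambda_j}\,\frac{n!}{\prod_{j=1}^n\lambda_j!(j!)^{\lambda_j}},$$ the sum being over nonnegative integers $(\lambda_1,\dots,\lambda_n)$ with $\sum_jj\lambda_j=n$ and $\sum_j\lambda_j=k$.
   Formalization: q_n(r|...) is taken as the conditional probability that Π_n has k-1+r blocks and the k-1 old blocks keep their sizes (no added element joins them); counting blocks alone makes the first formula false, already for n=3 with block sizes (1,2). *)

(* Defs.v *)
From HB Require Import structures.
From mathcomp Require Import all_boot all_order all_algebra all_fingroup.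
From mathcomp Require Import all_classical all_reals all_analysis.

Set Implicit Arguments.
Unset Strict Implicit.
Unset Printing Implicit Defensive.

Import Order.TTheory GRing.Theory Num.Theory.
Import numFieldNormedType.Exports.

Local Open Scope classical_set_scope.
Local Open Scope ring_scope.

Definition polish (R : realType) (X : topologicalType) : Prop :=
  (exists2 D : set X, countable D & dense D) /\
  exists (M : metricType R) (f : X -> M) (g : M -> X),
    [/\ cancel f g, cancel g f, continuous f, continuous g &
        forall F : set_system M, ProperFilter F -> cauchy F ->
          exists l : M, F --> l].

Definition borel (X : ptopologicalType) : measurableType (@open X).-sigma :=
  g_sigma_algebraType (@open X).

(* On a Polish space every atom charges a point, so that this is the absence
   of atoms. *)
Definition diffuse (R : realType) (X : ptopologicalType)
    (H : probability (borel X) R) : Prop :=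
  forall x : X, H [set x] = 0%E.

(* A partition of {0, ..., n-1} is a term pi : {set {set 'I_n}} such that
   finset.partition pi setT. The case n = 0 is included: the only partition is
   then set0, which has no block. *)
Definition restrict_partition (m n : nat) (le_mn : (m <= n)%N)
    (pi : {set {set 'I_n}}) : {set {set 'I_m}} :=
  [set widen_ord le_mn @^-1: B | B : {set 'I_n} in pi]%SET :\ finset.set0.

(* Each block is listed at the position of its smallest element. *)
Definition blocks (n : nat) (pi : {set {set 'I_n}}) : seq {set 'I_n} :=
  [seq finset.pblock pi i |
     i <- enum 'I_n & [forall j in finset.pblock pi i, (i <= j)%N]].

Definition block_sizes (n : nat) (pi : {set {set 'I_n}}) : seq nat :=
  [seq #|B| | B : {set 'I_n} <- blocks pi].

Definition random_partition (d : measure_display) (Om : measurableType d)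
    (Pi : forall n, Om -> {set {set 'I_n}}) : Prop :=
  [/\ forall n w, finset.partition (Pi n w) [set: 'I_n]%SET,
      forall n pi, measurable [set w | Pi n w = pi] &
      forall m n (le_mn : (m <= n)%N) w,
        Pi m w = restrict_partition le_mn (Pi n w)].

Definition exchangeable (R : realType) (d : measure_display)
    (Om : measurableType d) (P : probability Om R)
    (Pi : forall n, Om -> {set {set 'I_n}}) : Prop :=
  forall n (s : 'S_n) (pi : {set {set 'I_n}}),
    P [set w | [set s @: B | B : {set 'I_n} in Pi n w]%SET = pi] =
    P [set w | Pi n w = pi].

(* With n = 0 the last equation reads q [::] = 1, the usual convention. *)
Definition is_eppf (R : realType) (d : measure_display)
    (Om : measurableType d) (P : probability Om R)
    (Pi : forall n, Om -> {set {set 'I_n}}) (q : seq nat -> R) : Prop :=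
  (forall s t, all (leq 1) s -> perm_eq s t -> q s = q t) /\
  forall n (pi : {set {set 'I_n}}), finset.partition pi [set: 'I_n]%SET ->
    P [set w | Pi n w = pi] = (q (block_sizes pi))%:E.

Definition exchangeable_partition_with_eppf (R : realType)
    (d : measure_display) (Om : measurableType d) (P : probability Om R)
    (Pi : forall n, Om -> {set {set 'I_n}}) (q : seq nat -> R) : Prop :=
  [/\ random_partition Pi, exchangeable P Pi & is_eppf P Pi q].

Definition same_law (R : realType) (d1 d2 : measure_display)
    (Om1 : measurableType d1) (Om2 : measurableType d2)
    (P1 : probability Om1 R) (P2 : probability Om2 R)
    (u : nat -> {RV P1 >-> R}) (v : nat -> {RV P2 >-> R}) : Prop :=
  forall n (B : set (n.-tuple R)), measurable B ->
    P1 [set w | B [tuple u i w | i < n]] =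
    P2 [set w | B [tuple v i w | i < n]].

Definition ranked_frequency (R : realType) (n : nat) (pi : {set {set 'I_n}})
    (j : nat) : R :=
  (nth 0%N (sort geq (block_sizes pi)) j)%:R / n%:R.

(* The EPPF q corresponds to the law of the ranked weights pd. *)
Definition kingman (R : realType) (q : seq nat -> R) (d' : measure_display)
    (Om' : measurableType d') (P' : probability Om' R)
    (pd : nat -> {RV P' >-> R}) : Prop :=
  exists (d : measure_display) (Om : measurableType d) (P : probability Om R)
    (Pi : forall n, Om -> {set {set 'I_n}}) (u : nat -> {RV P >-> R}),
    [/\ exchangeable_partition_with_eppf P Pi q,
        {ae P, forall w, forall j,
           ranked_frequency R (Pi n w) j @[n --> \oo] --> u j w} &
        same_law u pd].

(* Sorting a sequence with infinitely many positive terms removes its zeros,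
   so only the positive values are matched, with multiplicity. *)
Definition decreasing_rearrangement (R : realType) (p pd : nat -> R) : Prop :=
  [/\ forall i j, (i <= j)%N -> pd j <= pd i,
      forall j, 0 <= pd j &
      forall x, 0 < x -> ([set i | pd i = x] #= [set i | p i = x])%card].

Definition iid (R : realType) (X : ptopologicalType)
    (H : probability (borel X) R) (d : measure_display)
    (Om : measurableType d) (P : probability Om R)
    (Z : nat -> {RV P >-> borel X}) : Prop :=
  forall n (B : nat -> set (borel X)), (forall j, measurable (B j)) ->
    P [set w | forall j, (j < n)%N -> B j (Z j w)] =
    (\prod_(j < n) H (B j))%E.

Definition independent_seq (R : realType) (X : ptopologicalType)
    (d : measure_display) (Om : measurableType d) (P : probability Om R)
    (p : nat -> {RV P >-> R}) (Z : nat -> {RV P >-> borel X}) : Prop :=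
  forall m n (A : set (m.-tuple R)) (B : set (n.-tuple (borel X))),
    measurable A -> measurable B ->
    P ([set w | A [tuple p i w | i < m]] `&` [set w | B [tuple Z j w | j < n]])
    = (P [set w | A [tuple p i w | i < m]] *
       P [set w | B [tuple Z j w | j < n]])%E.

(* Given the random probability measure Pt, the xi_i are i.i.d. with law Pt. *)
Definition conditionally_iid (R : realType) (X : ptopologicalType)
    (d : measure_display) (Om : measurableType d) (P : probability Om R)
    (Pt : {mfun Om >-> pprobability (borel X) R})
    (xi : nat -> {RV P >-> borel X}) : Prop :=
  forall n (B : nat -> set (borel X)) (S : set (pprobability (borel X) R)),
    (forall i, measurable (B i)) -> measurable S ->
    P ((Pt @^-1` S) `&` [set w | forall i, (i < n)%N -> B i (xi i w)]) =
    (\int[P]_(w in Pt @^-1` S)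
       \prod_(i < n) (Pt w : probability (borel X) R) (B i))%E.

Definition gSSS (R : realType) (X : ptopologicalType) (q : seq nat -> R)
    (H : probability (borel X) R) (d : measure_display)
    (Om : measurableType d) (P : probability Om R)
    (xi : nat -> {RV P >-> borel X}) : Prop :=
  exists2 Pt : {mfun Om >-> pprobability (borel X) R},
    conditionally_iid Pt xi &
    exists (d' : measure_display) (Om' : measurableType d')
      (P' : probability Om' R) (p pd : nat -> {RV P' >-> R})
      (Z : nat -> {RV P' >-> borel X})
      (mu : {mfun Om' >-> pprobability (borel X) R}),
      [/\ (forall j w, 0 <= p j w <= 1) /\
            {ae P', forall w, (\sum_(0 <= j <oo) (p j w)%:E = 1)%E},
          iid H Z /\ independent_seq p Z,
          {ae P', forall w,
             decreasing_rearrangement (fun j => p j w) (fun j => pd j w)} /\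
            kingman q pd,
          {ae P', forall w, forall A : set (borel X), measurable A ->
             ((mu w : probability (borel X) R) A =
              \sum_(0 <= j <oo) (p j w)%:E * \d_(Z j w) A)%E} &
          forall S : set (pprobability (borel X) R), measurable S ->
            P (Pt @^-1` S) = P' (mu @^-1` S)].

Definition induced_partition (R : realType) (X : ptopologicalType)
    (d : measure_display) (Om : measurableType d) (P : probability Om R)
    (xi : nat -> {RV P >-> borel X}) (n : nat) (w : Om) : {set {set 'I_n}} :=
  finset.equivalence_partition
    [rel i j : 'I_n | xi i w == xi j w] [set: 'I_n]%SET.

(* With m = sumn s and k = size s, the conditional probability, given that
   Pi_m has k blocks with sizes s, that Pi_n has k + r blocks consisting of
   those k blocks and of r blocks formed by the n - m additional elements. The
   condition on the first k sizes says that no additional element joins an old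
   block; without it (for n - m > r) the number of blocks alone would also
   count partitions in which the old blocks have grown, and the formulas for
   the induced partition would fail. If the conditioning event is null, so is
   q s, and the value 0 given by division is immaterial. *)
Definition prob_new_blocks (R : realType) (d : measure_display)
    (Om : measurableType d) (P : probability Om R)
    (Pi : forall n, Om -> {set {set 'I_n}}) (n r : nat) (s : seq nat) : R :=
  let E := [set w | block_sizes (Pi (sumn s) w) = s] in
  let F := [set w | size (block_sizes (Pi n w)) = (size s + r)%N /\
                    take (size s) (block_sizes (Pi n w)) = s] in
  fine (P (E `&` F)) / fine (P E).

Definition omit (T : Type) (i : nat) (s : seq T) : seq T :=
  take i s ++ drop i.+1 s.

Definition rising (R : realType) (x : R) (n : nat) : R :=
  \prod_(i < n) (x + i%:R).

Definition gibbs_type (R : realType) (sigma : R) (V : nat -> nat -> R)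
    (q : seq nat -> R) : Prop :=
  [/\ sigma < 1,
      forall n k, (1 <= k <= n)%N -> 0 < V n k,
      V 1%N 1%N = 1,
      forall n k, (1 <= k <= n)%N ->
        (n%:R - sigma * k%:R) * V n.+1 k + V n.+1 k.+1 = V n k &
      forall s, s != [::] -> all (leq 1) s ->
        q s = V (sumn s) (size s) *
              \prod_(m <- s) rising (1 - sigma) m.-1].

(* l j is the number of blocks of size j.+1; l j <= n is implied by the
   constraints. *)
Definition gen_stirling (R : realType) (sigma : R) (n k : nat) : R :=
  \sum_(l : {ffun 'I_n -> 'I_n.+1} |
          (\sum_(j < n) j.+1 * l j == n)%N && (\sum_(j < n) l j == k)%N)
    (\prod_(j < n) rising (1 - sigma) j ^+ l j) *
    (n`!%:R / \prod_(j < n) ((l j)`! * j.+1`! ^ l j)%N%:R).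

(* Main.v *)
Require Import Defs.
From HB Require Import structures.
From mathcomp Require Import all_boot all_order all_algebra all_fingroup.
From mathcomp Require Import all_classical all_reals all_analysis measurable_realfun.
From mathcomp Require Import ring lra zify.

Set Implicit Arguments.
Unset Strict Implicit.
Unset Printing Implicit Defensive.

Import Order.TTheory GRing.Theory Num.Theory.
Import numFieldNormedType.Exports.

Local Open Scope classical_set_scope.
Local Open Scope ring_scope.

(** The samples are drawn in two steps: first the index [j i] of the atom hit by
    the sample [i], with probability [p (j i)], then the locations [Z] of the
    atoms. Two samples are equal if they hit the same atom, or if they hit two
    atoms with the same location, which outside a null event happens only at the
    point [x0], since the other points have no mass under [H]. Hence the
    partition induced by the samples is obtained from the partition [rho] of the
    atom indices by amalgamating the blocks whose atoms sit at [x0]. Given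
    [rho], each block sits there with probability [a], independently of the
    others.

    The partition [rho] has the law prescribed by the EPPF. For weights summing
    to one the probability of [rho] is a pattern mass, that is, the sum of the
    products of weights over the index families whose fibres are the blocks of
    [rho]. A uniform sample with replacement from the first [M] integers connects
    this to the random partition: relative to the blocks of [Pi M] its pattern
    mass is that of the ranked frequencies, while by exchangeability it follows
    the EPPF as soon as the draws are distinct. As [M] grows the frequencies
    converge to the ranked weights, and the mass that escapes to the infinitely
    many small blocks is controlled by the defect of the sum of the weights
    ([mean_ranked_pattern], [mean_frequency_pattern], [kingman_mean_pattern]).

    The random measure is known through its values on measurable sets only, so
    that indices of atoms are not observed. The samples are therefore looked at
    through a finite partition of the space into cells, given by a countable
    family of open sets that separates points; the law of the cells of the
    samples is an integral of products of masses of cells, the first [N] atoms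
    account for all of it up to their defect, and the cells are then refined
    ([mean_atom_pattern_gap]). Together this gives the law of the induced
    partition as a sum over all partitions [rho] ([gSSS_pattern_prob]).

    It remains to sum. Amalgamating blocks of [rho] yields [pi] in two ways:
    [rho = pi] and no block sits at [x0], or one block [B] of [pi] is the union
    of the amalgamated blocks, which form a partition [tau] of [B]
    ([sum_amalgam]). The sum over the [tau] with [r] blocks is the value of
    [q] at the other block sizes times the conditional probability that the
    elements of [B] form [r] new blocks ([eppf_new_blocks]). For an EPPF of Gibbs
    type it factors, and the recursion that removes the block of a
    fixed element identifies the remaining sum with a generalized Stirling
    number ([sum_partitions_stirling]). *)

(** * Partitions as patterns of equalities *)

Section Fibers.
Variable I : finType.
Implicit Types (pi rho : {set {set I}}).

(** The equality pattern of the family [g]. Restricting, relabelling and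
    amalgamating partitions all become operations on such families. *)
Definition fibers (T : eqType) (g : I -> T) : {set {set I}} :=
  finset.preim_partition g [set: I]%SET.

Definition is_part pi := finset.partition pi [set: I]%SET.

Lemma fibers_partition (T : eqType) (g : I -> T) : is_part (fibers g).
Proof. exact: preim_partitionP. Qed.

Lemma mem_pblock_fibers (T : eqType) (g : I -> T) i j :
  (j \in finset.pblock (fibers g) i) = (g i == g j).
Proof.
rewrite /fibers /finset.preim_partition pblock_equivalence_partition ?inE //.
by move=> x y z _ _ _; split=> // /eqP ->.
Qed.

Lemma mem_pblock_part pi i j : is_part pi ->
  (j \in finset.pblock pi i) = (finset.pblock pi i == finset.pblock pi j).
Proof.
move=> pip; rewrite eq_pblock ?(partition_trivIset pip) //.
by rewrite (cover_partition pip) inE.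
Qed.

(** Every partition is a pattern: that of the family of its own blocks. *)
Lemma fibers_pblock pi : is_part pi -> fibers (finset.pblock pi) = pi.
Proof.
move=> pip; rewrite -[RHS](preim_partition_pblock pip) //.
Qed.

Lemma eq_fibers (T U : eqType) (g : I -> T) (h : I -> U) :
  (forall i j, (g i == g j) = (h i == h j)) -> fibers g = fibers h.
Proof.
move=> gh; rewrite /fibers /finset.preim_partition /finset.equivalence_partition.
by apply: eq_imset => i; apply/setP => j; rewrite !inE gh.
Qed.

Lemma fibers_eqP (T U : eqType) (g : I -> T) (h : I -> U) :
  reflect (forall i j, (g i == g j) = (h i == h j)) (fibers g == fibers h).
Proof.
apply: (iffP eqP) => [gh i j|]; last exact: eq_fibers.
by rewrite -!mem_pblock_fibers gh.
Qed.

Lemma fibers_pblockE (T : eqType) (g : I -> T) pi : is_part pi ->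
  reflect (forall i j, (g i == g j) = (finset.pblock pi i == finset.pblock pi j))
    (fibers g == pi).
Proof. by move=> pip; have := fibers_eqP g (finset.pblock pi); rewrite fibers_pblock. Qed.

Lemma partition_complement (P Q : {set {set I}}) (D : {set I}) : is_part (P :|: Q)%SET ->
  (P :&: Q)%SET = finset.set0 -> finset.cover P = (~: D)%SET ->
  finset.partition Q D.
Proof.
move=> PQ dis cP.
have sQ : Q \subset (P :|: Q)%SET by exact: finset.subsetUr.
apply/and3P; split; last by apply: contraFN (partition0 PQ); exact: (fintype.subsetP sQ).
  apply/eqP/setP => x; apply/bigcupP/idP => [[B BQ xB]|xD].
    rewrite -[D]finset.setCK -cP inE; apply/negP => /bigcupP[C CP xC].
    have e : B = C.
      rewrite -(def_pblock (partition_trivIset PQ) _ xB); last by rewrite inE BQ orbT.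
      by apply: (def_pblock (partition_trivIset PQ) _ xC); rewrite inE CP.
    have : B \in (P :&: Q)%SET by rewrite inE BQ e CP.
    by rewrite dis inE.
  have : x \in finset.cover (P :|: Q)%SET by rewrite (cover_partition PQ) inE.
  move=> /bigcupP[B]; rewrite inE => /orP[BP|BQ] xB; last by exists B.
  have : x \in finset.cover P by apply/bigcupP; exists B.
  by rewrite cP inE xD.
exact: finset.trivIsetS sQ (partition_trivIset PQ).
Qed.

Lemma partition_union (P Q : {set {set I}}) (D : {set I}) : finset.partition P (~: D)%SET ->
  finset.partition Q D -> is_part (P :|: Q)%SET /\ (P :&: Q)%SET = finset.set0.
Proof.
move=> Pp Qp; have cP := cover_partition Pp; have cQ := cover_partition Qp.
have disc : fintype.disjoint (mem (finset.cover P)) (mem (finset.cover Q)).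
  by rewrite cP cQ -finset.setI_eq0 finset.setIC finset.setICr.
split.
  apply/and3P; split.
  - have -> : finset.cover (P :|: Q)%SET = (finset.cover P :|: finset.cover Q)%SET.
      by rewrite /finset.cover finset.bigcup_setU.
    by rewrite cP cQ finset.setUC finset.setUCr.
  - by apply: finset.trivIsetU => //; [exact: partition_trivIset Pp|exact: partition_trivIset Qp].
  - by rewrite inE (partition0 Pp) (partition0 Qp).
apply/setP => B; rewrite !inE; apply/negbTE/negP => /andP[BP BQ].
have /set0Pn[x xB] := partition_neq0 Pp BP.
have := fintype.subsetP (partitionS Pp BP) x xB.
by rewrite inE (fintype.subsetP (partitionS Qp BQ) x xB).
Qed.

End Fibers.

(** * Pattern masses of weights *)

Section PatternMass.
Variables (R : realDomainType) (I : finType).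
Implicit Types (rho : {set {set I}}).

(** If the [x t] are the probabilities of independent draws then this is the
    probability that the draws have equality pattern [rho]. *)
Definition pattern_mass (T : finType) (x : T -> R) rho : R :=
  \sum_(j : {ffun I -> T} | fibers j == rho) \prod_i x (j i).

(** Drawing labels [u] of indices [t] amounts to drawing the indices and forgetting
    all but their labels: expand the product of the sums. *)
Lemma pattern_mass_push (T U : finType) (h : T -> U) (x : T -> R) rho :
  pattern_mass (fun u => \sum_(t | h t == u) x t) rho =
  \sum_(j : {ffun I -> T} | fibers (h \o j) == rho) \prod_i x (j i).
Proof.
rewrite /pattern_mass.
under eq_bigr => c _ do rewrite (bigA_distr_big_dep _ (fun i t => x t)).
have Hk (j : {ffun I -> T}) (c : {ffun I -> U}) :
    j \in family (fun i t => h t == c i) -> c = [ffun i => h (j i)].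
  by move=> /familyP jc; apply/ffunP => i; rewrite ffunE; apply/esym/eqP/jc.
rewrite (exchange_big_dep (fun j : {ffun I -> T} => fibers (h \o j) == rho)) /=.
  apply: eq_bigr => j /eqP kj.
  rewrite (big_pred1 [ffun i => h (j i)]) // => c.
  apply/idP/eqP => [/andP[_ /Hk]//|->].
  apply/andP; split; last by apply/familyP => i; rewrite ffunE; apply: eqxx.
  by rewrite -kj; apply/fibers_eqP => i i'; rewrite !ffunE.
move=> c j /eqP kc /Hk ce; rewrite -kc ce.
by apply/fibers_eqP => i i'; rewrite !ffunE.
Qed.

Lemma sum_prod_ffun (T : finType) (x : T -> R) :
  \sum_(j : {ffun I -> T}) \prod_i x (j i) = (\sum_t x t) ^+ #|I|.
Proof. by rewrite -(bigA_distr_bigA (fun _ t => x t)) prodr_const. Qed.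

Lemma pattern_mass_ge0 (T : finType) (x : T -> R) rho :
  (forall t, 0 <= x t) -> 0 <= pattern_mass x rho.
Proof. by move=> x0; apply: sumr_ge0 => j _; apply: prodr_ge0. Qed.

Lemma pattern_mass_le (T : finType) (x y : T -> R) rho :
  (forall t, 0 <= x t <= y t) ->
  pattern_mass x rho <= pattern_mass y rho.
Proof. by move=> xy; apply: ler_sum => j _; apply: ler_prod. Qed.

(** The difference is a sum, over the families of pattern [rho], of nonnegative
    differences of products; summed over all families these add up to the
    right-hand side. *)
Lemma pattern_mass_diff (T : finType) (x y : T -> R) rho :
  (forall t, 0 <= x t <= y t) ->
  pattern_mass y rho - pattern_mass x rho <=
  (\sum_t y t) ^+ #|I| - (\sum_t x t) ^+ #|I|.
Proof.
move=> xy; rewrite -!sum_prod_ffun /pattern_mass -!sumrB.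
rewrite [leRHS](bigID (fun j : {ffun I -> T} => fibers j == rho)) /= lerDl.
by apply: sumr_ge0 => j _; rewrite subr_ge0; apply: ler_prod.
Qed.

Lemma pattern_mass_le_sum (T : finType) (x : T -> R) rho :
  (forall t, 0 <= x t) -> pattern_mass x rho <= (\sum_t x t) ^+ #|I|.
Proof.
move=> x0; rewrite -sum_prod_ffun /pattern_mass [leRHS](bigID (fun j : {ffun I -> T} => fibers j == rho)) /= lerDl.
by apply: sumr_ge0 => j _; apply: prodr_ge0.
Qed.

(** Families that meet an index of weight zero contribute nothing, and on the
    others an injection of the support preserves the pattern. *)
Lemma pattern_mass_supp_inj (T U : finType) (h : T -> U) (x : T -> R) rho :
  {in [pred t | x t != 0] &, injective h} ->
  pattern_mass (fun u => \sum_(t | h t == u) x t) rho = pattern_mass x rho.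
Proof.
move=> hi; rewrite pattern_mass_push [LHS]big_mkcond /pattern_mass [RHS]big_mkcond /=.
apply: eq_bigr => j _.
have [/forallP xj|/forallPn [i /negbNE/eqP xj]] :=
    boolP [forall i, x (j i) != 0].
  rewrite (@eq_fibers _ _ _ (h \o j) j) // => i i' /=.
  by apply: (inj_in_eq hi); [exact: xj i|exact: xj i'].
by rewrite (bigD1 i) //= xj mul0r !if_same.
Qed.

(** Since [h] is injective on the support of [x], the weights pushed along [h] stay
    below [y], and they have the same pattern masses and the same sum as [x]. *)
Lemma pattern_mass_supp_le (T U : finType) (h : T -> U) (x : T -> R)
    (y : U -> R) rho :
  {in [pred t | x t != 0] &, injective h} ->
  (forall t, 0 <= x t) -> (forall u, 0 <= y u) ->
  (forall t, x t != 0 -> x t <= y (h t)) ->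
  [/\ pattern_mass x rho <= pattern_mass y rho, \sum_t x t <= \sum_u y u &
   pattern_mass y rho - pattern_mass x rho <=
     (\sum_u y u) ^+ #|I| - (\sum_t x t) ^+ #|I|].
Proof.
move=> hi x0 y0 xy.
have key u : 0 <= \sum_(t | h t == u) x t <= y u.
  rewrite sumr_ge0 //=.
  have [/existsP[t /andP[/eqP <- xt]]|/existsPn nt] :=
      boolP [exists t, (h t == u) && (x t != 0)].
    rewrite (bigD1 t) //= big1 ?addr0 ?xy// => t' /andP[/eqP htt' t't].
    apply/eqP; apply: contraNT t't => xt'.
    by apply/eqP; apply: hi.
  rewrite big1 // => t ht; apply/eqP.
  by have := nt t; rewrite ht /= negbK.
have sx : \sum_t x t = \sum_u \sum_(t | h t == u) x t.
  by rewrite (partition_big h predT).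
split; first by rewrite -(pattern_mass_supp_inj rho hi) pattern_mass_le.
  by rewrite sx; apply: ler_sum => u _; case/andP: (key u).
by rewrite -(pattern_mass_supp_inj rho hi) sx pattern_mass_diff.
Qed.

End PatternMass.

Lemma pattern_mass_widen (R : realDomainType) (I : finType) (p : nat -> R)
    (rho : {set {set I}}) N M : (N <= M)%N -> (forall i, 0 <= p i) ->
  [/\ pattern_mass (fun t : 'I_N => p t) rho <=
       pattern_mass (fun t : 'I_M => p t) rho,
      \sum_(t < N) p t <= \sum_(t < M) p t &
      pattern_mass (fun t : 'I_M => p t) rho -
      pattern_mass (fun t : 'I_N => p t) rho <=
      (\sum_(t < M) p t) ^+ #|I| - (\sum_(t < N) p t) ^+ #|I|].
Proof.
move=> NM p0; apply: (pattern_mass_supp_le (h := widen_ord NM)) => //.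
by move=> i j _ _ /(congr1 val) /= ij; apply: val_inj.
Qed.

(** * Blocks listed by their smallest elements *)

Lemma blocks_uniq n (pi : {set {set 'I_n}}) : is_part pi -> uniq (blocks pi).
Proof.
move=> pip; rewrite map_inj_in_uniq; first exact/filter_uniq/enum_uniq.
move=> i j; rewrite !mem_filter => /andP[/forall_inP im _] /andP[/forall_inP jm _] e.
apply/val_inj/eqP; rewrite eqn_leq im ?jm//.
  by rewrite -e mem_pblock_part.
by rewrite e mem_pblock_part.
Qed.

Lemma mem_blocks n (pi : {set {set 'I_n}}) B :
  is_part pi -> (B \in blocks pi) = (B \in pi).
Proof.
move=> pip; apply/mapP/idP => [[i _ ->]|Bpi].
  by rewrite pblock_mem// (cover_partition pip) inE.
have /set0Pn[i0 Bi0] := partition_neq0 pip Bpi.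
case: (@arg_minnP _ i0 (mem B) val Bi0) => i Bi imin.
have e := def_pblock (partition_trivIset pip) Bpi Bi.
exists i => //; rewrite mem_filter e mem_enum andbT.
by apply/forall_inP => j Bj; exact: imin.
Qed.

Lemma blocks_perm n (pi : {set {set 'I_n}}) :
  is_part pi -> perm_eq (blocks pi) (enum pi).
Proof.
move=> pip; apply: uniq_perm; rewrite ?blocks_uniq ?enum_uniq// => B.
by rewrite mem_blocks// mem_enum.
Qed.

(** A rank of weight [c] stands for the [c] elements of the block with that rank:
    the weights [1] of the elements are pushed along the map that sends an
    element to the rank of its block. *)
Lemma pattern_mass_ranked_blocks (R : realDomainType) (I : finType) M
    (pi : {set {set 'I_M}}) (rho : {set {set I}}) : is_part pi ->
  pattern_mass (fun u : 'I_M =>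
     (nth 0%N (sort geq (block_sizes pi)) u)%:R : R) rho =
  #|[set f : {ffun I -> 'I_M} | fibers (finset.pblock pi \o f) == rho]%SET|%:R.
Proof.
move=> pip.
pose bs := sort (relpre (fun B : {set 'I_M} => #|B|) geq) (blocks pi).
have bs_perm : perm_eq bs (blocks pi) by rewrite perm_sort.
have ubs : uniq bs by rewrite (perm_uniq bs_perm) blocks_uniq.
have mbs x : finset.pblock pi x \in bs.
  by rewrite (perm_mem bs_perm) mem_blocks// pblock_mem// (cover_partition pip) inE.
have szbs : (size bs <= M)%N.
  rewrite (perm_size bs_perm) /blocks size_map size_filter.
  by apply: leq_trans (count_size _ _) _; rewrite size_enum_ord.
have b_lt x : (index (finset.pblock pi x) bs < M)%N.
  by apply: leq_trans szbs; rewrite index_mem.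
pose b x := Ordinal (b_lt x).
have bE x y : (b x == b y) = (finset.pblock pi x == finset.pblock pi y).
  by rewrite -val_eqE /=; apply/eqP/eqP => [e|->//]; rewrite -(nth_index finset.set0 (mbs x)) e nth_index.
have := pattern_mass_push b (fun=> 1 : R) rho.
have -> : pattern_mass (fun u => \sum_(t | b t == u) 1) rho =
   pattern_mass (fun u : 'I_M =>
     (nth 0%N (sort geq (block_sizes pi)) u)%:R : R) rho.
  apply: eq_bigr => j _; apply: eq_bigr => i _; move: (j i) => u {j i}.
  rewrite sumr_const (eq_card (B := [pred t | b t == u]))//; congr (_%:R).
  rewrite /block_sizes sort_map -/bs.
  have [us|us] := ltnP u (size bs); last first.
    rewrite nth_default ?size_map// eq_card0// => x; apply/negbTE.
    rewrite inE -val_eqE /= neq_ltn; apply/orP; left.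
    by apply: leq_trans us; rewrite index_mem.
  rewrite (nth_map finset.set0)//; apply: eq_card => x.
  rewrite inE -val_eqE /=.
  have Bpi : nth finset.set0 bs u \in pi.
    by rewrite -mem_blocks// -(perm_mem bs_perm) mem_nth.
  apply/eqP/idP => [<-|xB].
    by rewrite nth_index// mem_pblock_part.
  by rewrite (def_pblock (partition_trivIset pip) Bpi xB) index_uniq.
move=> ->; rewrite -sum1_card natr_sum; apply: eq_big => [j|j _].
  rewrite inE; congr (_ == rho); apply: eq_fibers => i i'; exact: bE.
by rewrite big1.
Qed.

(** A map from [n] points to [M] points fails to be injective on one of at most
    [n ^ 2] pairs, and on a given pair for a fraction [1 / M] of the maps. The
    division by [M] is cleared to stay among natural numbers. *)
Lemma falling_gap M n : ((M ^ n - M ^_ n) * M <= n ^ 2 * M ^ n)%N.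
Proof.
elim: n => [|n IH]; first by rewrite ffactn0 expn0 subnn.
have h : (M ^_ n <= M ^ n)%N.
  by elim: n {IH} => // n IH; rewrite ffactnSr expnSr leq_mul// leq_subr.
rewrite ffactnSr expnSr.
move: IH h; set A := (M ^ n)%N; set B := (M ^_ n)%N => IH h.
have [Mn|nM] := leqP M n.
  have -> : (M - n = 0)%N by lia.
  by nia.
have [d Ad] : exists d, (A = B + d)%N by exists (A - B)%N; lia.
have [c Mc] : exists c, M = (n + c)%N by exists (M - n)%N; lia.
have e1 : (M - n = c)%N by lia.
have e2 : (A - B = d)%N by lia.
rewrite e2 in IH; rewrite e1.
have -> : (A * M - B * c = d * M + B * n)%N by rewrite Ad Mc; nia.
nia.
Qed.

(** * Means of bounded random variables *)

Section BoundedExpectation.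
Context (R : realType) (d : measure_display) (Om : measurableType d)
  (P : probability Om R).
Implicit Types (f g : Om -> R) (A : set Om).

(** The random variables averaged below are all bounded, which settles
    integrability once and for all. *)
Definition bounded_rv f : Prop :=
  measurable_fun [set: Om] f /\ exists C, forall w, `|f w| <= C.

Lemma bounded_rv_cst c : bounded_rv (fun=> c).
Proof. by split; [exact: measurable_cst|exists `|c|]. Qed.

Lemma bounded_rvD f g :
  bounded_rv f -> bounded_rv g -> bounded_rv (fun w => f w + g w).
Proof.
move=> [mf [C fC]] [mg [D gD]]; split; first exact: measurable_funD.
by exists (C + D) => w; rewrite (le_trans (ler_normD _ _))// lerD.
Qed.

Lemma bounded_rvN f : bounded_rv f -> bounded_rv (fun w => - f w).
Proof.
move=> [mf [C fC]]; split; first exact: measurable_funN.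
by exists C => w; rewrite normrN.
Qed.

Lemma bounded_rvB f g :
  bounded_rv f -> bounded_rv g -> bounded_rv (fun w => f w - g w).
Proof. by move=> hf hg; apply: bounded_rvD => //; exact: bounded_rvN. Qed.

Lemma bounded_rvM f g :
  bounded_rv f -> bounded_rv g -> bounded_rv (fun w => f w * g w).
Proof.
move=> [mf [C fC]] [mg [D gD]]; split; first exact: measurable_funM.
by exists (C * D) => w; rewrite normrM ler_pM.
Qed.

Lemma bounded_rv_sum (I : Type) (r : seq I) (p : pred I) (F : I -> Om -> R) :
  (forall i, p i -> bounded_rv (F i)) ->
  bounded_rv (fun w => \sum_(i <- r | p i) F i w).
Proof.
move=> hF; elim: r => [|i r IH].
  under eq_fun do rewrite big_nil; exact: bounded_rv_cst.
have [pi|/negPf pi] := boolP (p i); under eq_fun do rewrite big_cons pi //.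
  by apply: bounded_rvD => //; exact: hF.
exact: IH.
Qed.

Lemma bounded_rv_prod (I : Type) (r : seq I) (F : I -> Om -> R) :
  (forall i, bounded_rv (F i)) ->
  bounded_rv (fun w => \prod_(i <- r) F i w).
Proof.
move=> hF; elim: r => [|i r IH].
  under eq_fun do rewrite big_nil; exact: bounded_rv_cst.
under eq_fun do rewrite big_cons.
by apply: bounded_rvM => //; exact: hF.
Qed.

Lemma bounded_rvX f n : bounded_rv f -> bounded_rv (fun w => f w ^+ n).
Proof.
move=> hf; elim: n => [|n IH].
  under eq_fun do rewrite expr0; exact: bounded_rv_cst.
by under eq_fun do rewrite exprS; apply: bounded_rvM.
Qed.

Lemma bounded_rv_indic A : measurable A -> bounded_rv (\1_A).
Proof.
move=> mA; split; first exact: measurable_indic.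
by exists 1 => w; rewrite indicE normr_nat lern1 leq_b1.
Qed.

Lemma bounded_rv_integrable f :
  bounded_rv f -> P.-integrable [set: Om] (EFin \o f).
Proof.
move=> [mf [C fC]]; apply: measurable_bounded_integrable => //.
  by rewrite (le_lt_trans (probability_le1 _ _))// ltry.
exists C; split; first exact: num_real.
by move=> x Cx y _; rewrite /= (le_trans (fC y))// ltW.
Qed.

Lemma EFin_mean f : bounded_rv f ->
  (\int[P]_w (f w)%:E)%E = (\int[P]_w f w)%:E.
Proof.
move=> hf; rewrite /Rintegral fineK//.
by apply: integrable_fin_num => //; exact: bounded_rv_integrable.
Qed.

Lemma mean_cst c : \int[P]_w c = c.
Proof. rewrite /Rintegral integral_cst//.
by rewrite [X in (_ * X)%E](_ : _ = 1%E) ?mule1//; exact: probability_setT. Qed.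

Lemma mean_sum (I : Type) (r : seq I) (p : pred I) (F : I -> Om -> R) :
  (forall i, p i -> bounded_rv (F i)) ->
  \int[P]_w (\sum_(i <- r | p i) F i w) = \sum_(i <- r | p i) \int[P]_w F i w.
Proof.
move=> hF; elim: r => [|i r IH].
  by under eq_Rintegral do rewrite big_nil; rewrite big_nil mean_cst.
have [pi|/negPf pi] := boolP (p i); under eq_Rintegral do rewrite big_cons pi;
  rewrite big_cons pi ?IH//.
rewrite RintegralD ?IH//; apply: bounded_rv_integrable; first exact: hF.
exact: bounded_rv_sum.
Qed.

Lemma meanB f g : bounded_rv f -> bounded_rv g ->
  \int[P]_w (f w - g w) = \int[P]_w f w - \int[P]_w g w.
Proof. by move=> hf hg; apply: RintegralB => //; exact: bounded_rv_integrable. Qed.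

Lemma meanZ c f : bounded_rv f ->
  \int[P]_w (c * f w) = c * \int[P]_w f w.
Proof. by move=> hf; apply: RintegralZl => //; exact: bounded_rv_integrable. Qed.

Lemma mean_indic A : measurable A -> \int[P]_w \1_A w = fine (P A).
Proof. by move=> mA; rewrite /Rintegral integral_indic// setIT. Qed.

Lemma indic_boolE (b : Om -> bool) w : \1_[set w | b w] w = (b w)%:R :> R.
Proof.
by rewrite indicE; have [pV|/negP pV] := boolP (b w); [rewrite mem_set|rewrite memNset].
Qed.

Lemma bounded_rv_bool (b : Om -> bool) : measurable [set w | b w] ->
  bounded_rv (fun w => (b w)%:R).
Proof.
move=> mb; have := bounded_rv_indic mb; congr bounded_rv; apply/funext => w.
exact: indic_boolE.
Qed.

Lemma mean_bool (b : Om -> bool) : measurable [set w | b w] ->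
  \int[P]_w (b w)%:R = fine (P [set w | b w]).
Proof.
move=> mb; rewrite -mean_indic//.
by apply: eq_Rintegral => w _; rewrite indic_boolE.
Qed.

Lemma mean_ae_eq f g : bounded_rv f -> bounded_rv g ->
  {ae P, forall w, f w = g w} -> \int[P]_w f w = \int[P]_w g w.
Proof.
move=> hf hg fg; rewrite /Rintegral; congr fine.
apply: ae_eq_integral => //.
- by apply/measurable_EFinP; exact: hf.1.
- by apply/measurable_EFinP; exact: hg.1.
- by apply: filterS fg => w -> _.
Qed.

Lemma mean_ae_le f g : bounded_rv f -> bounded_rv g ->
  {ae P, forall w, f w <= g w} -> \int[P]_w f w <= \int[P]_w g w.
Proof.
move=> hf hg fg.
have hM : bounded_rv (fun w => Num.max (f w) (g w)).
  case: hf hg => mf [C fC] [mg [D gD]]; split; first exact: measurable_maxr.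
  exists (C + D) => w.
  have C0 : 0 <= C by rewrite (le_trans _ (fC w)).
  have D0 : 0 <= D by rewrite (le_trans _ (gD w)).
  have := fC w; have := gD w.
  by rewrite maxEle; case: ifP => _ gw fw; [apply: (le_trans gw)|apply: (le_trans fw)];
    rewrite (lerDl, lerDr).
rewrite [leRHS](mean_ae_eq hg hM).
  apply: le_Rintegral => //; try exact: bounded_rv_integrable.
  by move=> w _; rewrite le_max lexx.
by apply: filterS fg => w /max_idPr ->.
Qed.

Lemma mean_ge0 f : (forall w, 0 <= f w) -> 0 <= \int[P]_w f w.
Proof. by move=> f0; apply: Rintegral_ge0. Qed.

Lemma bounded_convergence (F : nat -> Om -> R) f (C : R) :
  (forall n, bounded_rv (F n)) -> {ae P, forall w, forall n, `|F n w| <= C} ->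
  bounded_rv f -> {ae P, forall w, F n w @[n --> \oo] --> f w} ->
  (\int[P]_w F n w) @[n --> \oo] --> \int[P]_w f w.
Proof.
move=> hF FC hf Ff.
suff : (\int[P]_w (F n w)%:E)%E @[n --> \oo] --> (\int[P]_w f w)%:E.
  by move=> /fine_cvgP[_].
rewrite -EFin_mean//.
have [] := @dominated_convergence _ _ _ P setT measurableT
  (fun n => EFin \o F n) (EFin \o f) (cst C%:E) => //.
- by move=> n; apply/measurable_EFinP; exact: (hF n).1.
- by apply/measurable_EFinP; exact: hf.1.
- by apply: filterS Ff => w Fw _ /=; apply: cvg_EFin => //; exact: nearW.
- exact: (bounded_rv_integrable (bounded_rv_cst C)).
- by apply: filterS FC => w Fw n _ /=; rewrite lee_fin.
Qed.

End BoundedExpectation.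

(** * Equality of laws and independence *)

Section Laws.
Context (R : realType) (d1 d2 d : measure_display) (Om1 : measurableType d1)
  (Om2 : measurableType d2) (T : measurableType d)
  (P1 : probability Om1 R) (P2 : probability Om2 R).

(** Both integrals are integrals of [g] against the common image measure. *)
Lemma eq_law_integral (X : Om1 -> T) (Y : Om2 -> T) (g : T -> \bar R) :
  measurable_fun [set: Om1] X -> measurable_fun [set: Om2] Y ->
  (forall A, measurable A -> P1 (X @^-1` A) = P2 (Y @^-1` A)) ->
  measurable_fun [set: T] g -> (forall t, 0 <= g t)%E ->
  (\int[P1]_w g (X w) = \int[P2]_w g (Y w))%E.
Proof.
move=> mX mY XY mg g0.
have hX := @ge0_integral_pushforward _ _ _ _ _ X mX P1 setT g measurableT mg
  (fun t _ => g0 t).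
have hY := @ge0_integral_pushforward _ _ _ _ _ Y mY P2 setT g measurableT mg
  (fun t _ => g0 t).
rewrite !preimage_setT in hX hY; rewrite -[LHS]hX -[RHS]hY.
by apply: eq_measure_integral => A mA _; exact: XY.
Qed.

Lemma eq_law_mean (X : Om1 -> T) (Y : Om2 -> T) (g : T -> R) :
  measurable_fun [set: Om1] X -> measurable_fun [set: Om2] Y ->
  (forall A, measurable A -> P1 (X @^-1` A) = P2 (Y @^-1` A)) ->
  measurable_fun [set: T] g -> (forall t, 0 <= g t) ->
  \int[P1]_w g (X w) = \int[P2]_w g (Y w).
Proof.
move=> mX mY XY mg g0; rewrite /Rintegral; congr fine.
apply: (eq_law_integral (g := EFin \o g)) => //.
exact/measurable_EFinP.
Qed.

End Laws.

Section Independence.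
Context (R : realType) (d d1 d2 : measure_display) (Om : measurableType d)
  (T1 : measurableType d1) (T2 : measurableType d2) (P : probability Om R).
Variables (X : {mfun Om >-> T1}) (Y : {mfun Om >-> T2}).
Hypothesis indep : forall A B, measurable A -> measurable B ->
  P ((X @^-1` A) `&` (Y @^-1` B)) = (P (X @^-1` A) * P (Y @^-1` B))%E.

(** A finite measure on a product is determined by its values on rectangles. *)
Lemma indep_product_law (S : set (T1 * T2)) : measurable S ->
  P ((fun w => (X w, Y w)) @^-1` S) =
  (distribution P X \x distribution P Y)%E S.
Proof.
move=> mS.
have mXY : measurable_fun [set: Om] (fun w => (X w, Y w)).
  by apply: measurable_fun_pair.
pose W : {mfun Om >-> (T1 * T2)%type} :=
  HB.pack (fun w => (X w, Y w)) (isMeasurableFun.Build _ _ _ _ _ mXY).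
have := @product_measure_unique _ _ T1 T2 R (distribution P X)
  (distribution P Y) (distribution P W).
move=> -> // A B mA mB; exact: indep.
Qed.

Lemma indep_mean (g : T1 -> R) B : measurable_fun [set: T1] g ->
  (forall t, 0 <= g t) -> bounded_rv (g \o X) -> measurable B ->
  \int[P]_w (g (X w) * \1_B (Y w)) =
  (\int[P]_w g (X w)) * fine (P (Y @^-1` B)).
Proof.
move=> mg g0 bg mB.
pose f (z : T1 * T2) := (g z.1 * \1_B z.2)%:E.
have mf : measurable_fun setT f.
  apply/measurable_EFinP/measurable_funM; first exact: measurableT_comp.
  by apply: measurableT_comp => //; exact: measurable_indic.
have f0 z : (0 <= f z)%E by rewrite lee_fin mulr_ge0.
have mXY : measurable_fun [set: Om] (fun w => (X w, Y w)).
  by apply: measurable_fun_pair.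
have h := @ge0_integral_pushforward _ _ _ _ _ _ mXY P setT f measurableT mf
  (fun t _ => f0 t).
rewrite preimage_setT in h.
rewrite /Rintegral -[X in fine X = _]h.
rewrite (@eq_measure_integral _ _ _ setT (distribution P X \x distribution P Y)%E);
  last by move=> A mA _; exact: indep_product_law.
rewrite fubini_tonelli1// /fubini_F /f /=.
have e x : (\int[distribution P Y]_y (g x * \1_B y)%:E =
    (g x)%:E * (P (Y @^-1` B)))%E.
  under eq_integral do rewrite EFinM.
  rewrite ge0_integralZl//; last 2 first.
  - by apply/measurable_EFinP; exact: measurable_indic.
  - by rewrite lee_fin.
  by rewrite integral_indic// setIT.
under eq_integral do rewrite e.
have fB : (P (Y @^-1` B)) \is a fin_num.
  apply: fin_num_measure.
  by rewrite -[X in measurable X]setTI; exact: (measurable_funPT Y).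
rewrite -(fineK fB) ge0_integralZr//; last 3 first.
- exact/measurable_EFinP.
- by move=> t _; rewrite lee_fin.
- by rewrite lee_fin fine_ge0.
have := @ge0_integral_pushforward _ _ _ _ _ X (measurable_funPT X) P setT
  (EFin \o g) measurableT ((measurable_EFinP _ _).2 mg) _.
rewrite preimage_setT => hX.
rewrite [X in (X * _)%E](_ : _ = (\int[P]_w g (X w))%:E); last first.
  rewrite -(EFin_mean P bg); apply: hX => t _; first by rewrite lee_fin.
by rewrite -EFinM /= /Rintegral.
Qed.

End Independence.

(** * Random variables with finitely many values *)

Section FiniteValued.
Context (R : realType) (d : measure_display) (Om : measurableType d)
  (P : probability Om R) (F : finType).
Implicit Type V : Om -> F.

Definition finite_rv V := forall v, measurable [set w | V w = v].

Lemma finite_rv_pred V (p : pred F) : finite_rv V -> measurable [set w | p (V w)].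
Proof.
move=> mV; rewrite (_ : [set w | p (V w)] =
    \bigcup_(v in [set v | p v]) [set w | V w = v]).
  by apply: fin_bigcup_measurable => // v _; exact: mV.
by apply/seteqP; split=> [w pw|w [v /= pv ->]//]; exists (V w).
Qed.

Lemma finite_rv_decomp V (phi : F -> R) w :
  phi (V w) = \sum_v phi v * \1_[set w | V w = v] w.
Proof.
rewrite (bigD1 (V w)) //= indicE mem_set// mulr1.
rewrite big1 ?addr0// => v vV; rewrite indicE memNset ?mulr0// => /= h.
by rewrite h eqxx in vV.
Qed.

Lemma finite_rv_bounded V (phi : F -> R) :
  finite_rv V -> bounded_rv (fun w => phi (V w)).
Proof.
move=> mV; under eq_fun do rewrite finite_rv_decomp.
apply: bounded_rv_sum => v _; apply: bounded_rvM; first exact: bounded_rv_cst.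
exact: bounded_rv_indic.
Qed.

Lemma finite_rv_mean V (phi : F -> R) : finite_rv V ->
  \int[P]_w phi (V w) = \sum_v phi v * fine (P [set w | V w = v]).
Proof.
move=> mV; under eq_Rintegral do rewrite finite_rv_decomp.
rewrite mean_sum; last first.
  move=> v _; apply: bounded_rvM; first exact: bounded_rv_cst.
  exact: bounded_rv_indic.
apply: eq_bigr => v _; rewrite meanZ ?mean_indic//.
exact: bounded_rv_indic.
Qed.

Lemma finite_rv_prob V (p : pred F) : finite_rv V ->
  fine (P [set w | p (V w)]) = \sum_(v | p v) fine (P [set w | V w = v]).
Proof.
move=> mV; rewrite -mean_bool; last exact: finite_rv_pred.
rewrite [RHS]big_mkcond /=.
under eq_bigr => v _ do rewrite -mulrb -mulr_natl.
exact: (finite_rv_mean (fun v => (p v)%:R) mV).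
Qed.

End FiniteValued.

Lemma fine_probK (R : realType) (d : measure_display) (Om : measurableType d)
  (P : probability Om R) A : measurable A -> (fine (P A))%:E = P A.
Proof. by move=> mA; rewrite fineK// fin_num_measure. Qed.

Lemma finite_rv_comp (d : measure_display) (Om : measurableType d)
    (F G : finType) (V : Om -> F) (phi : F -> G) :
  finite_rv V -> finite_rv (phi \o V).
Proof.
move=> mV v; have := finite_rv_pred (fun u => phi u == v) mV.
congr measurable; apply/seteqP; split=> w /=; [by move/eqP|by move->].
Qed.

(** * Restriction and relabelling of partitions *)

Lemma restrict_fibers m n (le_mn : (m <= n)%N) (pi : {set {set 'I_n}}) :
  is_part pi ->
  restrict_partition le_mn pi = fibers (finset.pblock pi \o widen_ord le_mn).
Proof.
move=> pip; apply/setP => C; rewrite !inE; apply/andP/imsetP.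
  move=> [/set0Pn[i iC] /imsetP[B Bpi CE]]; exists i; rewrite ?inE//.
  apply/setP => j; rewrite CE !inE /= -(mem_pblock_part _ _ pip).
  move: iC; rewrite CE inE => iB.
  by rewrite (def_pblock (partition_trivIset pip) Bpi iB).
move=> [i _ ->]; split.
  by apply/set0Pn; exists i; rewrite !inE /=.
apply/imsetP; exists (finset.pblock pi (widen_ord le_mn i)).
  by rewrite pblock_mem// (cover_partition pip) inE.
by apply/setP => j; rewrite !inE /= mem_pblock_part.
Qed.

Lemma perm_imset_fibers (I : finType) (s : {perm I}) (pi : {set {set I}}) :
  is_part pi ->
  [set s @: B | B : {set I} in pi]%SET = fibers (finset.pblock pi \o (s^-1)%g).
Proof.
move=> pip; apply/setP => C; apply/imsetP/imsetP.
  move=> [B Bpi ->]; have /set0Pn[i iB] := partition_neq0 pip Bpi.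
  exists (s i); rewrite ?inE//; apply/setP => j; rewrite !inE /= permK.
  rewrite (def_pblock (partition_trivIset pip) Bpi iB).
  apply/imsetP/eqP => [[x xB ->]|Be].
    by rewrite permK (def_pblock (partition_trivIset pip) Bpi xB).
  exists ((s^-1)%g j); rewrite ?permKV// Be.
  by rewrite mem_pblock_part.
move=> [i _ ->]; exists (finset.pblock pi ((s^-1)%g i)).
  by rewrite pblock_mem// (cover_partition pip) inE.
apply/setP => j; rewrite !inE /=; apply/eqP/imsetP => [ij|[x xi ->]].
  exists ((s^-1)%g j); rewrite ?permKV//.
  by rewrite mem_pblock_part ?ij.
by rewrite permK; apply/eqP; rewrite -mem_pblock_part.
Qed.

(** The missing elements of the codomain, listed in any order after the image of
    [f], complete [f] to a permutation. *)
Lemma extend_injection n M (le : (n <= M)%N) (f : 'I_n -> 'I_M) :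
  injective f -> exists s : 'S_M, forall i, s (widen_ord le i) = f i.
Proof.
move=> fi; pose r := codom f ++ [seq x <- enum 'I_M | x \notin codom f].
have ur : uniq r.
  rewrite cat_uniq map_inj_uniq ?enum_uniq// filter_uniq ?enum_uniq// andbT/=.
  by apply/hasPn => x; rewrite mem_filter => /andP[].
have mr x : x \in r.
  by rewrite mem_cat mem_filter mem_enum andbT; case: (x \in codom f).
have sr : size r = M.
  have /perm_size -> : perm_eq r (enum 'I_M).
    by apply: uniq_perm; rewrite ?enum_uniq// => x; rewrite mr mem_enum.
  by rewrite size_enum_ord.
pose g (i : 'I_M) := nth i r i.
have gi : injective g.
  move=> i j; rewrite /g (set_nth_default j) ?sr// => /eqP.
  by rewrite nth_uniq ?sr// => /eqP /val_inj.
exists (perm gi) => i; rewrite permE /g /= nth_cat size_codom card_ord ltn_ord.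
by rewrite (nth_map i) ?size_enum_ord// nth_ord_enum.
Qed.

(** * Block sizes and limits of pattern masses *)

Lemma pattern_mass_scale (R : realDomainType) (I T : finType) (x : T -> R) c
    (rho : {set {set I}}) :
  pattern_mass (fun t => x t * c) rho = pattern_mass x rho * c ^+ #|I|.
Proof.
rewrite /pattern_mass mulr_suml; apply: eq_bigr => j _.
by rewrite big_split /= prodr_const.
Qed.

Lemma sumn_block_sizes n (pi : {set {set 'I_n}}) :
  is_part pi -> sumn (block_sizes pi) = n.
Proof.
move=> pip; rewrite sumnE /block_sizes big_map (perm_big _ (blocks_perm pip)) /=.
by rewrite big_enum -(card_partition pip) cardsT card_ord.
Qed.

Lemma size_block_sizes n (pi : {set {set 'I_n}}) : (size (block_sizes pi) <= n)%N.
Proof.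
rewrite size_map size_map size_filter (leq_trans (count_size _ _))//.
by rewrite size_enum_ord.
Qed.

Lemma leq_nth_sumn s j : (nth 0 s j <= sumn s)%N.
Proof.
by elim: s j => [|x s IH] [|j] //=; rewrite ?leq_addr// (leq_trans (IH j))// leq_addl.
Qed.

Lemma sum_nth_ord s M : (size s <= M)%N -> (\sum_(u < M) nth 0 s u)%N = sumn s.
Proof.
move=> sM; rewrite sumnE (big_nth 0%N) -(big_mkord predT (nth 0%N s)).
rewrite (big_cat_nat (n := size s))//= [X in (_ + X)%N]big1_seq ?addn0// => i.
by rewrite mem_index_iota => /andP[_ /andP[si _]]; rewrite nth_default.
Qed.

Lemma ranked_frequency_itv (R : realType) n (pi : {set {set 'I_n}}) j :
  is_part pi -> 0 <= ranked_frequency R pi j <= 1.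
Proof.
move=> pip; rewrite /ranked_frequency divr_ge0//=.
have [n0|n0] := posnP n.
  have -> : n%:R = 0 :> R by rewrite n0.
  by rewrite invr0 mulr0.
rewrite ler_pdivrMr ?ltr0n// mul1r ler_nat.
by rewrite (leq_trans (leq_nth_sumn _ _))// (perm_sumn (permEl (perm_sort _ _))) sumn_block_sizes.
Qed.

Lemma ranked_frequency_sum (R : realType) n (pi : {set {set 'I_n}}) :
  (0 < n)%N -> is_part pi -> \sum_(u < n) ranked_frequency R pi u = 1.
Proof.
move=> n0 pip; rewrite -mulr_suml -natr_sum sum_nth_ord ?size_sort ?size_block_sizes//.
by rewrite (perm_sumn (permEl (perm_sort _ _))) sumn_block_sizes// divff// pnatr_eq0 -lt0n.
Qed.

Lemma cvg_sum_seq (R : realType) (I : Type) (r : seq I) (p : pred I)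
    (F : I -> nat -> R) (l : I -> R) : (forall i, p i -> F i m @[m --> \oo] --> l i) ->
  (\sum_(i <- r | p i) F i m) @[m --> \oo] --> \sum_(i <- r | p i) l i.
Proof.
move=> h; elim: r => [|i r IH].
  by rewrite big_nil; under eq_fun do rewrite big_nil; exact: cvg_cst.
rewrite big_cons; have [pi|/negPf pi] := boolP (p i);
  under eq_fun do rewrite big_cons pi.
  by apply: cvgD => //; exact: h.
exact: IH.
Qed.

Lemma cvg_prod_seq (R : realType) (I : Type) (r : seq I)
    (F : I -> nat -> R) (l : I -> R) : (forall i, F i m @[m --> \oo] --> l i) ->
  (\prod_(i <- r) F i m) @[m --> \oo] --> \prod_(i <- r) l i.
Proof.
move=> h; elim: r => [|i r IH].
  by rewrite big_nil; under eq_fun do rewrite big_nil; exact: cvg_cst.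
rewrite big_cons; under eq_fun do rewrite big_cons.
by apply: cvgM.
Qed.

Lemma cvg_pattern_mass (R : realType) (I T : finType) (x : nat -> T -> R)
    (y : T -> R) (rho : {set {set I}}) : (forall t, x m t @[m --> \oo] --> y t) ->
  pattern_mass (x m) rho @[m --> \oo] --> pattern_mass y rho.
Proof.
by move=> xy; apply: cvg_sum_seq => j _; apply: cvg_prod_seq => i.
Qed.

Lemma cvg_exp_seq (R : realType) (x : nat -> R) (y : R) n : x m @[m --> \oo] --> y ->
  x m ^+ n @[m --> \oo] --> y ^+ n.
Proof.
move=> xy; elim: n => [|n IH].
  by under eq_fun do rewrite expr0; exact: cvg_cst.
by rewrite exprS; under eq_fun do rewrite exprS; apply: cvgM.
Qed.

Lemma bounded_pattern_mass (R : realType) (d : measure_display)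
    (Om : measurableType d) (I T : finType) (x : T -> Om -> R) (rho : {set {set I}}) :
  (forall t, bounded_rv (x t)) ->
  bounded_rv (fun w => pattern_mass (x ^~ w) rho).
Proof.
by move=> hx; apply: bounded_rv_sum => j _; apply: bounded_rv_prod => i.
Qed.

(** Ranked weights are constrained almost surely only, whereas the transfer of
    means between equal laws wants a function bounded everywhere; truncation to
    the unit interval provides it without changing the weights. *)
Definition clip (R : realType) (x : R) : R := Num.max 0 (Num.min x 1).

Lemma clip_itv (R : realType) (x : R) : 0 <= clip x <= 1.
Proof. by rewrite /clip le_max lexx /= ge_max ler01 ge_min lexx orbT. Qed.

Lemma clip_id (R : realType) (x : R) : 0 <= x <= 1 -> clip x = x.
Proof. by move=> /andP[x0 x1]; rewrite /clip (min_idPl x1) (max_idPr x0). Qed.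

Lemma measurable_clip (R : realType) (d : measure_display) (Om : measurableType d)
    (f : Om -> R) : measurable_fun [set: Om] f ->
  measurable_fun [set: Om] (fun w => clip (f w)).
Proof.
move=> mf; apply: measurable_maxr; first exact: measurable_cst.
by apply: measurable_minr => //; exact: measurable_cst.
Qed.

Lemma bounded_rv_clip (R : realType) (d : measure_display) (Om : measurableType d)
    (f : Om -> R) : measurable_fun [set: Om] f ->
  bounded_rv (fun w => clip (f w)).
Proof.
move=> mf; split; first exact: measurable_clip.
by exists 1 => w; have /andP[c0 c1] := clip_itv (f w); rewrite ger0_norm.
Qed.

(** * From an EPPF to the ranked weights *)

Section Eppf.
Context (R : realType) (d : measure_display) (Om : measurableType d)
  (P : probability Om R) (Pi : forall n, Om -> {set {set 'I_n}})
  (q : seq nat -> R).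
Hypothesis eppf : exchangeable_partition_with_eppf P Pi q.

Lemma eppf_part n w : is_part (Pi n w).
Proof. by case: eppf => -[h _ _] _ _; exact: h. Qed.

Lemma eppf_finite_rv n : finite_rv (Pi n).
Proof. by case: eppf => -[_ h _] _ _; exact: h. Qed.

Lemma eppf_prob n (rho : {set {set 'I_n}}) : is_part rho ->
  fine (P [set w | Pi n w = rho]) = q (block_sizes rho).
Proof. by case: eppf => _ _ [_ h] rhop; rewrite h. Qed.

(** A permutation carries the first [n] elements to the elements listed by [f], and
    exchangeability lets it act without changing the law. *)
Lemma eppf_pattern_injection n M (f : 'I_n -> 'I_M) (rho : {set {set 'I_n}}) :
  injective f -> is_part rho ->
  fine (P [set w | fibers (finset.pblock (Pi M w) \o f) == rho]) =
  q (block_sizes rho).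
Proof.
move=> fi rhop.
have le : (n <= M)%N by have := leq_card f fi; rewrite !card_ord.
have [s sf] := extend_injection le fi.
pose act (pi : {set {set 'I_M}}) : {set {set 'I_M}} :=
  [set (s^-1)%g @: B | B : {set 'I_M} in pi]%SET.
have actp w : is_part (act (Pi M w)).
  by rewrite /act perm_imset_fibers ?fibers_partition//; exact: eppf_part.
have resE w : fibers (finset.pblock (Pi M w) \o f) =
    restrict_partition le (act (Pi M w)).
  rewrite restrict_fibers//; apply: eq_fibers => i j /=.
  rewrite -!(mem_pblock_part _ _ (actp w)) /act perm_imset_fibers; last exact: eppf_part.
  by rewrite mem_pblock_fibers /= invgK !sf.
under eq_set do rewrite resE.
have -> : fine (P [set w | restrict_partition le (act (Pi M w)) == rho]) =
          fine (P [set w | restrict_partition le (Pi M w) == rho]).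
  rewrite (finite_rv_prob P (fun pi => restrict_partition le pi == rho)
     (finite_rv_comp act (@eppf_finite_rv M))).
  rewrite (finite_rv_prob P (fun pi => restrict_partition le pi == rho)
     (@eppf_finite_rv M)).
  by apply: eq_bigr => pi _; case: eppf => _ ex _; rewrite -(ex M (s^-1)%g pi).
rewrite -eppf_prob//; congr (fine (P _)); apply/seteqP.
case: eppf => -[_ _ res] _ _.
by split => w /=; rewrite -res => /eqP.
Qed.

Lemma eppf_itv n (rho : {set {set 'I_n}}) : is_part rho ->
  0 <= q (block_sizes rho) <= 1.
Proof.
move=> rhop; rewrite -eppf_prob// fine_ge0//=.
rewrite -lee_fin fine_probK; last exact: eppf_finite_rv.
by apply: probability_le1; exact: eppf_finite_rv.
Qed.

(** The mean pattern mass is the probability that a uniform sample with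
    replacement of [n] elements of ['I_M], independent of [Pi M], meets the blocks
    of [Pi M] in the pattern [rho]. Each injective sample does so with probability
    exactly [q (block_sizes rho)], and the others are a fraction of at most
    [n ^ 2 / M]. *)
Lemma mean_ranked_pattern n M (rho : {set {set 'I_n}}) :
  (0 < M)%N -> is_part rho ->
  `|\int[P]_w pattern_mass (fun u : 'I_M => ranked_frequency R (Pi M w) u) rho
    - q (block_sizes rho)| <= (n ^ 2)%:R / M%:R.
Proof.
move=> M0 rhop.
pose b (f : {ffun 'I_n -> 'I_M}) w := fibers (finset.pblock (Pi M w) \o f) == rho.
have mb f : measurable [set w | b f w].
  exact: (finite_rv_pred (fun pi => fibers (finset.pblock pi \o f) == rho)
    (@eppf_finite_rv M)).
have bb f : bounded_rv (fun w => (b f w)%:R : R).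
  exact: (finite_rv_bounded (fun pi => (fibers (finset.pblock pi \o f) == rho)%:R)
    (@eppf_finite_rv M)).
pose c : R := (M%:R ^+ n)^-1.
have -> : \int[P]_w pattern_mass (fun u : 'I_M => ranked_frequency R (Pi M w) u) rho
   = c * \sum_f fine (P [set w | b f w]).
  under [in RHS]eq_bigr => f _ do rewrite -(mean_bool P (mb f)).
  rewrite -mean_sum// -meanZ; last exact: bounded_rv_sum.
  apply: eq_Rintegral => w _.
  rewrite /ranked_frequency (@pattern_mass_scale R _ _
    (fun u : 'I_M => (nth 0%N (sort geq (block_sizes (Pi M w))) u)%:R)).
  rewrite pattern_mass_ranked_blocks; last exact: eppf_part.
  rewrite card_ord mulrC exprVn -/c; congr (_ * _).
  rewrite -sum1_card natr_sum [LHS]big_mkcond /=; apply: eq_bigr => f _.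
  by rewrite inE /b; case: (_ == _).
set a := q _; have /andP[a0 a1] : 0 <= a <= 1 by exact: eppf_itv.
rewrite (bigID (fun f : {ffun 'I_n -> 'I_M} => injectiveb f)) /=.
rewrite (eq_bigr (fun=> a)); last first.
  by move=> f /injectiveP fi; exact: eppf_pattern_injection.
set e := \sum_(f | ~~ _) _.
have cardI : #|[pred f : {ffun 'I_n -> 'I_M} | injectiveb f]| = (M ^_ n)%N.
  by have := card_inj_ffuns 'I_n 'I_M; rewrite cardsE !card_ord.
have cardD : #|[pred f : {ffun 'I_n -> 'I_M} | ~~ injectiveb f]| = (M ^ n - M ^_ n)%N.
  have := cardC [pred f : {ffun 'I_n -> 'I_M} | injectiveb f].
  by rewrite cardI card_ffun !card_ord => <-; rewrite addKn; exact: eq_card.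
have fle : (M ^_ n <= M ^ n)%N.
  by rewrite -cardI -[in leqRHS](card_ord M) -[X in (_ <= _ ^ X)%N](card_ord n) -card_ffun max_card.
rewrite sumr_const (eq_card (B := [pred f : {ffun 'I_n -> 'I_M} | injectiveb f]))//.
rewrite cardI -[a *+ _]mulr_natl.
have e0 : 0 <= e by apply: sumr_ge0 => f _; exact: fine_ge0.
have e1 : e <= (M ^ n - M ^_ n)%N%:R.
  rewrite -cardD -sum1_card natr_sum; apply: ler_sum => f _.
  by rewrite -lee_fin fine_probK// probability_le1.
move: e0 e1; rewrite natrB// => e0 e1.
have A0 : 0 < (M ^ n)%:R :> R by rewrite ltr0n expn_gt0 M0.
have M0' : 0 < M%:R :> R by rewrite ltr0n.
have gap : ((M ^ n)%:R - (M ^_ n)%:R) * M%:R <= (n ^ 2)%:R * (M ^ n)%:R :> R.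
  by rewrite -natrB// -!natrM ler_nat falling_gap.
have BA : (M ^_ n)%:R <= (M ^ n)%:R :> R by rewrite ler_nat.
rewrite /c -natrX [_^-1 * _]mulrC.
apply: (@le_trans _ _ (((M ^ n)%:R - (M ^_ n)%:R) / (M ^ n)%:R)); last first.
  by rewrite ler_pdivrMr// mulrAC ler_pdivlMr.
rewrite ler_pdivlMr// -[X in _ * X]gtr0_norm// -normrM mulrBl divfK ?gt_eqF//.
set A := (M ^ n)%:R in A0 BA e1 *; set B := (M ^_ n)%:R in BA e1 *.
rewrite ler_norml; apply/andP; split; nra.
Qed.

(** Keep the [N] largest blocks in [mean_ranked_pattern] and let [M] grow. What is
    discarded is at most the probability that a sample leaves these blocks, which
    is the right-hand side. It cannot be dropped here: the limits of the
    frequencies may have a sum below one for every fixed [N]. *)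
Lemma mean_frequency_pattern (u : nat -> Om -> R) N n (rho : {set {set 'I_n}}) :
  (forall j, measurable_fun [set: Om] (u j)) ->
  {ae P, forall w, forall j,
     ranked_frequency R (Pi m w) j @[m --> \oo] --> u j w} ->
  is_part rho ->
  `|\int[P]_w pattern_mass (fun t : 'I_N => clip (u t w)) rho - q (block_sizes rho)|
  <= 1 - \int[P]_w (\sum_(t < N) clip (u t w)) ^+ n.
Proof.
move=> mu u_lim rhop.
pose x M t w := ranked_frequency R (Pi M w) t.
have bx M t : bounded_rv (x M t).
  exact: (finite_rv_bounded (fun pi => ranked_frequency R pi t) (@eppf_finite_rv M)).
have x01 M t w : 0 <= x M t w <= 1 by apply: ranked_frequency_itv; exact: eppf_part.
have bK (A : finType) (y : A -> Om -> R) :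
    (forall a, bounded_rv (y a)) -> bounded_rv (fun w => pattern_mass (y ^~ w) rho).
  exact: bounded_pattern_mass.
have bS (y : 'I_N -> Om -> R) :
    (forall a, bounded_rv (y a)) -> bounded_rv (fun w => (\sum_t y t w) ^+ n).
  by move=> by_; apply: bounded_rvX; apply: bounded_rv_sum => t _.
have u_lim' : {ae P, forall w, forall t, x M t w @[M --> \oo] --> clip (u t w)}.
  apply: filterS u_lim => w uw t; rewrite clip_id; first exact: uw.
  apply/andP; split.
    apply: (ler_cvg_to (cvg_cst 0) (uw t)).
    by apply: nearW => M; case/andP: (x01 M t w).
  apply: (ler_cvg_to (l' := 1) (uw t)); first exact: (cvg_cst (1 : R)).
  by apply: nearW => M; case/andP: (x01 M t w).
have K_lim : (\int[P]_w pattern_mass (fun t : 'I_N => x M t w) rho) @[M --> \oo] -->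
    \int[P]_w pattern_mass (fun t : 'I_N => clip (u t w)) rho.
  apply: (@bounded_convergence _ _ _ _ _ _ (N%:R ^+ n)) => //.
  - by move=> M; apply: (bK _ (fun (t : 'I_N) => x M t)) => t; exact: bx.
  - apply: aeW => w M; rewrite ger0_norm; last by apply: pattern_mass_ge0 => t; case/andP: (x01 M t w).
    apply: le_trans (pattern_mass_le_sum _ _) _.
      by move=> t; case/andP: (x01 M t w).
    rewrite card_ord lerXn2r ?nnegrE//.
      by apply: sumr_ge0 => t _; case/andP: (x01 M t w).
    rewrite -[leRHS]mulr1 -[X in X%:R * _]card_ord -sum1_card natr_sum mulr_suml.
    by apply: ler_sum => t _; rewrite mul1r; case/andP: (x01 M t w).
  - by apply: (bK _ (fun (t : 'I_N) w => clip (u t w))) => t; exact: bounded_rv_clip.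
  - apply: filterS u_lim' => w uw.
    by apply: (cvg_pattern_mass (x := fun M (t : 'I_N) => x M t w)) => t; exact: uw.
have S_lim : (\int[P]_w (\sum_(t < N) x M t w) ^+ n) @[M --> \oo] -->
    \int[P]_w (\sum_(t < N) clip (u t w)) ^+ n.
  apply: (@bounded_convergence _ _ _ _ _ _ (N%:R ^+ n)) => //.
  - by move=> M; apply: (bS (fun (t : 'I_N) => x M t)) => t; exact: bx.
  - apply: aeW => w M; have s0 : 0 <= \sum_(t < N) x M t w.
      by apply: sumr_ge0 => t _; case/andP: (x01 M t w).
    rewrite ger0_norm ?exprn_ge0// lerXn2r ?nnegrE//.
    rewrite -[leRHS]mulr1 -[X in X%:R * _]card_ord -sum1_card natr_sum mulr_suml.
    by apply: ler_sum => t _; rewrite mul1r; case/andP: (x01 M t w).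
  - by apply: (bS (fun (t : 'I_N) w => clip (u t w))) => t; exact: bounded_rv_clip.
  - apply: filterS u_lim' => w uw; apply: cvg_exp_seq.
    by apply: cvg_sum_seq => t _; exact: uw.
have lim1 : `|\int[P]_w pattern_mass (fun t : 'I_N => x M t w) rho - q (block_sizes rho)|
   @[M --> \oo] --> `|\int[P]_w pattern_mass (fun t : 'I_N => clip (u t w)) rho - q (block_sizes rho)|.
  by apply: cvg_norm; apply: cvgB => //; exact: cvg_cst.
(* The index is shifted because the harmonic sequence starts at [1 / 1]. *)
have lim2 : ((n ^ 2)%:R * @harmonic R M +
    (1 - \int[P]_w (\sum_(t < N) x M.+1 t w) ^+ n)) @[M --> \oo] -->
    (n ^ 2)%:R * 0 + (1 - \int[P]_w (\sum_(t < N) clip (u t w)) ^+ n).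
  apply: cvgD; first by apply: cvgMl_tmp; exact: cvg_harmonic.
  by apply: cvgB; [exact: cvg_cst|rewrite (cvg_shiftS (fun M => \int[P]_w (\sum_(t < N) x M t w) ^+ n))].
move: lim2; rewrite mulr0 add0r => lim2.
move: lim1; rewrite -cvg_shiftS /= => lim1.
apply: (ler_cvg_to lim1 lim2); near=> M.
have NM : (N <= M.+1)%N by near: M; exists N => // k /= /leqW.
have h := mean_ranked_pattern (ltn0Sn M) rhop.
apply: le_trans (ler_distD (\int[P]_w pattern_mass
  (fun t : 'I_M.+1 => x M.+1 t w) rho) _ _) _.
rewrite addrC lerD//.
rewrite distrC -meanB; last 2 first.
- by apply: (bK _ (fun (t : 'I_M.+1) => x M.+1 t)) => t.
- by apply: (bK _ (fun (t : 'I_N) => x M.+1 t)) => t.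
have bS' : bounded_rv (fun w => 1 - (\sum_(t < N) x M.+1 t w) ^+ n).
  apply: bounded_rvB; first exact: bounded_rv_cst.
  by apply: (bS (fun (t : 'I_N) => x M.+1 t)) => t.
have -> : 1 - \int[P]_w (\sum_(t < N) x M.+1 t w) ^+ n =
    \int[P]_w (1 - (\sum_(t < N) x M.+1 t w) ^+ n).
  rewrite meanB ?mean_cst//; first exact: bounded_rv_cst.
  by apply: (bS (fun (t : 'I_N) => x M.+1 t)) => t.
have hw w := @pattern_mass_widen R _ (x M.+1 ^~ w) rho _ _ NM
  (fun t => proj1 (andP (x01 M.+1 t w))).
rewrite ger0_norm; last first.
  by apply: mean_ge0 => w; have [le _ _] := hw w; rewrite subr_ge0.
apply: mean_ae_le => //.
  apply: bounded_rvB.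
    by apply: (bK _ (fun (t : 'I_M.+1) => x M.+1 t)) => t.
  by apply: (bK _ (fun (t : 'I_N) => x M.+1 t)) => t.
apply: aeW => w; have [_ _] := hw w.
by rewrite ranked_frequency_sum ?expr1n ?card_ord//; exact: eppf_part.
Unshelve. all: by end_near. Qed.

End Eppf.

(** * Rearrangement of the weights *)

(** Positive values occur equally often in [p] and in [pd], so one bijection for
    each value glues to an injection of the support of [p]. *)
Lemma card_eq_transport (R : realType) (p pd : nat -> R) :
  (forall x, 0 < x -> ([set i | pd i = x] #= [set i | p i = x])%card) ->
  exists2 h : nat -> nat, (forall i, 0 < p i -> pd (h i) = p i) &
    {in [pred i | 0 < p i] &, injective h}.
Proof.
move=> card_pq.
have /choice[g hg] : forall x : R, exists g : nat -> nat, 0 < x ->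
    set_bij [set i | p i = x] [set i | pd i = x] g.
  move=> x; have [x0|x0] := ltP 0 x; last by exists id.
  have := card_pq x x0; rewrite card_eq_sym => /card_set_bijP[g gb].
  by exists g.
exists (fun i => g (p i) i).
  by move=> i pi; have [+ _ _] := hg _ pi; apply.
move=> i j; rewrite !inE => pi pj e.
have [fi inji _] := hg _ pi; have [fj _ _] := hg _ pj.
have pij : p i = p j by rewrite -(fi i erefl) -[RHS](fj j erefl) e.
by apply: inji; rewrite ?inE//= e pij.
Qed.

Section Rearrangement.
Variables (R : realType) (I : finType) (rho : {set {set I}}).
Implicit Types p pd : nat -> R.

(** The part of a decreasing rearrangement that ignores the order, which makes
    the relation symmetric. *)
Definition rearranged p pd : Prop :=
  [/\ forall j, 0 <= p j, forall j, 0 <= pd j &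
      forall x, 0 < x -> ([set i | pd i = x] #= [set i | p i = x])%card].

Lemma rearranged_sym p pd : rearranged p pd -> rearranged pd p.
Proof. by move=> [? ? h]; split=> // x x0; rewrite card_eq_sym h. Qed.

Lemma pattern_mass_rearranged_le p pd N : rearranged p pd ->
  exists M, pattern_mass (fun t : 'I_N => p t) rho <=
            pattern_mass (fun t : 'I_M => pd t) rho /\
            \sum_(t < N) p t <= \sum_(t < M) pd t.
Proof.
move=> [p0 pd0 /card_eq_transport[h ph hi]].
pose M := (\max_(t < N) h t).+1; exists M.
have hM (t : 'I_N) : (h t < M)%N by rewrite ltnS (leq_bigmax t).
have [] := @pattern_mass_supp_le R I _ _ (fun t : 'I_N => Ordinal (hM t))
   (fun t : 'I_N => p t) (fun t : 'I_M => pd t) rho => //.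
  move=> t t'; rewrite !inE => pt pt' /(congr1 val) /= e; apply: val_inj.
  by apply: hi => //; rewrite inE lt_neqAle eq_sym ?pt ?pt' p0.
by move=> t pt /=; rewrite ph// lt_neqAle eq_sym pt p0.
Qed.

(** Each term of [g] lies below the limit [l] of [f], and the terms of [f], which
    come close to [l], lie below terms of [g]. *)
Lemma cofinal_cvg (f g : nat -> R) (l : R) :
  {homo f : n m / (n <= m)%N >-> n <= m} -> {homo g : n m / (n <= m)%N >-> n <= m} ->
  (forall N, exists M, f N <= g M) -> (forall N, exists M, g N <= f M) ->
  f n @[n --> \oo] --> l -> g n @[n --> \oo] --> l.
Proof.
move=> fm gm fg gf fl.
have fle n : f n <= l.
  have <- : limn f = l by apply/cvg_lim.
  by apply: nondecreasing_cvgn_le => //; apply/cvg_ex; exists l.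
have gle n : g n <= l by have [M /le_trans] := gf n; apply.
apply/cvgrPdist_le => e e0.
move/cvgrPdist_le : fl => /(_ e e0) [N _ hN].
have [M fgM] := fg N; exists M => // k /= Mk.
rewrite ger0_norm ?subr_ge0// lerBlDr -lerBlDl.
apply: le_trans (gm _ _ Mk); apply: le_trans fgM.
have := hN N (leqnn _); rewrite ger0_norm ?subr_ge0// => ?.
by rewrite lerBlDl addrC -lerBlDl.
Qed.

(** Finitely many positive weights of one sequence occur among finitely many
    weights of the other, so the partial sums and the partial pattern masses of
    the two are mutually dominated. *)
Lemma pattern_mass_rearranged p pd : rearranged p pd ->
  (\sum_(t < N) p t) @[N --> \oo] --> (1 : R) ->
  [/\ (\sum_(t < N) pd t) @[N --> \oo] --> (1 : R),
      forall N, 0 <= \sum_(t < N) p t <= 1,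
      forall N, 0 <= \sum_(t < N) pd t <= 1 &
      (pattern_mass (fun t : 'I_N => p t) rho -
       pattern_mass (fun t : 'I_N => pd t) rho) @[N --> \oo] --> (0 : R)].
Proof.
move=> hp p1; have [p0 pd0 _] := hp; have hp' := rearranged_sym hp.
have mono (r : nat -> R) : (forall j, 0 <= r j) ->
    {homo (fun N => \sum_(t < N) r t) : n m / (n <= m)%N >-> n <= m}.
  by move=> r0 n m nm; have [_] := pattern_mass_widen rho nm r0.
have monoK (r : nat -> R) : (forall j, 0 <= r j) ->
    {homo (fun N => pattern_mass (fun t : 'I_N => r t) rho) :
      n m / (n <= m)%N >-> n <= m}.
  by move=> r0 n m nm; have [] := pattern_mass_widen rho nm r0.
have pd1 : (\sum_(t < N) pd t) @[N --> \oo] --> (1 : R).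
  apply: (@cofinal_cvg (fun N => \sum_(t < N) p t)) => //; try exact: mono.
  - by move=> N; have [M [_]] := pattern_mass_rearranged_le N hp; exists M.
  - by move=> N; have [M [_]] := pattern_mass_rearranged_le N hp'; exists M.
have le1 (r : nat -> R) N : (forall j, 0 <= r j) ->
    (\sum_(t < N) r t) @[N --> \oo] --> (1 : R) -> 0 <= \sum_(t < N) r t <= 1.
  move=> r0 r1; apply/andP; split; first exact: sumr_ge0.
  have <- : limn (fun N => \sum_(t < N) r t) = 1 by apply/cvg_lim.
  by apply: nondecreasing_cvgn_le; [exact: mono|apply/cvg_ex; exists 1].
split => //; try by move=> N; apply: le1.
have [l Kl] : exists l : R, pattern_mass (fun t : 'I_N => p t) rho @[N --> \oo] --> l.
  apply/cvg_ex; apply: nondecreasing_is_cvgn; first exact: monoK.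
  exists 1 => _ [N _ <-]; apply: le_trans (pattern_mass_le_sum _ _) _ => //.
  by rewrite exprn_ile1//; have /andP[] := le1 p N p0 p1.
rewrite -[X in _ --> X](subrr l); apply: cvgB => //.
apply: (@cofinal_cvg (fun N => pattern_mass (fun t : 'I_N => p t) rho)) => //;
  try exact: monoK.
- by move=> N; have [M [+ _]] := pattern_mass_rearranged_le N hp; exists M.
- by move=> N; have [M [+ _]] := pattern_mass_rearranged_le N hp'; exists M.
Qed.

End Rearrangement.

Lemma measurable_tuple_rv (d d' : measure_display)
    (Om : measurableType d) (T : measurableType d') (u : nat -> Om -> T) n :
  (forall j, measurable_fun [set: Om] (u j)) ->
  measurable_fun [set: Om] (fun w => [tuple u i w | i < n]).
Proof.
move=> mu; apply/measurable_fun_tnthP => i /=.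
rewrite (_ : _ \o _ = u i)//.
by apply/funext => w /=; rewrite tnth_mktuple.
Qed.

Lemma same_law_mean (R : realType) (d1 d2 : measure_display)
  (Om1 : measurableType d1) (Om2 : measurableType d2)
  (P1 : probability Om1 R) (P2 : probability Om2 R)
  (u : nat -> {RV P1 >-> R}) (v : nat -> {RV P2 >-> R}) N (g : ('I_N -> R) -> R) :
  same_law u v ->
  measurable_fun [set: N.-tuple R] (fun x => g (tnth x)) -> (forall x, 0 <= g x) ->
  \int[P1]_w g (fun t => u t w) = \int[P2]_w g (fun t => v t w).
Proof.
move=> uv mg g0.
have gE (r : nat -> R) : g (fun t : 'I_N => r t) = g (tnth [tuple r i | i < N]).
  by congr g; apply/funext => t; rewrite tnth_mktuple.
under eq_Rintegral => w _ do rewrite (gE (fun t => u t w)).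
under [RHS]eq_Rintegral => w _ do rewrite (gE (fun t => v t w)).
apply: (@eq_law_mean _ _ _ _ _ _ _ P1 P2 (fun w => [tuple u i w | i < N])
  (fun w => [tuple v i w | i < N]) (fun x => g (tnth x))) => //.
- apply: (measurable_tuple_rv (u := u)) => j; exact: measurable_funPT.
- apply: (measurable_tuple_rv (u := v)) => j; exact: measurable_funPT.
- by move=> A mA; exact: uv.
Qed.

Lemma measurable_clip_pattern (R : realType) (I : finType) N (rho : {set {set I}}) :
  measurable_fun [set: N.-tuple R]
    (fun x => pattern_mass (fun t => clip (tnth x t)) rho).
Proof.
have [] // := @bounded_pattern_mass R _ _ I 'I_N
  (fun t (x : N.-tuple R) => clip (tnth x t)) rho.
move=> t; apply: bounded_rv_clip; exact: measurable_tnth.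
Qed.

(** The EPPF is the limit of the mean pattern masses of the first [N] weights,
    in their original order. The ranked weights inherit the estimate of
    [mean_frequency_pattern] through their law; its right-hand side vanishes in
    the limit because the weights add up to one, and rearranging them does not
    affect the limit. *)
Lemma kingman_mean_pattern (R : realType) (q : seq nat -> R)
    (d : measure_display) (Om : measurableType d) (P : probability Om R)
    (p pd : nat -> {RV P >-> R}) n (rho : {set {set 'I_n}}) :
  kingman q pd ->
  (forall j w, 0 <= p j w <= 1) ->
  {ae P, forall w, (\sum_(t < N) p t w) @[N --> \oo] --> (1 : R)} ->
  {ae P, forall w, decreasing_rearrangement (p ^~ w) (pd ^~ w)} ->
  is_part rho ->
  (\int[P]_w pattern_mass (fun t : 'I_N => p t w) rho) @[N --> \oo] -->
    q (block_sizes rho) /\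
  (\int[P]_w (\sum_(t < N) p t w) ^+ n) @[N --> \oo] --> (1 : R).
Proof.
move=> [d' [Om' [P' [Pi [u [eppf u_lim upd]]]]]] p01 p1 ppd rhop.
have bp t : bounded_rv (p t).
  by split => //; exists 1 => w; have /andP[? ?] := p01 t w; rewrite ger0_norm.
have bc t : bounded_rv (fun w => clip (pd t w)) by exact: bounded_rv_clip.
have bS (y : nat -> Om -> R) N : (forall t, bounded_rv (y t)) ->
    bounded_rv (fun w => (\sum_(t < N) y t w) ^+ n).
  by move=> hy; apply: bounded_rvX; apply: bounded_rv_sum => t _.
have bK (y : nat -> Om -> R) N : (forall t, bounded_rv (y t)) ->
    bounded_rv (fun w => pattern_mass (fun t : 'I_N => y t w) rho).
  by move=> hy; apply: (bounded_pattern_mass (x := fun (t : 'I_N) => y t)) => t.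
have key : {ae P, forall w,
   [/\ (\sum_(t < N) clip (pd t w)) @[N --> \oo] --> (1 : R),
      forall N, 0 <= \sum_(t < N) p t w <= 1,
      forall N, 0 <= \sum_(t < N) clip (pd t w) <= 1 &
      (pattern_mass (fun t : 'I_N => p t w) rho -
       pattern_mass (fun t : 'I_N => clip (pd t w)) rho) @[N --> \oo] --> (0 : R)]}.
  apply: filterS2 p1 ppd => w p1 [_ pd0 hcard].
  have hp : rearranged (p ^~ w) (pd ^~ w).
    by split=> // j; case/andP: (p01 j w).
  have pdc j : clip (pd j w) = pd j w.
    apply: clip_id; rewrite pd0 /=.
    (* A positive ranked weight is also a value of [p], hence at most one. *)
    have [pdj|] := ltP 0 (pd j w); last by move=> h; apply: le_trans h _.
    have [_ _ hc] := rearranged_sym hp.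
    have [h hE _] := card_eq_transport hc.
    by rewrite -(hE j pdj); case/andP: (p01 (h j) w).
  have hc : rearranged (p ^~ w) (fun j => clip (pd j w)).
    by rewrite (_ : (fun j => clip (pd j w)) = pd ^~ w)//; apply/funext.
  by have [] := pattern_mass_rearranged rho hc p1.
have g0 N (x : 'I_N -> R) : 0 <= pattern_mass (fun t => clip (x t)) rho.
  by apply: pattern_mass_ge0 => t; case/andP: (clip_itv (x t)).
have s0 N (x : 'I_N -> R) : 0 <= (\sum_t clip (x t)) ^+ n.
  by apply: exprn_ge0; apply: sumr_ge0 => t _; case/andP: (clip_itv (x t)).
have mS N : measurable_fun [set: N.-tuple R] (fun x => (\sum_t clip (tnth x t)) ^+ n).
  apply: measurable_funX; apply: measurable_sum => t.
  by apply: measurable_clip; exact: measurable_tnth.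
have gap N : `|\int[P]_w pattern_mass (fun t : 'I_N => clip (pd t w)) rho - q (block_sizes rho)|
    <= 1 - \int[P]_w (\sum_(t < N) clip (pd t w)) ^+ n.
  have := mean_frequency_pattern eppf N (fun j => measurable_funPT (u j)) u_lim rhop.
  rewrite (same_law_mean (g := fun x => pattern_mass (fun t => clip (x t)) rho) upd
    (@measurable_clip_pattern R _ N rho) (g0 N)).
  by rewrite (same_law_mean (g := fun x => (\sum_t clip (x t)) ^+ n) upd (mS N) (s0 N)).
have S_lim (y : nat -> Om -> R) : (forall t, bounded_rv (y t)) ->
    {ae P, forall w, (\sum_(t < N) y t w) @[N --> \oo] --> (1 : R)} ->
    {ae P, forall w, forall N, 0 <= \sum_(t < N) y t w <= 1} ->
    (\int[P]_w (\sum_(t < N) y t w) ^+ n) @[N --> \oo] --> (1 : R).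
  move=> by_ y1 y01; rewrite -[X in _ --> X](mean_cst P).
  apply: (@bounded_convergence _ _ _ _ _ _ 1) => //.
  - by move=> N; exact: bS.
  - apply: filterS y01 => w yw N; have /andP[? ?] := yw N.
    by rewrite ger0_norm ?exprn_ge0// exprn_ile1.
  - exact: bounded_rv_cst.
  - apply: filterS y1 => w yw; rewrite -[X in _ --> X](expr1n R n).
    exact: cvg_exp_seq.
have Sp_lim : (\int[P]_w (\sum_(t < N) p t w) ^+ n) @[N --> \oo] --> (1 : R).
  by apply: (S_lim p) => //; apply: filterS key => w [].
split => //.
have Sc_lim : (\int[P]_w (\sum_(t < N) clip (pd t w)) ^+ n) @[N --> \oo] --> (1 : R).
  by apply: (S_lim (fun t w => clip (pd t w))) => //; apply: filterS key => w [].
have D_lim : (\int[P]_w (pattern_mass (fun t : 'I_N => p t w) rho -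
    pattern_mass (fun t : 'I_N => clip (pd t w)) rho)) @[N --> \oo] --> (0 : R).
  rewrite -[X in _ --> X](mean_cst P).
  apply: (@bounded_convergence _ _ _ _ _ _ 2) => //.
  - move=> N; apply: bounded_rvB; first exact: (bK p).
    exact: (bK (fun t w => clip (pd t w))).
  - apply: filterS key => w [_ hp hc _] N.
    have h (y : nat -> R) : (forall t, 0 <= y t) -> \sum_(t < N) y t <= 1 ->
        `|pattern_mass (fun t : 'I_N => y t) rho| <= 1.
      move=> y0 y1; rewrite ger0_norm ?pattern_mass_ge0//.
      apply: le_trans (pattern_mass_le_sum _ _) _ => //.
      by rewrite exprn_ile1// sumr_ge0.
    rewrite (le_trans (ler_normB _ _))// [leRHS](_ : 2 = 1 + 1) ?lerD//.
    + by apply: (h (p ^~ w)); [move=> t; case/andP: (p01 t w)|case/andP: (hp N)].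
    + apply: (h (fun t => clip (pd t w))); last by case/andP: (hc N).
      by move=> t; case/andP: (clip_itv (pd t w)).
  - exact: bounded_rv_cst.
  - by apply: filterS key => w [].
have Kc_lim : (\int[P]_w pattern_mass (fun t : 'I_N => clip (pd t w)) rho)
    @[N --> \oo] --> q (block_sizes rho).
  apply/cvgrPdist_le => e e0.
  have /cvgrPdist_le/(_ e e0) := Sc_lim; apply: filterS => N; rewrite distrC => hN.
  by rewrite distrC; apply: le_trans (gap N) _; rewrite -normrN opprB in hN;
    apply: le_trans (ler_norm _) hN.
have E N : \int[P]_w pattern_mass (fun t : 'I_N => p t w) rho =
    \int[P]_w (pattern_mass (fun t : 'I_N => p t w) rho -
      pattern_mass (fun t : 'I_N => clip (pd t w)) rho) +
    \int[P]_w pattern_mass (fun t : 'I_N => clip (pd t w)) rho.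
  rewrite meanB ?subrK//; first exact: (bK p).
  exact: (bK (fun t w => clip (pd t w))).
under eq_fun do rewrite E.
by rewrite -[q _]add0r; exact: cvgD D_lim Kc_lim.
Qed.

(** * Cells that separate the points of a Polish space *)

(** In a separable metric space take the balls of radius [1 / k.+1] centred at the
    points of a dense sequence. *)
Lemma polish_separating_opens (R : realType) (X : ptopologicalType) :
  polish R X -> exists U : nat -> set X, (forall m, open (U m)) /\
    forall x y, x <> y -> exists m, U m x /\ ~ U m y.
Proof.
move=> [[D cD dD] [M [f [g [fK gK cf cg _]]]]].
have [e eD] : exists e : nat -> X, set_surj setT D e by apply/pcard_surjP.
pose B i k := f @^-1` (ball (f (e i)) (k.+1%:R^-1 : R))°.
exists (fun m => let ik := odflt (0, 0)%N (choice.unpickle m) in B ik.1 ik.2); split.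
  move=> m; apply: open_comp; last exact: open_interior.
  by move=> x _; exact: cf.
move=> x y xy.
have r0 : 0 < mdist (f x) (f y).
  by rewrite mdist_gt0; apply/eqP => fxy; apply: xy; rewrite -(fK x) fxy fK.
set r := mdist _ _ in r0.
(* Such a ball of radius at most half of [r] around a point close to [x] contains
   [x], and it misses [y] by the triangle inequality. *)
have [k kr] : exists k : nat, k.+1%:R^-1 <= r / 2.
  exists (Num.truncn (r / 2)^-1).
  by rewrite -[leRHS]invrK lef_pV2 ?posrE ?invr_gt0 ?divr_gt0// ltW// truncnS_gt.
have k0 : 0 < (k.+1%:R^-1 : R) by rewrite invr_gt0 ltr0n.
pose O := f @^-1` (ball (f x) (k.+1%:R^-1 / 2 : R))°.
have fxO : nbhs (f x) (ball (f x) (k.+1%:R^-1 / 2 : R)).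
  by apply: nbhsx_ballx; rewrite divr_gt0.
have [d [Od Dd]] : O `&` D !=set0.
  apply: dD; first by exists x; exact: nbhs_singleton (nbhs_interior fxO).
  apply: open_comp; last exact: open_interior.
  by move=> z _; exact: cf.
have [i _ ed] := eD _ Dd.
have fxd : ball (f x) (k.+1%:R^-1 / 2 : R) (f d) by exact: interior_subset Od.
exists (choice.pickle (i, k)); rewrite choice.pickleK /= /B ed; split => /=.
  apply: filterS fxO => z xz; rewrite [X in ball _ X](splitr (k.+1%:R^-1 : R)).
  by apply: ball_triangle xz; exact: ball_sym.
move=> /interior_subset /= dy.
have : ball (f x) r (f y).
  rewrite [X in ball _ X](splitr r).
  apply: (@ball_triangle _ _ (f d)).
    apply: le_ball fxd; apply: le_trans _ kr.
    by move: k0; set s := k.+1%:R^-1 => s0; lra.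
  exact: le_ball dy.
by rewrite ballEmdist /= ltxx.
Qed.

Lemma measurable_evaluation (R : realType) (d : measure_display)
    (T : measurableType d) (A : set T) : measurable A ->
  measurable_fun [set: pprobability T R]
    (fun th : pprobability T R => (th : probability T R) A).
Proof.
by move=> mA; exact: (measurable_kernel (kprobability (@measurable_id _ _ setT)) A mA).
Qed.

Lemma fibers_ffun (I : finType) (V : eqType) (g : I -> V) :
  fibers [ffun i => g i] = fibers g.
Proof. by apply: eq_fibers => i j; rewrite !ffunE. Qed.

Section Cells.
Context (X : ptopologicalType) (U : nat -> set X).
Hypothesis U_open : forall m, open (U m).
Hypothesis U_sep : forall x y, x <> y -> exists m, U m x /\ ~ U m y.
Local Notation T := (borel X).

(** The cell of a point in the finite partition generated by the first [m]
    sets of the family. *)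
Definition code m (x : T) : {ffun 'I_m -> bool} := [ffun i : 'I_m => `[< U i x >]].

Lemma measurable_code m (p : pred {ffun 'I_m -> bool}) :
  measurable [set x : T | p (code m x)].
Proof.
apply: (@finite_rv_pred _ T _ (code m)) => c.
rewrite (_ : [set x | _] = \bigcap_(i in [set: 'I_m])
    (if c i then U i : set T else ~` (U i : set T))); last first.
  apply/seteqP; split => [x /= <- i _|x h /=].
    by rewrite ffunE; case: asboolP.
  apply/ffunP => i; rewrite ffunE; have := h i Logic.I.
  by case: (c i) => [/asboolT|/asboolF].
apply: fin_bigcap_measurable => // i _.
have mU : measurable (U i : set T) by apply: sub_sigma_algebra.
by case: (c i) => //; exact: measurableC.
Qed.

Lemma code_separates (x y : T) : x <> y ->
  exists m0, forall m, (m0 <= m)%N -> code m x != code m y.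
Proof.
move=> /U_sep [m0 [Ux Uy]]; exists m0.+1 => m m0m.
apply/eqP => /ffunP /(_ (Ordinal m0m)); rewrite !ffunE /=.
by rewrite (asboolT Ux) (asboolF Uy).
Qed.

(** Finitely many distinct points are separated by finitely many of the sets. *)
Lemma code_fibers_near n (z : 'I_n -> T) :
  \forall m \near \oo, fibers (fun i => code m (z i)) = fibers z.
Proof.
have /choice[m0 hm0] : forall ij : 'I_n * 'I_n, exists m0, z ij.1 <> z ij.2 ->
    forall m, (m0 <= m)%N -> code m (z ij.1) != code m (z ij.2).
  move=> [i j] /=; have [zij|zij] := pselect (z i = z j); first by exists 0%N.
  by have [m0 h] := code_separates zij; exists m0.
exists (\max_ij m0 ij) => // m /= mm0; apply: eq_fibers => i j.
have [->|zij] := eqVneq (z i) (z j); first by rewrite eqxx.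
apply/negbTE; apply: (hm0 (i, j)); first exact/eqP.
by apply: leq_trans mm0; exact: (leq_bigmax (i, j)).
Qed.

Lemma measurable_point (x : T) : measurable [set x].
Proof.
rewrite (_ : [set x] = \bigcap_m [set y | code m y == code m x]).
  by apply: bigcapT_measurable => m; exact: measurable_code (fun c => c == code m x).
apply/seteqP; split => [y -> m _ //=|y h /=].
have [//|/code_separates[m /(_ _ (leqnn m))]] := pselect (y = x).
by rewrite (h m Logic.I).
Qed.

(** The diagonal is the intersection over [m] of the finite unions of squares of
    cells; without a countable separating family it could fail to be measurable
    for the product of the sigma-algebras. *)
Lemma measurable_eq_rv (d : measure_display) (Om : measurableType d)
    (f g : Om -> T) : measurable_fun [set: Om] f -> measurable_fun [set: Om] g ->
  measurable [set w | f w = g w].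
Proof.
move=> mf mg.
rewrite (_ : [set w | f w = g w] = \bigcap_m \bigcup_(c in [set: {ffun 'I_m -> bool}])
   ((f @^-1` [set x | code m x == c]) `&` (g @^-1` [set x | code m x == c]))).
  apply: bigcapT_measurable => m; apply: fin_bigcup_measurable => // c _.
  by apply: measurableI; rewrite -[X in measurable X]setTI; [apply: mf|apply: mg] => //;
    exact: measurable_code (fun c' => c' == c).
apply/seteqP; split => [w /= fg m _|w h /=].
  by exists (code m (f w)) => //=; rewrite fg !eqxx.
have [//|/code_separates[m /(_ _ (leqnn m))]] := pselect (f w = g w).
by have [c _ /= [/eqP -> /eqP ->]] := h m Logic.I; rewrite eqxx.
Qed.

Lemma measurable_fibers_rv (d : measure_display) (Om : measurableType d) n
    (f : 'I_n -> Om -> T) (rho : {set {set 'I_n}}) :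
  (forall i, measurable_fun [set: Om] (f i)) ->
  measurable [set w | fibers (f ^~ w) == rho].
Proof.
move=> mf.
have hE : finite_rv (fun w => [ffun ij : 'I_n * 'I_n => f ij.1 w == f ij.2 w]).
  move=> c; rewrite (_ : [set w | _] = \bigcap_(ij in [set: 'I_n * 'I_n])
    (if c ij then [set w | f ij.1 w = f ij.2 w] else ~` [set w | f ij.1 w = f ij.2 w])).
    apply: fin_bigcap_measurable => // ij _.
    by have m := measurable_eq_rv (mf ij.1) (mf ij.2); case: (c ij) => //; exact: measurableC.
  apply/seteqP; split => [w /= <- ij _|w h /=].
    by rewrite ffunE; case: eqP.
  by apply/ffunP => ij; rewrite ffunE; have := h ij Logic.I; case: (c ij) => /eqP // /negbTE.
pose phi (c : {ffun 'I_n * 'I_n -> bool}) :=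
  finset.equivalence_partition (fun i j => c (i, j)) [set: 'I_n]%SET.
rewrite (_ : [set w | _] = [set w | phi [ffun ij : 'I_n * 'I_n => f ij.1 w == f ij.2 w] == rho]).
  exact: (finite_rv_pred (fun c => phi c == rho) hE).
apply/seteqP; split => w /=; rewrite /phi /fibers /finset.preim_partition;
  (rewrite (_ : finset.equivalence_partition (fun i j => [ffun _ => _] _) _ =
    finset.equivalence_partition (fun i j => f i w == f j w) [set: 'I_n]%SET) //;
   apply: eq_imset => i; apply/setP => j; rewrite !inE ffunE //).
Qed.

Lemma finite_rv_code (d : measure_display) (Om : measurableType d) m n
    (f : 'I_n -> Om -> T) : (forall i, measurable_fun [set: Om] (f i)) ->
  finite_rv (fun w => [ffun i => code m (f i w)]).
Proof.
move=> mf c; rewrite (_ : [set w | _] = \bigcap_(i in [set: 'I_n])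
    (f i @^-1` [set x | code m x == c i])).
  apply: fin_bigcap_measurable => // i _; rewrite -[X in measurable X]setTI.
  by apply: mf => //; exact: (measurable_code (fun c' => c' == c i)).
apply/seteqP; split => [w /= <- i _|w h /=]; first by rewrite /= ffunE.
by apply/ffunP => i; rewrite ffunE; exact/eqP/(h i).
Qed.

Lemma measurable_code_fibers_rv (d : measure_display) (Om : measurableType d) m n
    (f : 'I_n -> Om -> T) (rho : {set {set 'I_n}}) :
  (forall i, measurable_fun [set: Om] (f i)) ->
  measurable [set w | fibers (fun i => code m (f i w)) == rho].
Proof.
move=> mf; have := finite_rv_pred
  (fun c : {ffun 'I_n -> {ffun 'I_m -> bool}} => fibers c == rho) (finite_rv_code mf).
by under eq_set do rewrite fibers_ffun.
Qed.

End Cells.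

(** * Samples seen through the atoms of the random measure *)

Section Sampling.
Context (R : realType) (X : ptopologicalType).
Local Notation T := (borel X).
Context (d1 : measure_display) (Om1 : measurableType d1) (P1 : probability Om1 R)
  (xi : nat -> {RV P1 >-> T}) (Pt : {mfun Om1 >-> pprobability T R})
  (d2 : measure_display) (Om2 : measurableType d2) (P2 : probability Om2 R)
  (mu : {mfun Om2 >-> pprobability T R}).
Hypothesis ciid : conditionally_iid Pt xi.
Hypothesis eq_law : forall S : set (pprobability T R), measurable S ->
  P1 (Pt @^-1` S) = P2 (mu @^-1` S).

Lemma bounded_rv_mu A : measurable A ->
  bounded_rv (fun w => fine ((mu w : probability T R) A)).
Proof.
move=> mA; split.
  apply/measurable_EFinP.
  rewrite (_ : _ \o _ = fun w => (mu w : probability T R) A).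
    exact: (measurableT_comp (measurable_evaluation mA)).
  by apply/funext => w /=; rewrite fine_probK.
exists 1 => w; rewrite ger0_norm ?fine_ge0//.
by rewrite -lee_fin fine_probK// probability_le1.
Qed.

(** Conditionally independent sampling, read on rectangles and transported to the
    space of the representation of the random measure by atoms. *)
Lemma sampling_rectangle n (B : 'I_n -> set T) : (forall i, measurable (B i)) ->
  fine (P1 [set w | forall i, B i (xi i w)]) =
  \int[P2]_w \prod_i fine ((mu w : probability T R) (B i)).
Proof.
move=> mB.
pose B' j : set T := if insub j is Some i then B i else setT.
have mB' j : measurable (B' j) by rewrite /B'; case: insub.
have B'E (i : 'I_n) : B' i = B i by rewrite /B' insubT// => ?; congr B; exact: val_inj.
have := ciid n mB' (measurableT : measurable (setT : set (pprobability T R))).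
rewrite preimage_setT setTI.
rewrite (_ : [set w | _] = [set w | forall i, B i (xi i w)]); last first.
  apply/seteqP; split => w /= h i; first by rewrite -B'E; exact: h.
  by move=> ilt; have := h (Ordinal ilt); rewrite -B'E.
pose G (th : pprobability T R) : \bar R := (\prod_(i < n) (th : probability T R) (B i))%E.
have GE th : G th = (\prod_i fine ((th : probability T R) (B i)))%:E.
  by rewrite /G -prodEFin; apply: eq_bigr => i _; rewrite fine_probK.
move=> ->; rewrite (_ : (\int[P1]_w _)%E = (\int[P1]_w G (Pt w))%E); last first.
  by apply: eq_integral => w _; apply: eq_bigr => i _; rewrite B'E.
rewrite (@eq_law_integral _ _ _ _ _ _ _ P1 P2 Pt mu G) //.
- by rewrite /Rintegral; congr fine; apply: eq_integral => w _; exact: GE.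
- have := (fun (i : 'I_n) => measurable_evaluation (R := R) (mB i)).
  move=> me; rewrite (_ : G = fun th => (\prod_i fine ((th : probability T R) (B i)))%:E).
    apply/measurable_EFinP; apply: measurable_prod => i _.
    apply/measurable_EFinP.
    rewrite (_ : _ \o _ = fun th : pprobability T R => (th : probability T R) (B i))//.
    by apply/funext => th /=; rewrite fine_probK.
  by apply/funext => th; exact: GE.
- by move=> th; rewrite GE lee_fin; apply: prodr_ge0 => i _; exact: fine_ge0.
Qed.

Variables (U : nat -> set X) (p : nat -> {RV P2 >-> R}) (Z : nat -> {RV P2 >-> T}).
Hypothesis U_open : forall m, open (U m).
Hypothesis U_sep : forall x y, x <> y -> exists m, U m x /\ ~ U m y.
Hypothesis p01 : forall j w, 0 <= p j w <= 1.
Hypothesis mu_pZ : {ae P2, forall w, forall A : set T, measurable A ->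
  ((mu w : probability T R) A = \sum_(0 <= j <oo) (p j w)%:E * \d_(Z j w) A)%E}.

Lemma bounded_rv_weight j : bounded_rv (p j).
Proof.
by split => //; exists 1 => w; have /andP[? ?] := p01 j w; rewrite ger0_norm.
Qed.

(** The mass that the first [N] atoms give to the samples of size [n] with
    equality pattern [pi], the locations of the atoms being seen through [f]. *)
Definition atom_pattern (V : eqType) (f : T -> V) N n (pi : {set {set 'I_n}}) w : R :=
  \sum_(j : {ffun 'I_n -> 'I_N} | fibers (fun i => f (Z (j i) w)) == pi)
     \prod_i p (j i) w.

Lemma bounded_rv_atom_pattern (V : eqType) (f : T -> V) N n (pi : {set {set 'I_n}}) :
  (forall j : {ffun 'I_n -> 'I_N},
    measurable [set w | fibers (fun i => f (Z (j i) w)) == pi]) ->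
  bounded_rv (atom_pattern f N pi).
Proof.
move=> mf; rewrite /atom_pattern.
under eq_fun => w do rewrite big_mkcond /=.
apply: bounded_rv_sum => j _.
rewrite (_ : (fun w => _) = (fun w =>
    \1_[set w | fibers (fun i => f (Z (j i) w)) == pi] w * \prod_i p (j i) w)).
  apply: bounded_rvM; first exact: bounded_rv_indic.
  by apply: bounded_rv_prod => i; exact: bounded_rv_weight.
by apply/funext => w; rewrite indic_boolE; case: ifP; rewrite (mul1r, mul0r).
Qed.

Lemma measurable_code_fibers m N n (pi : {set {set 'I_n}}) (j : {ffun 'I_n -> 'I_N}) :
  measurable [set w | fibers (fun i => code U m (Z (j i) w)) == pi].
Proof.
by apply: (measurable_code_fibers_rv U_open m (f := fun i => Z (j i))) => i.
Qed.

(** The cells of the samples take finitely many values, whose joint law is given by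
    rectangles. *)
Lemma code_pattern_prob m n (pi : {set {set 'I_n}}) :
  fine (P1 [set w | fibers (fun i : 'I_n => code U m (xi i w)) == pi]) =
  \int[P2]_w pattern_mass
    (fun c => fine ((mu w : probability T R) [set x | code U m x == c])) pi.
Proof.
pose V w := [ffun i : 'I_n => code U m (xi i w)].
have VE c : [set w | V w = c] = [set w | forall i, [set x | code U m x == c i] (xi i w)].
  apply/seteqP; split => [w /= <- i|w h /=]; first by rewrite /= ffunE.
  by apply/ffunP => i; rewrite ffunE; exact/eqP/h.
have mc c : measurable [set x | code U m x == c].
  exact: (measurable_code U_open (fun c' => c' == c)).
have mV : finite_rv V by apply: (finite_rv_code U_open (f := fun i : 'I_n => xi i)).
rewrite (_ : [set w | _] = [set w | fibers (V w) == pi]); last first.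
  by under [RHS]eq_set do rewrite fibers_ffun.
rewrite (finite_rv_prob P1 (fun c : {ffun 'I_n -> {ffun 'I_m -> bool}} => fibers c == pi) mV).
rewrite mean_sum; last first.
  by move=> c _; apply: bounded_rv_prod => i; exact: bounded_rv_mu.
apply: eq_bigr => c _.
by rewrite VE (sampling_rectangle (B := fun i => [set x | code U m x == c i])).
Qed.

(** The mass of a cell is at least the sum of the weights of those of the first
    [N] atoms that it contains, and the masses of the cells add up to one. *)
Lemma atom_pattern_code_gap m N n (pi : {set {set 'I_n}}) :
  {ae P2, forall w,
    0 <= pattern_mass
      (fun c => fine ((mu w : probability T R) [set x | code U m x == c])) pi -
      atom_pattern (code U m) N pi w <= 1 - (\sum_(t < N) p t w) ^+ n}.
Proof.
apply: filterS mu_pZ => w mu_w.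
have mc c : measurable [set x | code U m x == c].
  exact: (measurable_code U_open (fun c' => c' == c)).
set x := (fun c => fine _).
pose y c := \sum_(t < N | code U m (Z t w) == c) p t w.
have yE : pattern_mass y pi = atom_pattern (code U m) N pi w.
  exact: (pattern_mass_push (fun t : 'I_N => code U m (Z t w)) (fun t : 'I_N => p t w) pi).
have xy c : 0 <= y c <= x c.
  rewrite sumr_ge0/=; last by move=> t _; case/andP: (p01 t w).
  rewrite -lee_fin /x fine_probK// mu_w//.
  apply: le_trans (nneseries_lim_ge N _); last first.
    by move=> t _; rewrite mule_ge0// lee_fin; case/andP: (p01 t w).
  rewrite big_mkord /y -sumEFin [leLHS]big_mkcond /=; apply: lee_sum => t _.
  rewrite diracE; case: ifP => h; last by rewrite mule_ge0// lee_fin; case/andP: (p01 t w).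
  by rewrite mem_set// mule1.
have x1 : \sum_c x c = 1.
  have := finite_rv_prob (mu w : probability T R) predT (V := code U m).
  rewrite (_ : [set _ | _] = setT); last by apply/seteqP; split.
  move=> /(_ _); rewrite (probability_setT (mu w : probability T R)) /=.
  move=> -> //.
    apply: eq_bigr => c _; congr (fine (_ _)); apply/seteqP.
    by split => z /= /eqP.
  by move=> c; have := mc c; congr measurable; apply/seteqP; split => z /= /eqP.
have y1 : \sum_c y c = \sum_(t < N) p t w.
  by rewrite [RHS](partition_big (fun t : 'I_N => code U m (Z t w)) predT).
rewrite -yE subr_ge0 pattern_mass_le//=.
by have := pattern_mass_diff pi xy; rewrite x1 expr1n y1 card_ord.
Qed.

Lemma mean_atom_pattern_code_gap m N n (pi : {set {set 'I_n}}) :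
  `|fine (P1 [set w | fibers (fun i : 'I_n => code U m (xi i w)) == pi]) -
    \int[P2]_w atom_pattern (code U m) N pi w| <=
  1 - \int[P2]_w (\sum_(t < N) p t w) ^+ n.
Proof.
rewrite code_pattern_prob.
have bx : bounded_rv (fun w => pattern_mass
    (fun c => fine ((mu w : probability T R) [set x | code U m x == c])) pi).
  apply: (bounded_pattern_mass (x := fun c w => fine ((mu w : probability T R)
     [set x | code U m x == c]))) => c.
  by apply: bounded_rv_mu; exact: (measurable_code U_open (fun c' => c' == c)).
have ba : bounded_rv (atom_pattern (code U m) N pi).
  by apply: bounded_rv_atom_pattern => j; exact: measurable_code_fibers.
have bS : bounded_rv (fun w => (\sum_(t < N) p t w) ^+ n).
  by apply: bounded_rvX; apply: bounded_rv_sum => t _; exact: bounded_rv_weight.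
rewrite -meanB// -[X in X - _](mean_cst P2) -meanB//; last exact: bounded_rv_cst.
rewrite ger0_norm.
  apply: mean_ae_le; [exact: bounded_rvB| |].
    by apply: bounded_rvB => //; exact: bounded_rv_cst.
  by apply: filterS (atom_pattern_code_gap m N pi) => w /andP[].
rewrite -[leLHS](mean_cst P2); apply: mean_ae_le; [exact: bounded_rv_cst|exact: bounded_rvB|].
by apply: filterS (atom_pattern_code_gap m N pi) => w /andP[].
Qed.

Lemma measurable_atom_fibers N n (pi : {set {set 'I_n}}) (j : {ffun 'I_n -> 'I_N}) :
  measurable [set w | fibers (fun i => Z (j i) w) == pi].
Proof.
by apply: (measurable_fibers_rv U_open U_sep (f := fun i => Z (j i))) => i.
Qed.

(** Refining the cells, the pattern of the codes of a sample becomes the pattern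
    of the sample itself. *)
Lemma mean_atom_pattern_gap N n (pi : {set {set 'I_n}}) :
  `|fine (P1 [set w | fibers (fun i : 'I_n => xi i w) == pi]) -
    \int[P2]_w atom_pattern id N pi w| <=
  1 - \int[P2]_w (\sum_(t < N) p t w) ^+ n.
Proof.
have mxi m : measurable [set w | fibers (fun i : 'I_n => code U m (xi i w)) == pi].
  by apply: (measurable_code_fibers_rv U_open m (f := fun i : 'I_n => xi i)) => i.
have mx : measurable [set w | fibers (fun i : 'I_n => xi i w) == pi].
  by apply: (measurable_fibers_rv U_open U_sep (f := fun i : 'I_n => xi i)).
have near_cst (V : Type) (F : nat -> V) (h : V -> R) (v : V) :
    (\forall m \near \oo, F m = v) -> h (F m) @[m --> \oo] --> h v.
  by move=> Fv; apply: cvg_near_cst; apply: filterS Fv => m ->.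
have lim1 : fine (P1 [set w | fibers (fun i : 'I_n => code U m (xi i w)) == pi]) @[m --> \oo] -->
    fine (P1 [set w | fibers (fun i : 'I_n => xi i w) == pi]).
  rewrite -mean_bool//; under eq_fun => m do rewrite -mean_bool//.
  apply: (@bounded_convergence _ _ _ _ _ _ 1).
  - by move=> m; exact: bounded_rv_bool.
  - by apply: aeW => w m; rewrite normr_nat lern1 leq_b1.
  - exact: bounded_rv_bool.
  - apply: aeW => w; apply: (near_cst _ _ (fun rho => (rho == pi)%:R)).
    exact: (code_fibers_near U_sep (fun i : 'I_n => xi i w)).
have p0 t w : 0 <= p t w by case/andP: (p01 t w).
have lim2 : (\int[P2]_w atom_pattern (code U m) N pi w) @[m --> \oo] -->
    \int[P2]_w atom_pattern id N pi w.
  apply: (@bounded_convergence _ _ _ _ _ _ (N%:R ^+ n)).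
  - by move=> m; apply: bounded_rv_atom_pattern => j; exact: measurable_code_fibers.
  - apply: aeW => w m; rewrite ger0_norm; last first.
      by apply: sumr_ge0 => j _; apply: prodr_ge0.
    apply: (@le_trans _ _ ((\sum_(t < N) p t w) ^+ #|'I_n|)).
      rewrite -sum_prod_ffun /atom_pattern big_mkcond /=; apply: ler_sum => j _.
      by case: ifP => // _; apply: prodr_ge0.
    rewrite card_ord lerXn2r ?nnegrE ?sumr_ge0//.
    rewrite -[leRHS]mulr1 -[X in X%:R * _]card_ord -sum1_card natr_sum mulr_suml.
    by apply: ler_sum => t _; rewrite mul1r; case/andP: (p01 t w).
  - by apply: bounded_rv_atom_pattern => j; exact: measurable_atom_fibers.
  - apply: aeW => w; rewrite /atom_pattern big_mkcond /=.
    under eq_fun do rewrite big_mkcond /=.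
    apply: cvg_sum_seq => j _.
    apply: (near_cst _ _ (fun rho => if rho == pi then \prod_i p (j i) w else 0)).
    exact: (code_fibers_near U_sep (fun i : 'I_n => Z (j i) w)).
have lim3 : `|fine (P1 [set w | fibers (fun i : 'I_n => code U m (xi i w)) == pi]) -
    \int[P2]_w atom_pattern (code U m) N pi w| @[m --> \oo] -->
    `|fine (P1 [set w | fibers (fun i : 'I_n => xi i w) == pi]) -
    \int[P2]_w atom_pattern id N pi w|.
  by apply: cvg_norm; apply: cvgB.
apply: (cvgr_to_le lim3); apply: nearW => m.
exact: mean_atom_pattern_code_gap.
Qed.

End Sampling.

(** * Atoms located at the fixed point *)

Section Amalgam.
Variable I : finType.
Implicit Types (rho W pi : {set {set I}}).

(** The blocks in [W] are given the common label [None], the others keep their own;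
    in particular nothing happens if [W] has at most one block. *)
Definition amalgam rho W : {set {set I}} :=
  fibers (fun i => let B := finset.pblock rho i in if B \in W then None else Some B).

End Amalgam.

Section Atoms.
Context (R : realType) (X : ptopologicalType).
Local Notation T := (borel X).
Context (d : measure_display) (Om : measurableType d) (P : probability Om R)
  (H : probability T R) (Z : nat -> {RV P >-> T}) (U : nat -> set X).
Hypothesis U_open : forall m, open (U m).
Hypothesis U_sep : forall x y, x <> y -> exists m, U m x /\ ~ U m y.
Hypothesis Z_iid : iid H Z.

Lemma iid_marginal l A : measurable A -> P (Z l @^-1` A) = H A.
Proof.
move=> mA; have := Z_iid l.+1 (B := fun j => if j == l then A else setT).
rewrite big_ord_recr /= eqxx big1 ?mul1e; last first.
  by move=> i _; rewrite ltn_eqF// probability_setT.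
move=> <-; last by move=> j; case: ifP.
congr (P _); apply/seteqP; split => w /=; first by move=> Aw j _; case: eqP => [->|].
by move=> /(_ l (ltnSn l)); rewrite eqxx.
Qed.

Lemma iid_pair l l' A B : l != l' -> measurable A -> measurable B ->
  P ((Z l @^-1` A) `&` (Z l' @^-1` B)) = (P (Z l @^-1` A) * P (Z l' @^-1` B))%E.
Proof.
move=> ll' mA mB; rewrite !iid_marginal//.
pose C j := if j == l then A else if j == l' then B else setT.
have := Z_iid (maxn l l').+1 (B := C).
have lN : (l < (maxn l l').+1)%N by rewrite ltnS leq_maxl.
have lN' : (l' < (maxn l l').+1)%N by rewrite ltnS leq_maxr.
rewrite (bigD1 (Ordinal lN)) //= (bigD1 (Ordinal lN')) /=; last first.
  by rewrite -val_eqE /= eq_sym.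
rewrite big1 ?mule1; last first.
  move=> i /andP[/negbTE i1 /negbTE i2]; rewrite /C.
  by move: i1 i2; rewrite -!val_eqE /= => -> ->; rewrite probability_setT.
have Cl : C l = A by rewrite /C eqxx.
have Cl' : C l' = B by rewrite /C [l' == l]eq_sym (negbTE ll') eqxx.
rewrite Cl Cl' => <-; last first.
  by move=> j; rewrite /C; case: ifP => // _; case: ifP.
congr (P _); apply/seteqP; split => w /=.
  by move=> [Aw Bw] j _; rewrite /C; case: eqP => [->//|_]; case: eqP => [->|].
by move=> h; have := h l lN; have := h l' lN'; rewrite Cl Cl'.
Qed.

Variables (x0 : X).
Hypothesis H_atom : forall x : T, x <> x0 -> H [set x] = 0%E.

(** By Fubini: given [Z l = x] with [x <> x0], the independent location [Z l'] is
    equal to [x] with probability [H [set x] = 0]. *)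
Lemma atoms_distinct_pair l l' : l != l' ->
  {ae P, forall w, Z l w = Z l' w -> Z l w = x0 :> T}.
Proof.
move=> ll'.
pose S : set (T * T) := [set z | z.1 = z.2] `&` ~` [set z | z.1 = x0].
have mS : measurable S.
  apply: measurableI; first exact: (measurable_eq_rv U_open U_sep).
  apply: measurableC; rewrite (_ : [set z | _] = fst @^-1` [set (x0 : T)])//.
  rewrite -[X in measurable X]setTI; apply: measurable_fst => //.
  exact: (measurable_point U_open U_sep).
exists ((fun w => (Z l w, Z l' w)) @^-1` S); split.
- rewrite -[X in measurable X]setTI.
  by apply: (measurable_fun_pair (measurable_funPT (Z l)) (measurable_funPT (Z l'))).
- rewrite (indep_product_law (fun A B mA mB => iid_pair ll' mA mB) mS).
  rewrite /product_measure1 /= integral0_eq// => x _.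
  rewrite [LHS]iid_marginal; last exact: measurable_xsection.
  have [xx0|xx0] := pselect (x = x0).
    rewrite (_ : xsection S x = set0) ?measure0//.
    by apply/seteqP; split=> // y /=; rewrite /xsection /= inE => -[_ /=].
  rewrite (_ : xsection S x = [set x]) ?H_atom//.
  apply/seteqP; split=> y /=; rewrite /xsection /= inE; first by case.
  by move=> ->; split.
- by move=> w /= h; split=> [|/= zx]; [apply: contrapT => zz; apply: h|apply: h].
Qed.

Lemma atoms_distinct :
  {ae P, forall w, forall l l', Z l w = Z l' w -> l = l' \/ Z l w = x0 :> T}.
Proof.
have h l : {ae P, forall w, forall l', Z l w = Z l' w -> l = l' \/ Z l w = x0 :> T}.
  apply/ae_foralln => l'; have [->|ll'] := eqVneq l l'; first by apply: aeW => w; left.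
  by apply: filterS (atoms_distinct_pair ll') => w h /h; right.
exact/ae_foralln.
Qed.

Variable a : R.
Hypothesis H_x0 : H [set (x0 : T)] = a%:E.

Lemma H_not_x0 : H (~` [set (x0 : T)]) = (1 - a)%:E.
Proof.
rewrite probability_setC ?H_x0//; exact: (measurable_point U_open U_sep).
Qed.

(** All samples of a block of [fibers j] hit the same atom, so it is enough that one
    of them sits at [x0]. *)
Definition stuck_blocks N n (j : {ffun 'I_n -> 'I_N}) w : {set {set 'I_n}} :=
  [set B in fibers j | [exists i in B, Z (j i) w == x0 :> T]]%SET.

Lemma fibers_ffunE (I V : finType) (j : {ffun I -> V}) :
  fibers j = [set j @^-1: [set l] | l : V & j @^-1: [set l] != finset.set0]%SET.
Proof.
apply/setP => B; apply/imsetP/imsetP => [[i _ ->]|[l]].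
  exists (j i); last by apply/setP => i'; rewrite !inE eq_sym.
  by rewrite inE; apply/set0Pn; exists i; rewrite !inE.
rewrite inE => /set0Pn[i]; rewrite !inE => /eqP ji ->.
by exists i; rewrite ?inE//; apply/setP => i'; rewrite !inE ji eq_sym.
Qed.

(** The event prescribes, for each atom that is hit, whether its location is [x0]:
    it is a rectangle for the independent locations, with a factor [a] for each
    block in [W] and a factor [1 - a] for each other block. *)
Lemma stuck_blocks_prob N n (j : {ffun 'I_n -> 'I_N}) (W : {set {set 'I_n}}) :
  W \subset fibers j ->
  P [set w | stuck_blocks j w = W] =
  (a ^+ #|W| * (1 - a) ^+ #|fibers j :\: W|)%:E.
Proof.
move=> Wj.
pose blk l : {set 'I_n} := (j @^-1: [set l])%SET.
(* Atoms that no sample hits have an empty block and are left free. *)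
pose B (l : nat) : set T := if insub l is Some l' then
  (if blk l' == finset.set0 then setT else if blk l' \in W then [set (x0 : T)]
   else ~` [set (x0 : T)]) else setT.
have mB l : measurable (B l).
  have mx := measurable_point U_open U_sep (x0 : T).
  rewrite /B; case: insub => // l'; case: ifP => // _; case: ifP => // _.
  exact: measurableC.
have BE (l : 'I_N) C : C = blk l -> C != finset.set0 ->
    B l = if C \in W then [set (x0 : T)] else ~` [set (x0 : T)].
  by move=> -> /negbTE l0; rewrite /B valK l0.
have := Z_iid N mB.
have -> : [set w | forall l : nat, (l < N)%N -> B l (Z l w)] =
    [set w | stuck_blocks j w = W].
  apply/seteqP; split => w /=.
    move=> h; apply/setP => C; rewrite inE.
    have [CW|CW] := boolP (C \in W).
      have Cj := fintype.subsetP Wj _ CW; rewrite Cj /=.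
      move: Cj; rewrite fibers_ffunE => /imsetP[l]; rewrite inE => l0 CE.
      rewrite -CE in l0; have := h l (ltn_ord l); rewrite (BE l C)// CW /=.
      move=> zl; move: l0 => /set0Pn[i]; rewrite CE !inE => /eqP ji.
      by apply/existsP; exists i; rewrite !inE ji eqxx /= zl.
    apply/negbTE; rewrite negb_and; have [Cj|//] := boolP (C \in fibers j).
    move: Cj; rewrite fibers_ffunE => /imsetP[l]; rewrite inE => l0 CE.
    rewrite -CE in l0; have := h l (ltn_ord l); rewrite (BE l C)// (negbTE CW) /=.
    move=> zl; apply/existsPn => i; rewrite CE !inE negb_and.
    by case: eqP => //= ->; apply/eqP.
  move=> WE l lN; rewrite /B insubT -WE /=.
  case: eqP => // /eqP l0; rewrite inE fibers_ffunE imset_f ?inE//=.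
  case: ifP => [/existsP[i]|/existsPn h]; first by rewrite !inE => /andP[/eqP -> /eqP].
  move/set0Pn : l0 => [i]; rewrite !inE => /eqP ji.
  by have := h i; rewrite !inE ji eqxx /= => /eqP.
move=> ->.
rewrite (eq_bigr (fun l : 'I_N => ((if blk l == finset.set0 then 1 else
    if blk l \in W then a else 1 - a))%:E)); last first.
  move=> l _; rewrite /B valK; case: ifP => _; first exact: probability_setT.
  by case: ifP => _; rewrite ?H_x0 ?H_not_x0.
rewrite prodEFin; congr EFin.
rewrite (bigID (fun l => blk l == finset.set0)) /= big1 ?mul1r; last by move=> l ->.
rewrite (eq_bigr (fun l => if blk l \in W then a else 1 - a)); last first.
  by move=> l /negbTE ->.
transitivity (\prod_(C in fibers j) (if C \in W then a else 1 - a)).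
  rewrite fibers_ffunE big_imset /=; first by apply: eq_bigl => l; rewrite inE.
  move=> l l'; rewrite !inE => /set0Pn[i il] _ e.
  by move: (il); rewrite e !inE => /eqP <-; move: il; rewrite !inE => /eqP.
rewrite (bigID [in W]) /=; congr (_ * _).
  rewrite (eq_bigl [in W]) => [|C]; last first.
    by rewrite /= andbC; case: (boolP (C \in W)) => // /(fintype.subsetP Wj).
  by rewrite (eq_bigr (fun=> a)) ?prodr_const// => C ->.
rewrite (eq_bigl [in (fibers j :\: W)%SET]) => [|C]; last by rewrite !inE andbC.
by rewrite (eq_bigr (fun=> 1 - a)) ?prodr_const// => C; rewrite inE => /andP[/negbTE ->].
Qed.

Lemma finite_rv_stuck_blocks N n (j : {ffun 'I_n -> 'I_N}) :
  finite_rv (stuck_blocks j).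
Proof.
have h : finite_rv (fun w => [ffun l : 'I_N => Z l w == x0 :> T]).
  move=> c; rewrite (_ : [set w | _] = \bigcap_(l in [set: 'I_N])
    (if c l then Z l @^-1` [set (x0 : T)] else ~` (Z l @^-1` [set (x0 : T)]))).
    apply: fin_bigcap_measurable => // l _.
    have m : measurable (Z l @^-1` [set (x0 : T)]).
      rewrite -[X in measurable X]setTI; apply: measurable_funPT => //.
      exact: (measurable_point U_open U_sep).
    by case: (c l) => //; exact: measurableC.
  apply/seteqP; split => [w /= <- l _|w h /=].
    by rewrite ffunE; case: eqP.
  by apply/ffunP => l; rewrite ffunE; have := h l Logic.I; case: (c l) => /eqP // /negbTE.
move=> W; have := finite_rv_pred (fun c : {ffun 'I_N -> bool} =>
  [set B in fibers j | [exists i in B, c (j i)]]%SET == W) h.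
congr measurable; apply/seteqP; split => w /=.
  move/eqP => <-; apply/setP => B; rewrite !inE; congr (_ && _).
  by apply: eq_existsb => i; rewrite ffunE.
move=> <-; apply/eqP/setP => B; rewrite !inE; congr (_ && _).
by apply: eq_existsb => i; rewrite ffunE.
Qed.

(** Almost surely, distinct atoms have distinct locations unless they both sit at
    [x0]. *)
Lemma fibers_atoms_amalgam N n (j : {ffun 'I_n -> 'I_N}) :
  {ae P, forall w, fibers (fun i => Z (j i) w) = amalgam (fibers j) (stuck_blocks j w)}.
Proof.
apply: filterS atoms_distinct => w distinct.
have stuckE i : (finset.pblock (fibers j) i \in stuck_blocks j w) =
    (Z (j i) w == x0 :> T).
  rewrite inE pblock_mem ?(cover_partition (fibers_partition j)) ?inE//=.
  apply/existsP/idP => [[i']|zi]; last first.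
    by exists i; rewrite zi andbT mem_pblock_fibers.
  by rewrite mem_pblock_fibers => /andP[/eqP -> ].
apply: eq_fibers => i i' /=; rewrite !stuckE.
case: ifPn => zi; case: ifPn => zi'.
- by rewrite eqxx; apply/eqP; exact: etrans (eqP zi) (esym (eqP zi')).
- by apply/negbTE; apply: contraNneq zi' => <-.
- by apply/negbTE; apply: contraNneq zi => ->.
rewrite (inj_eq Some_inj).
rewrite -(mem_pblock_part _ _ (fibers_partition j)) mem_pblock_fibers.
apply/eqP/eqP => [/distinct[/val_inj//|zx]|-> //].
by move/eqP : zi; case.
Qed.

(** The chance that a sample whose equality pattern among the atoms is [rho] has
    equality pattern [pi] among the values. *)
Definition amalgam_prob n (rho pi : {set {set 'I_n}}) : R :=
  \sum_(W : {set {set 'I_n}} | (W \subset rho) && (amalgam rho W == pi))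
     a ^+ #|W| * (1 - a) ^+ #|rho :\: W|.

Lemma fibers_atoms_prob N n (j : {ffun 'I_n -> 'I_N}) (pi : {set {set 'I_n}}) :
  fine (P [set w | fibers (fun i => Z (j i) w) == pi]) = amalgam_prob (fibers j) pi.
Proof.
have m1 : measurable [set w | fibers (fun i => Z (j i) w) == pi].
  by apply: (measurable_fibers_rv U_open U_sep (f := fun i => Z (j i))) => i.
have mS := @finite_rv_stuck_blocks N n j.
have m2 : measurable [set w | amalgam (fibers j) (stuck_blocks j w) == pi].
  exact: (finite_rv_pred (fun W => amalgam (fibers j) W == pi) mS).
rewrite -mean_bool// (@mean_ae_eq _ _ _ _ _
  (fun w => (amalgam (fibers j) (stuck_blocks j w) == pi)%:R)); first last.
- by apply: filterS (fibers_atoms_amalgam j) => w ->.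
- exact: bounded_rv_bool.
- exact: bounded_rv_bool.
rewrite mean_bool// (finite_rv_prob P (fun W => amalgam (fibers j) W == pi) mS).
rewrite /amalgam_prob (bigID (fun W : {set {set 'I_n}} => W \subset fibers j)) /= [X in _ + X]big1 ?addr0.
  apply: eq_big => [W|W /andP[_ Wj]]; first by rewrite andbC.
  by rewrite stuck_blocks_prob.
move=> W /andP[_ Wj]; rewrite (_ : [set w | _] = set0) ?measure0//.
apply/seteqP; split => // w /= WE; move: Wj; rewrite -WE.
by apply/negP; rewrite negbK; apply/fintype.subsetP => B; rewrite inE => /andP[].
Qed.

End Atoms.

(** * The law of the induced partition *)

Section SamplingFormula.
Context (R : realType) (X : ptopologicalType).
Local Notation T := (borel X).
Context (d : measure_display) (Om : measurableType d) (P : probability Om R)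
  (H : probability T R) (p : nat -> {RV P >-> R}) (Z : nat -> {RV P >-> T})
  (U : nat -> set X) (x0 : X) (a : R).
Hypothesis U_open : forall m, open (U m).
Hypothesis U_sep : forall x y, x <> y -> exists m, U m x /\ ~ U m y.
Hypothesis Z_iid : iid H Z.
Hypothesis pZ_indep : independent_seq p Z.
Hypothesis p01 : forall j w, 0 <= p j w <= 1.
Hypothesis H_atom : forall x : T, x <> x0 -> H [set x] = 0%E.
Hypothesis H_x0 : H [set (x0 : T)] = a%:E.

(** Weights and locations are independent. *)
Lemma mean_weights_pattern N n (j : {ffun 'I_n -> 'I_N}) (pi : {set {set 'I_n}}) :
  \int[P]_w (\prod_i p (j i) w * \1_[set w | fibers (fun i => Z (j i) w) == pi] w) =
  (\int[P]_w \prod_i p (j i) w) * amalgam_prob a (fibers j) pi.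
Proof.
pose tp w := [tuple p i w | i < N]; pose tZ w := [tuple Z i w | i < N].
have mtp : measurable_fun [set: Om] tp.
  by apply: (measurable_tuple_rv (u := p)) => i; exact: measurable_funPT.
have mtZ : measurable_fun [set: Om] tZ.
  by apply: (measurable_tuple_rv (u := Z)) => i; exact: measurable_funPT.
pose Xp : {mfun Om >-> N.-tuple R} := HB.pack tp (isMeasurableFun.Build _ _ _ _ _ mtp).
pose XZ : {mfun Om >-> N.-tuple T} := HB.pack tZ (isMeasurableFun.Build _ _ _ _ _ mtZ).
pose g (x : N.-tuple R) : R := \prod_i clip (tnth x (j i)).
pose B : set (N.-tuple T) := [set z | fibers (fun i => tnth z (j i)) == pi].
have gE w : g (Xp w) = \prod_i p (j i) w.
  by apply: eq_bigr => i _; rewrite tnth_mktuple clip_id.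
have BE : [set w | fibers (fun i => Z (j i) w) == pi] = XZ @^-1` B.
  have h w : fibers (fun i => tnth (XZ w) (j i)) = fibers (fun i => Z (j i) w).
    by congr fibers; apply/funext => i; rewrite tnth_mktuple.
  by apply/seteqP; split => w /=; rewrite /B /= h.
have mB : measurable B.
  apply: (measurable_fibers_rv U_open U_sep (f := fun i (z : N.-tuple T) => tnth z (j i))).
  by move=> i; exact: measurable_tnth.
have mg : measurable_fun [set: N.-tuple R] g.
  by apply: measurable_prod => i _; apply: measurable_clip; exact: measurable_tnth.
have bp t : bounded_rv (p t) by exact: bounded_rv_weight.
rewrite -(fibers_atoms_prob U_open U_sep Z_iid H_atom H_x0) BE.
transitivity (\int[P]_w (g (Xp w) * \1_B (XZ w))).
  by apply: eq_Rintegral => w _; rewrite gE !indicE.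
rewrite indep_mean//.
- by congr (_ * _); apply: eq_Rintegral => w _; rewrite gE.
- by move=> A C mA mC; exact: pZ_indep.
- by move=> t; apply: prodr_ge0 => i _; case/andP: (clip_itv (tnth t (j i))).
- rewrite (_ : _ \o _ = fun w => \prod_i p (j i) w); last exact/funext.
  by apply: bounded_rv_prod.
Qed.

(** Group the index families [j] by their pattern [rho], on which alone the
    probability of amalgamating to [pi] depends. *)
Lemma mean_atom_pattern N n (pi : {set {set 'I_n}}) :
  \int[P]_w atom_pattern p Z id N pi w =
  \sum_(rho | is_part rho)
    (\int[P]_w pattern_mass (fun t : 'I_N => p t w) rho) * amalgam_prob a rho pi.
Proof.
have bp t : bounded_rv (p t) by exact: bounded_rv_weight.
have bj (j : {ffun 'I_n -> 'I_N}) : bounded_rv (fun w => \prod_i p (j i) w).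
  exact: bounded_rv_prod.
have mj (j : {ffun 'I_n -> 'I_N}) :
    measurable [set w | fibers (fun i => Z (j i) w) == pi].
  by apply: (measurable_fibers_rv U_open U_sep (f := fun i => Z (j i))) => i.
transitivity (\sum_(j : {ffun 'I_n -> 'I_N})
    (\int[P]_w \prod_i p (j i) w) * amalgam_prob a (fibers j) pi).
  under [RHS]eq_bigr => j _ do rewrite -mean_weights_pattern.
  rewrite -mean_sum; last first.
    by move=> j _; apply: bounded_rvM => //; exact: bounded_rv_indic.
  apply: eq_Rintegral => w _; rewrite /atom_pattern big_mkcond /=.
  apply: eq_bigr => j _; rewrite (indic_boolE _ (fun w => fibers (fun i => Z (j i) w) == pi)).
  by case: ifP; rewrite (mulr1, mulr0).
rewrite (partition_big (fun j : {ffun 'I_n -> 'I_N} => fibers j) (@is_part 'I_n)) /=; last first.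
  by move=> j _; exact: fibers_partition.
apply: eq_bigr => rho _; rewrite /pattern_mass mean_sum// mulr_suml.
by apply: eq_bigr => j /eqP ->.
Qed.

End SamplingFormula.

(** The means of [atom_pattern] have two limits as [N] grows. By
    [mean_atom_pattern_gap] one is the probability on the left, since the weights
    add up to one; by [mean_atom_pattern] and [kingman_mean_pattern] the other is
    the sum on the right. *)
Lemma gSSS_pattern_prob (R : realType) (X : ptopologicalType)
    (a : R) (x0 : X) (H : probability (borel X) R) (q : seq nat -> R)
    (d : measure_display) (Om : measurableType d) (P : probability Om R)
    (xi : nat -> {RV P >-> borel X}) n (pi : {set {set 'I_n}}) :
  polish R X -> (forall x : borel X, x <> x0 -> H [set x] = 0%E) ->
  H [set (x0 : borel X)] = a%:E -> gSSS q H xi ->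
  P [set w | induced_partition xi n w = pi] =
  (\sum_(rho | is_part rho) q (block_sizes rho) * amalgam_prob a rho pi)%:E.
Proof.
move=> /polish_separating_opens [U [U_open U_sep]] H_atom H_x0.
move=> [Pt ciid [d' [Om' [P' [p [pd [Z [mu [[p01 p_sum] [Z_iid pZ] [p_pd kq] mu_pZ law]]]]]]]]].
have mE : measurable [set w | fibers (fun i : 'I_n => xi i w) == pi].
  by apply: (measurable_fibers_rv U_open U_sep (f := fun i : 'I_n => xi i)).
have -> : [set w | induced_partition xi n w = pi] =
    [set w | fibers (fun i : 'I_n => xi i w) == pi].
  by apply/seteqP; split => w /= /eqP.
rewrite -fine_probK//; congr EFin.
have p1 : {ae P', forall w, (\sum_(t < N) p t w) @[N --> \oo] --> (1 : R)}.
  apply: filterS p_sum => w pw.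
  have : (\sum_(0 <= j < N) (p j w)%:E)%E @[N --> \oo] --> 1%:E.
    rewrite -pw; apply: is_cvg_nneseries => j _ _.
    by rewrite lee_fin; case/andP: (p01 j w).
  under eq_fun do rewrite big_mkord sumEFin.
  by move=> /fine_cvgP[_].
have S1 : (\int[P']_w (\sum_(t < N) p t w) ^+ n) @[N --> \oo] --> (1 : R).
  by have [] := kingman_mean_pattern kq p01 p1 p_pd (fibers_partition (@id 'I_n)).
have A1 : (\int[P']_w atom_pattern p Z id N pi w) @[N --> \oo] -->
   \sum_(rho | is_part rho) q (block_sizes rho) * amalgam_prob a rho pi.
  under eq_fun do rewrite (mean_atom_pattern U_open U_sep Z_iid pZ p01 H_atom H_x0).
  apply: cvg_sum_seq => rho rhop; apply: cvgM; last exact: cvg_cst.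
  by have [] := kingman_mean_pattern kq p01 p1 p_pd rhop.
apply: (@cvg_unique _ (@Rhausdorff R) ((\int[P']_w atom_pattern p Z id N pi w) @[N --> \oo])) => //.
apply/cvgrPdist_le => e e0.
have /cvgrPdist_le/(_ e e0) := S1; apply: filterS => N hN.
apply: le_trans (mean_atom_pattern_gap ciid law U_open U_sep p01 mu_pZ N pi) _.
exact: le_trans (ler_norm _) hN.
Qed.

(** * Summation over amalgamations *)

Section AmalgamSum.
Variable I : finType.
Implicit Types (rho W pi tau : {set {set I}}) (B : {set I}).

Lemma amalgam0 rho : is_part rho -> amalgam rho finset.set0 = rho.
Proof.
move=> rhop; rewrite -[RHS](fibers_pblock rhop); apply: eq_fibers => i j.
by rewrite /= !inE.
Qed.

Lemma amalgamE rho W : is_part rho -> W \subset rho -> W != finset.set0 ->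
  amalgam rho W = (finset.cover W |: (rho :\: W))%SET.
Proof.
move=> rhop Wrho /set0Pn[B0 B0W].
have inW i : (finset.pblock rho i \in W) = (i \in finset.cover W).
  apply/idP/bigcupP => [iW|[B BW iB]].
    by exists (finset.pblock rho i); rewrite // mem_pblock_part.
  by rewrite (def_pblock (partition_trivIset rhop) (fintype.subsetP Wrho _ BW) iB).
have fE i : [set j in [set: I] | (if finset.pblock rho i \in W then None
      else Some (finset.pblock rho i)) == (if finset.pblock rho j \in W then None
      else Some (finset.pblock rho j))]%SET =
    if i \in finset.cover W then finset.cover W else finset.pblock rho i.
  apply/setP => j; rewrite !inE /= -inW; case: ifPn => iW.
    by rewrite -inW; case: ifP.
  rewrite mem_pblock_part//; case: ifPn => // jW.
  by apply/esym/negbTE; apply: contraNneq iW => ->.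
rewrite /amalgam /fibers /finset.preim_partition /finset.equivalence_partition.
apply/setP => C; rewrite !inE; apply/imsetP/orP => [[i _ ->]|].
  rewrite fE; case: ifPn => iW; [by left; rewrite eqxx|right].
  by rewrite inW iW pblock_mem// (cover_partition rhop) inE.
have rho0 B : B \in rho -> exists i, i \in B.
  by move=> Brho; apply/set0Pn; exact: partition_neq0 rhop Brho.
case=> [/eqP ->|/andP[CW Crho]].
  have [i iB0] := rho0 B0 (fintype.subsetP Wrho _ B0W); exists i => //.
  by rewrite fE (_ : i \in finset.cover W)//; apply/bigcupP; exists B0.
have [i iC] := rho0 C Crho; exists i => //; rewrite fE -inW.
by rewrite (def_pblock (partition_trivIset rhop) Crho iC) (negbTE CW).
Qed.

Lemma split_block_part pi B tau : is_part pi -> B \in pi ->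
  finset.partition tau B ->
  is_part (tau :|: (pi :\ B))%SET /\ (tau :&: (pi :\ B))%SET = finset.set0.
Proof.
move=> pip Bpi; rewrite finset.setUC finset.setIC; apply: partition_union.
by rewrite -finset.setTD; exact: partitionD1.
Qed.

Lemma setUK_disjoint W rho :
  (W :&: rho)%SET = finset.set0 -> ((W :|: rho) :\: W)%SET = rho.
Proof.
move=> dis; rewrite finset.setDUl finset.setDv finset.set0U.
by apply/finset.setDidPl; rewrite -finset.setI_eq0 finset.setIC dis.
Qed.

(** The term [W = set0] forces [rho = pi]. Otherwise [cover W] is a block [B] of
    [pi], [W] is a partition [tau] of [B] and [rho] is [pi] with [B] replaced by
    [tau]; conversely every pair of a block and a partition of it arises so. *)
Lemma sum_amalgam (R : realDomainType) (a : R) (Q : {set {set I}} -> R) pi :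
  is_part pi ->
  \sum_(rho | is_part rho) Q rho *
     (\sum_(W : {set {set I}} | (W \subset rho) && (amalgam rho W == pi))
        a ^+ #|W| * (1 - a) ^+ #|rho :\: W|) =
  (1 - a) ^+ #|pi| * Q pi + (1 - a) ^+ #|pi|.-1 *
    \sum_(B in pi) \sum_(tau | finset.partition tau B)
       a ^+ #|tau| * Q (tau :|: (pi :\ B))%SET.
Proof.
move=> pip.
under eq_bigr => rho rhop.
  rewrite (bigID (fun W : {set {set I}} => W == finset.set0)) /= mulrDr.
  over.
rewrite big_split /=; congr (_ + _).
  rewrite (bigD1 pi) //= [X in _ + X]big1 ?addr0; last first.
    move=> rho /andP[rhop rhopi]; rewrite big1 ?mulr0// => W /andP[/andP[_ +] /eqP WE].
    by rewrite WE amalgam0// (negbTE rhopi).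
  rewrite (big_pred1 finset.set0) => [|W]; last first.
    by rewrite /= andbC; case: eqP => [->|]//; rewrite finset.sub0set amalgam0// eqxx.
  by rewrite cards0 finset.setD0 mul1r mulrC.
rewrite mulr_sumr.
under eq_bigr do rewrite mulr_sumr.
under [RHS]eq_bigr do rewrite mulr_sumr.
rewrite !pair_big_dep /=.
(* The pair of [B] and [tau] gives the refinement of [pi] and the set [W = tau] to
   amalgamate; [B] is recovered as the union of [W]. *)
rewrite (reindex_onto (fun z : {set I} * {set {set I}} => ((z.2 :|: (pi :\ z.1))%SET, z.2))
   (fun z => (finset.cover z.2, z.2))) /=.
  have condE B tau : [&& is_part (tau :|: pi :\ B)%SET,
      (tau \subset tau :|: pi :\ B)%SET && (amalgam (tau :|: pi :\ B)%SET tau == pi)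
      & tau != finset.set0] && ((finset.cover tau, tau) == (B, tau)) =
      (B \in pi) && finset.partition tau B.
    apply/idP/idP => [/andP[/and3P[rhop /andP[sub /eqP mE] t0] /eqP[cB]]|].
      rewrite (amalgamE rhop sub t0) cB in mE.
      rewrite -mE setU11 /= -cB; apply/and3P; split => //.
        exact: finset.trivIsetS sub (partition_trivIset rhop).
      by apply: contraFN (partition0 rhop); exact: (fintype.subsetP sub).
    move=> /andP[Bpi taup].
    have [rhop dis] := split_block_part pip Bpi taup.
    have c1 := cover_partition taup.
    have t0 : tau != finset.set0.
      apply: contraTneq (partition_neq0 pip Bpi) => t0.
      by rewrite negbK -c1 t0 /finset.cover big_set0.
    rewrite rhop finset.subsetUl t0 c1 eqxx !andbT /= (amalgamE rhop)// ?finset.subsetUl//.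
    by rewrite c1 setUK_disjoint// finset.setD1K.
  apply: eq_big => [[B tau]|[B tau]] /=; first exact: condE.
  rewrite condE => /andP[Bpi taup].
  have [_ dis] := split_block_part pip Bpi taup.
  by rewrite setUK_disjoint// (cardsD1 B pi) Bpi add1n mulrA mulrC [Q _ * _]mulrC.
move=> [rho W] /= /and3P[rhop /andP[sub /eqP mE] W0]; congr (_, _).
have notin : finset.cover W \notin (rho :\: W)%SET.
  have /set0Pn[C CW] := W0; have Crho := fintype.subsetP sub _ CW.
  have /set0Pn[i iC] := partition_neq0 rhop Crho.
  apply/negP; rewrite inE => /andP[cW crho]; case/negP: cW.
  have icW : i \in finset.cover W by apply/bigcupP; exists C.
  by rewrite -(def_pblock (partition_trivIset rhop) crho icW)
    (def_pblock (partition_trivIset rhop) Crho iC).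
rewrite -mE (amalgamE rhop sub W0) setU1K//.
by apply/setP => C; rewrite !inE; case: (boolP (C \in W)) => //= /(fintype.subsetP sub) ->.
Qed.

End AmalgamSum.

(** * Sums over the partitions of a finite set *)

Section PartitionSums.
Variables (R : realFieldType).

Definition part_sizes (T : finType) (tau : {set {set T}}) : seq nat :=
  [seq #|B| | B : {set T} <- enum tau].

(** Split a partition into the block of [x] and the rest. *)
Lemma sum_part_rec (T : finType) (A : {set T}) x (F : {set {set T}} -> R) :
  x \in A ->
  \sum_(tau | finset.partition tau A) F tau =
  \sum_(B : {set T} | (x \in B) && (B \subset A))
     \sum_(tau | finset.partition tau (A :\: B)%SET) F (B |: tau)%SET.
Proof.
move=> xA.
rewrite (partition_big (fun tau => finset.pblock tau x)
  (fun B : {set T} => (x \in B) && (B \subset A))) /=; last first.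
  move=> tau taup; rewrite mem_pblock (cover_partition taup) xA /=.
  by apply: (partitionS taup); rewrite pblock_mem// (cover_partition taup).
apply: eq_bigr => B /andP[xB BA].
rewrite (reindex_onto (fun tau => B |: tau)%SET (fun tau => tau :\ B)%SET) /=; last first.
  move=> tau /andP[taup /eqP <-]; rewrite finset.setD1K//.
  by rewrite pblock_mem// (cover_partition taup).
apply: eq_bigl => tau; apply/idP/idP => [/andP[/andP[taup _] /eqP tauE]|taup].
  by rewrite -tauE; apply: partitionD1 => //; rewrite setU11.
have Btau : B \notin tau.
  apply/negP => Btau; have := partitionS taup Btau => /fintype.subsetP /(_ x xB).
  by rewrite inE xB.
have Bp : finset.partition (B |: tau)%SET A.
  have -> : A = (B :|: (A :\: B))%SET.
    by apply/setP => y; rewrite !inE; case: (boolP (y \in B)) => //= /(fintype.subsetP BA) ->.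
  apply: partitionU1 => //.
  - by apply/set0Pn; exists x.
  - by rewrite -finset.setI_eq0; apply/eqP/setP => y; rewrite !inE; case: (y \in B); rewrite ?andbF.
rewrite Bp setU1K// eqxx andbT /=; apply/eqP.
by apply: (def_pblock (partition_trivIset Bp)); rewrite // setU11.
Qed.

Lemma sum_subsets_card (T : finType) (A : {set T}) (g : nat -> R) :
  \sum_(B : {set T} | B \subset A) g #|B| =
  \sum_(j < #|A|.+1) g j *+ 'C(#|A|, j).
Proof.
rewrite (partition_big (fun B : {set T} => inord #|B| : 'I_#|A|.+1) predT) //=.
apply: eq_bigr => j _; rewrite -cards_draws -sumr_const.
apply: eq_big => [B|B /andP[BA /eqP <-]].
  rewrite inE; apply/andb_id2l => BA; rewrite -val_eqE /= inordK// ltnS.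
  exact: subset_leq_card.
by rewrite inordK// ltnS subset_leq_card.
Qed.

Lemma sum_pointed_subsets_card (T : finType) (A : {set T}) x (g : nat -> R) :
  x \in A ->
  \sum_(B : {set T} | (x \in B) && (B \subset A)) g #|B| =
  \sum_(j < #|A|) g j.+1 *+ 'C(#|A|.-1, j).
Proof.
move=> xA.
rewrite (reindex_onto (fun C => x |: C)%SET (fun B => B :\ x)%SET) /=; last first.
  by move=> B /andP[xB _]; rewrite finset.setD1K.
have cA : #|A| = #|(A :\ x)%SET|.+1 by rewrite (cardsD1 x A) xA.
rewrite cA /= -(sum_subsets_card _ (fun j => g j.+1)).
have E (C : {set T}) : [&& x \in (x |: C)%SET, (x |: C)%SET \subset A &
    ((x |: C) :\ x)%SET == C] = (C \subset A :\ x).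
  rewrite setU11 /= subsetD1 finset.subUset finset.sub1set xA /=; congr (_ && _).
  apply/eqP/idP => [<-|xC]; last exact: setU1K.
  by rewrite !inE eqxx.
apply: eq_big => [C|C]; first by rewrite -E andbA.
rewrite -andbA E subsetD1 => /andP[_ xC].
by rewrite cardsU1 xC.
Qed.

(** A sum over the partitions of a set with [m] elements, computed from [m] alone:
    the block of a fixed element is chosen by choosing its [j] other elements. The
    argument [fuel] bounds the number of blocks and makes the recursion
    structural. *)
Fixpoint partition_sum (fuel m : nat) (f : seq nat -> R) : R :=
  if fuel is fuel'.+1 then
    if m is m'.+1 then
      \sum_(j < m'.+1) partition_sum fuel' (m' - j) (fun s => f (j.+1 :: s)) *+ 'C(m', j)
    else f [::]
  else f [::].

(** Lists with a zero are left out because the symmetry of an EPPF concerns sizes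
    of blocks. *)
Definition size_symmetric (f : seq nat -> R) : Prop :=
  forall s t, all (leq 1) s -> perm_eq s t -> f s = f t.

Lemma part_sizes_gt0 (T : finType) (A : {set T}) tau :
  finset.partition tau A -> all (leq 1) (part_sizes tau).
Proof.
move=> taup; apply/allP => _ /mapP[B + ->]; rewrite mem_enum => Btau.
by rewrite card_gt0; exact: partition_neq0 taup Btau.
Qed.

Lemma part_sizes_setU1 (T : finType) (B : {set T}) (tau : {set {set T}}) : B \notin tau ->
  perm_eq (part_sizes (B |: tau)%SET) (#|B| :: part_sizes tau).
Proof.
move=> Btau; rewrite /part_sizes -[_ :: _]/(map (fun B : {set T} => #|B|) (B :: enum tau)).
apply: perm_map; apply: uniq_perm; rewrite /= ?enum_uniq ?mem_enum ?Btau//.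
by move=> C; rewrite mem_enum !inE mem_enum.
Qed.

Lemma sum_partition_sum (T : finType) fuel (A : {set T}) (f : seq nat -> R) :
  size_symmetric f -> (#|A| <= fuel)%N ->
  \sum_(tau | finset.partition tau A) f (part_sizes tau) =
  partition_sum fuel #|A| f.
Proof.
elim: fuel A f => [|fuel IH] A f fsym.
  rewrite leqn0 cards_eq0 => /eqP ->; rewrite (big_pred1 finset.set0) => [|tau].
    by rewrite /part_sizes enum_set0.
  exact: partition_set0.
have [->|/set0Pn[x xA]] := eqVneq A finset.set0.
  move=> _; rewrite cards0 /= (big_pred1 finset.set0) => [|tau].
    by rewrite /part_sizes enum_set0.
  exact: partition_set0.
move=> Afuel; rewrite (sum_part_rec _ xA).
rewrite (eq_bigr (fun B : {set T} => partition_sum fuel (#|A| - #|B|)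
   (fun s => f (#|B| :: s)))) => [|B /andP[xB BA]]; last first.
  have cAB : #|(A :\: B)%SET| = (#|A| - #|B|)%N by rewrite cardsDS.
  have B0 : (0 < #|B|)%N by rewrite card_gt0; apply/set0Pn; exists x.
  rewrite -cAB -IH; last by rewrite cAB; lia.
    apply: eq_bigr => tau taup; apply: fsym.
      apply/allP => _ /mapP[C + ->]; rewrite mem_enum !inE card_gt0.
      case/orP => [/eqP ->|]; first by rewrite -card_gt0.
      exact: partition_neq0 taup.
    apply: part_sizes_setU1; apply/negP => Btau.
    have := partitionS taup Btau => /fintype.subsetP /(_ x xB).
    by rewrite inE xB.
  by move=> s t s0 st; apply: fsym; rewrite /= ?B0// perm_cons.
rewrite (sum_pointed_subsets_card (fun m => partition_sum fuel (#|A| - m)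
  (fun s => f (m :: s))) xA).
have [m cA] : exists m, #|A| = m.+1 by exists #|A|.-1; rewrite prednK// card_gt0; apply/set0Pn; exists x.
by rewrite cA /=; apply: eq_bigr => j _; rewrite subSS.
Qed.

Lemma sum_partitions_card (T T' : finType) (A : {set T}) (A' : {set T'})
    (f : seq nat -> R) : size_symmetric f -> #|A| = #|A'| ->
  \sum_(tau | finset.partition tau A) f (part_sizes tau) =
  \sum_(tau | finset.partition tau A') f (part_sizes tau).
Proof.
by move=> fs AA'; rewrite !(sum_partition_sum (fuel := #|A|))// AA'.
Qed.

Lemma partition_sumZ fuel m c (f : seq nat -> R) :
  partition_sum fuel m (fun s => c * f s) = c * partition_sum fuel m f.
Proof.
elim: fuel m f => [|fuel IH] [|m] f //=.
rewrite mulr_sumr; apply: eq_bigr => j _.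
by rewrite (IH _ (fun s => f (j.+1 :: s))) mulrnAr.
Qed.

Lemma partition_sum0 fuel m : partition_sum fuel m (fun=> 0) = 0.
Proof.
by elim: fuel m => [|fuel IH] [|m] //=; rewrite big1// => j _; rewrite IH mul0rn.
Qed.

End PartitionSums.

(** * Generalized Stirling numbers *)

Section Stirling.
Variables (R : realType) (sigma : R).
Local Notation w := (rising (1 - sigma)).

(** The generalized Stirling numbers without the factor [n`!]. The bound [N] on the
    sizes and the multiplicities is kept apart from [n], so that the index type
    stays the same in a recursion on [n]. *)
Definition stirling_coef (N n k : nat) : R :=
  \sum_(l : {ffun 'I_N -> 'I_N.+1} |
      (\sum_(j < N) j.+1 * l j == n)%N && (\sum_(j < N) l j == k)%N)
    \prod_(j < N) ((w j / (j.+1)`!%:R) ^+ l j / (l j)`!%:R).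

Lemma gen_stirlingE n k : gen_stirling sigma n k = n`!%:R * stirling_coef n n k.
Proof.
rewrite /gen_stirling /stirling_coef mulr_sumr; apply: eq_bigr => l _.
rewrite [RHS]mulrC mulrCA [RHS]mulrC; congr (_ * _).
rewrite -prodfV -big_split /=; apply: eq_bigr => j _.
rewrite natrM natrX exprMn exprVn invfM -mulrA; congr (_ * _).
by rewrite mulrC.
Qed.

Lemma stirling_coef0 N k : stirling_coef N 0 k = (k == 0)%:R.
Proof.
rewrite /stirling_coef; have [->|k0] := eqVneq k 0%N.
  rewrite (big_pred1 [ffun=> ord0]) => [|l].
    by rewrite big1// => j _; rewrite ffunE expr0 divr1.
  rewrite /= !sum_nat_eq0; apply/andP/eqP => [[/forallP h _]|->].
    by apply/ffunP => j; rewrite ffunE; apply/val_inj/eqP; have := h j; rewrite muln_eq0.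
  by split; apply/forallP => j; rewrite ffunE ?muln0.
rewrite big_pred0// => l; apply/negbTE; apply: contra k0 => /andP[].
rewrite sum_nat_eq0 => /forallP h /eqP <-; rewrite sum_nat_eq0; apply/forallP => j.
by have := h j; rewrite muln_eq0.
Qed.

Lemma stirling_coefS0 N n : stirling_coef N n.+1 0 = 0.
Proof.
rewrite /stirling_coef big_pred0// => l; apply/negbTE; apply/negP => /andP[].
move=> /eqP hn; rewrite sum_nat_eq0 => /forallP h.
suff : n.+1 = 0%N by [].
rewrite -hn; apply/eqP; rewrite sum_nat_eq0; apply/forallP => j.
by have /eqP -> := h j; rewrite muln0.
Qed.

(** Removing one block of size [j.+1] lowers [l j] by one, and the factor [l j]
    cancels against [(l j)`!]. *)
Lemma stirling_coef_remove N n k (j : 'I_N) : (n <= N)%N ->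
  \sum_(l : {ffun 'I_N -> 'I_N.+1} |
      (\sum_(i < N) i.+1 * l i == n)%N && (\sum_(i < N) l i == k.+1)%N)
    (l j)%:R * \prod_(i < N) ((w i / (i.+1)`!%:R) ^+ l i / (l i)`!%:R) =
  if (j < n)%N then w j / (j.+1)`!%:R * stirling_coef N (n - j.+1) k else 0.
Proof.
move=> nN; case: ltnP => jn; last first.
  rewrite big1// => l /andP[/eqP ln _].
  suff -> : (l j : nat) = 0%N by rewrite mul0r.
  have : (j.+1 * l j <= n)%N by rewrite -ln (bigD1 j)//= leq_addr.
  by case: (val (l j)) => // m; nia.
rewrite (bigID (fun l : {ffun 'I_N -> 'I_N.+1} => 0 < l j)%N) /= [X in _ + X]big1 ?addr0; last first.
  by move=> l /andP[_]; rewrite -eqn0Ngt => /eqP ->; rewrite mul0r.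
pose inc (l : {ffun 'I_N -> 'I_N.+1}) : {ffun 'I_N -> 'I_N.+1} :=
  [ffun i => if i == j then inord (l i).+1 else l i].
pose dec (l : {ffun 'I_N -> 'I_N.+1}) : {ffun 'I_N -> 'I_N.+1} :=
  [ffun i => if i == j then inord (l i).-1 else l i].
have incE (l : {ffun 'I_N -> 'I_N.+1}) : (l j < N)%N -> forall i, inc l i = (l i + (i == j))%N :> nat.
  move=> lj i; rewrite ffunE; case: eqP => [->|_]; last by rewrite addn0.
  by rewrite inordK ?addn1// ltnS.
have incK (l : {ffun 'I_N -> 'I_N.+1}) : (l j < N)%N -> dec (inc l) = l.
  move=> lj; apply/ffunP => i; rewrite ffunE; case: (eqVneq i j) => [->|ij].
    by rewrite incE// eqxx addn1 /= inord_val.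
  by rewrite ffunE (negbTE ij).
rewrite (reindex_onto inc dec) /=; last first.
  move=> l /andP[_ l0]; apply/ffunP => i; rewrite !ffunE; case: eqP => [->|//].
  rewrite inordK ?prednK ?inord_val//.
  exact: ltnW.
rewrite mulr_sumr.
have sumE (l : {ffun 'I_N -> 'I_N.+1}) : (l j < N)%N -> (\sum_(i < N) i.+1 * inc l i = \sum_(i < N) i.+1 * l i + j.+1)%N /\
    (\sum_(i < N) inc l i = (\sum_(i < N) l i).+1)%N.
  move=> lj; split.
    under eq_bigr do rewrite incE// mulnDr.
    rewrite big_split /=; congr (_ + _)%N; rewrite (bigD1 j)//= eqxx muln1.
    by rewrite big1 ?addn0// => i /negbTE ->; rewrite muln0.
  under eq_bigr do rewrite incE//.
  rewrite big_split /= -[RHS]addn1; congr (_ + _)%N; rewrite (bigD1 j)//= eqxx.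
  by rewrite big1 ?addn0// => i /negbTE ->.
have condE (l : {ffun 'I_N -> 'I_N.+1}) : [&& (\sum_(i < N) i.+1 * inc l i == n)%N && (\sum_(i < N) inc l i == k.+1)%N,
    (0 < inc l j)%N & dec (inc l) == l] =
    (\sum_(i < N) i.+1 * l i == n - j.+1)%N && (\sum_(i < N) l i == k)%N.
  have [lj|lj] := ltnP (l j) N.
    have [-> ->] := sumE l lj; rewrite incK// incE// !eqxx addn1 /= andbT eqSS.
    by congr (_ && _); apply/eqP/eqP; lia.
  (* The constraint on [l] excludes the value at which [inord] overflows. *)
  have lN : l j = N :> nat by apply/eqP; rewrite eqn_leq lj -ltnS ltn_ord.
  apply/idP/idP => [/and3P[_ + _]|/andP[/eqP h _]].
    by rewrite ffunE eqxx lN /inord /insubd insubF ?ltnn.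
  have : (j.+1 * l j <= n - j.+1)%N by rewrite -h (bigD1 j)//= leq_addr.
  rewrite lN; nia.
apply: eq_big => [l|l]; first by rewrite -andbA condE.
rewrite -andbA condE => /andP[/eqP h _].
have lj : (l j < N)%N.
  have : (j.+1 * l j <= n - j.+1)%N by rewrite -h (bigD1 j)//= leq_addr.
  nia.
rewrite (bigD1 j)//= [in RHS](bigD1 j)//= !incE// eqxx addn1.
rewrite (eq_bigr (fun i : 'I_N => (w i / (i.+1)`!%:R) ^+ l i / (l i)`!%:R)); last first.
  by move=> i /negbTE ij; rewrite incE// ij addn0.
have gen (c x y : R) m :
    m.+1%:R * (c * x / (m.+1)`!%:R * y) = c * (x / m`!%:R * y).
  rewrite factS natrM; have m0 : m.+1%:R != 0 :> R by rewrite pnatr_eq0.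
  have f0 : m`!%:R != 0 :> R by rewrite pnatr_eq0 -lt0n fact_gt0.
  move: (m.+1%:R) (m`!%:R) m0 f0 => u v u0 v0.
  by field; rewrite u0 v0.
by rewrite exprS; exact: gen.
Qed.

(** Write [n] as the sum of the [j.+1 * l j] and exchange the sums. *)
Lemma stirling_coefS N n k : (n <= N)%N ->
  n%:R * stirling_coef N n k.+1 =
  \sum_(j < n) j.+1%:R * (w j / (j.+1)`!%:R) * stirling_coef N (n - j.+1) k.
Proof.
move=> nN; rewrite /stirling_coef mulr_sumr.
transitivity (\sum_(j < N) j.+1%:R * (if (j < n)%N then
    w j / (j.+1)`!%:R * stirling_coef N (n - j.+1) k else 0)).
  under [RHS]eq_bigr => j _ do rewrite -(stirling_coef_remove k j nN) mulr_sumr.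
  rewrite exchange_big /=; apply: eq_bigr => l /andP[/eqP ln _].
  under [RHS]eq_bigr => j _ do rewrite mulrA -natrM.
  by rewrite -mulr_suml -natr_sum ln.
rewrite (big_ord_widen N (fun j => j.+1%:R * (w j / (j.+1)`!%:R) * stirling_coef N (n - j.+1) k) nN).
rewrite [RHS]big_mkcond /=; apply: eq_bigr => j _.
by case: ifP => _; rewrite ?mulr0// mulrA.
Qed.

(** The dependence of a Gibbs EPPF on the sizes of [k] blocks, extended by zero to
    other numbers of blocks. *)
Definition block_weight k (s : seq nat) : R :=
  (size s == k)%:R * \prod_(m <- s) w m.-1.

Lemma block_weight_sym k : size_symmetric (block_weight k).
Proof.
by move=> s t _ st; rewrite /block_weight (perm_size st) (perm_big _ st).
Qed.

(** Both sides satisfy the recursion that removes the block of a fixed element,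
    because [m.+1 * 'C(m, j) * j`! * (m - j)`!] is [m.+1`!]. *)
Lemma partition_sum_stirling fuel N m k : (m <= fuel)%N -> (m <= N)%N ->
  partition_sum fuel m (block_weight k) = m`!%:R * stirling_coef N m k.
Proof.
elim: fuel m k => [|fuel IH] [|m] k // mf mN.
- by rewrite /= /block_weight big_nil mulr1 fact0 mul1r stirling_coef0 eq_sym.
- by rewrite /= /block_weight big_nil mulr1 fact0 mul1r stirling_coef0 eq_sym.
case: k => [|k].
  rewrite stirling_coefS0 mulr0 /= big1// => j _.
  rewrite (_ : (fun s => _) = fun=> 0) ?partition_sum0 ?mul0rn//.
  by apply/funext => s; rewrite /block_weight /= mul0r.
rewrite factS natrM mulrC mulrA [X in _ = X * _]mulrC.
rewrite [X in _ = X](_ : _ = m`!%:R * (m.+1%:R * stirling_coef N m.+1 k.+1)); last first.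
  by rewrite !mulrA [m`!%:R * _]mulrC mulrAC.
rewrite stirling_coefS// mulr_sumr /=; apply: eq_bigr => j _.
rewrite (_ : (fun s => _) = fun s => w j * block_weight k s); last first.
  by apply/funext => s; rewrite /block_weight /= eqSS big_cons mulrCA.
rewrite partition_sumZ IH ?subSS; [|lia|lia].
have jm : (j <= m)%N by rewrite -ltnS.
have fE := bin_fact jm.
rewrite -[LHS]mulr_natr factS -fE !natrM.
have f0 i : i`!%:R != 0 :> R by rewrite pnatr_eq0 -lt0n fact_gt0.
have j0 : j.+1%:R != 0 :> R by rewrite pnatr_eq0.
have := f0 j; have := f0 (m - j)%N; move: j0.
move: (j.+1%:R) (j`!%:R) ((m - j)`!%:R) ('C(m, j)%:R) (w j) (stirling_coef N (m - j) k).
move=> u v x y z t u0 x0 v0.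
by field; rewrite u0 v0.
Qed.

Lemma sum_partitions_stirling (T : finType) (A : {set T}) k :
  \sum_(tau | finset.partition tau A) block_weight k (part_sizes tau) =
  gen_stirling sigma #|A| k.
Proof.
rewrite (sum_partition_sum (fuel := #|A|) (@block_weight_sym k))//.
by rewrite (partition_sum_stirling (N := #|A|))// gen_stirlingE.
Qed.

End Stirling.

(** * Extensions of a partition by new elements *)

Section PartSizes.
Variable T : finType.
Implicit Types (P Q : {set {set T}}).

Lemma part_sizes_setU P Q : (P :&: Q)%SET = finset.set0 ->
  perm_eq (part_sizes (P :|: Q)%SET) (part_sizes P ++ part_sizes Q).
Proof.
move=> dis; rewrite /part_sizes -map_cat; apply: perm_map; apply: uniq_perm.
- exact: enum_uniq.
- rewrite cat_uniq !enum_uniq /= andbT; apply/hasPn => B; rewrite !mem_enum => BQ.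
  apply/negP => BP; have : B \in (P :&: Q)%SET by rewrite inE BP.
  by rewrite dis inE.
- by move=> B; rewrite mem_cat !mem_enum inE.
Qed.

End PartSizes.

Lemma block_sizes_perm n (pi : {set {set 'I_n}}) : is_part pi ->
  perm_eq (block_sizes pi) (part_sizes pi).
Proof. by move=> pip; apply: perm_map; exact: blocks_perm. Qed.

Lemma size_block_sizes_card n (pi : {set {set 'I_n}}) : is_part pi ->
  size (block_sizes pi) = #|pi|.
Proof.
by move=> pip; rewrite (perm_size (block_sizes_perm pip)) size_map cardE.
Qed.

Section Extension.
Variables (m n : nat) (le_mn : (m <= n)%N).
Implicit Types (alpha : {set {set 'I_m}}) (beta pi : {set {set 'I_n}}).
Local Notation wd := (widen_ord le_mn).

Definition new_elements : {set 'I_n} := [set i : 'I_n | (m <= i)%N]%SET.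
Definition lift_part alpha : {set {set 'I_n}} :=
  [set wd @: B | B : {set 'I_m} in alpha]%SET.

Lemma wd_inj : injective wd.
Proof. by move=> i j /(congr1 val) /= e; apply: val_inj. Qed.

Lemma wd_image : (wd @: [set: 'I_m])%SET = (~: new_elements)%SET.
Proof.
apply/setP => i; rewrite !inE -ltnNge; apply/imsetP/idP => [[j _ ->]|im].
  exact: (ltn_ord j).
by exists (Ordinal im) => //; apply: val_inj.
Qed.

Lemma card_new_elements : #|new_elements| = (n - m)%N.
Proof.
have := cardsC new_elements; rewrite -wd_image card_imset ?cardsT ?card_ord//; last exact: wd_inj.
lia.
Qed.

Lemma lift_partition alpha : is_part alpha ->
  finset.partition (lift_part alpha) (~: new_elements)%SET.
Proof. by move=> ap; rewrite -wd_image imset_partition//; exact: wd_inj. Qed.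

Lemma enum_ord_split :
  enum 'I_n = [seq wd i | i <- enum 'I_m] ++ [seq i : 'I_n <- enum 'I_n | (m <= i)%N].
Proof.
apply: (inj_map val_inj); rewrite map_cat -[X in _ = X ++ _]map_comp.
rewrite (_ : [seq val i | i <- [seq i : 'I_n <- enum 'I_n | (m <= i)%N]] =
  [seq i <- iota 0 n | (m <= i)%N]); last by rewrite -val_enum_ord filter_map.
rewrite val_enum_ord (eq_map (g := val))// val_enum_ord.
rewrite -[n in LHS](subnKC le_mn) iotaD add0n; congr (_ ++ _).
rewrite -[n in RHS](subnKC le_mn) iotaD add0n filter_cat.
rewrite (@eq_in_filter _ _ pred0) ?filter_pred0 ?cat0s; last first.
  by move=> i; rewrite mem_iota /= add0n ltnNge => /negbTE.
rewrite (@eq_in_filter _ _ predT) ?filter_predT//.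
by move=> i; rewrite mem_iota => /andP[->].
Qed.

Local Notation is_min pi i := [forall j in finset.pblock pi i, (i <= j)%N].

(** The smallest element of a block is below [m] exactly if the block meets the
    first [m] elements, so the blocks of the restriction come first, in the same
    order. *)
Lemma blocks_restrict pi : is_part pi ->
  let alpha := restrict_partition le_mn pi in
  blocks pi =
    [seq finset.pblock pi (wd i) | i <- enum 'I_m & is_min alpha i] ++
    [seq finset.pblock pi i | i <- enum 'I_n & is_min pi i && (m <= i)%N].
Proof.
move=> pip alpha; rewrite /blocks {1}enum_ord_split filter_cat map_cat; congr (_ ++ _).
  rewrite filter_map -map_comp; congr map; apply: eq_filter => i /=.
  rewrite /alpha restrict_fibers//; apply/forall_inP/forall_inP => h j.
    rewrite mem_pblock_fibers /= => ij; have := h (wd j); rewrite mem_pblock_part//.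
    exact.
  move=> ij; have [jm|mj] := ltnP j m; last by rewrite (leq_trans _ mj)// ltnW//=.
  apply: (h (Ordinal jm)); rewrite mem_pblock_fibers /=.
  by rewrite (_ : wd (Ordinal jm) = j) -?mem_pblock_part//; exact: val_inj.
by rewrite -filter_predI; congr map; apply: eq_filter => i /=.
Qed.

Lemma restrict_part pi : is_part pi -> is_part (restrict_partition le_mn pi).
Proof. by move=> pip; rewrite restrict_fibers//; exact: fibers_partition. Qed.

(** A block of the restriction is included in one of the first blocks of [pi],
    hence equal to it when the sizes agree: no new element has joined it. *)
Lemma lift_part_sub pi : is_part pi ->
  let alpha := restrict_partition le_mn pi in
  take (size (block_sizes alpha)) (block_sizes pi) = block_sizes alpha ->
  lift_part alpha \subset pi.
Proof.
move=> pip alpha; have ap : is_part alpha by exact: restrict_part.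
rewrite {1 2}/block_sizes size_map (blocks_restrict pip) -/alpha map_cat.
rewrite take_size_cat; last by rewrite !size_map.
rewrite /block_sizes /blocks -!map_comp => /eq_in_map h.
apply/fintype.subsetP => _ /imsetP[B Ba ->].
move: (Ba); rewrite -mem_blocks// => /mapP[i imin BE].
have := h i imin => /=; rewrite -BE => cardE.
have sub : (wd @: B)%SET \subset finset.pblock pi (wd i).
  apply/fintype.subsetP => _ /imsetP[j jB ->]; rewrite mem_pblock_part//.
  by move: jB; rewrite BE /alpha restrict_fibers// mem_pblock_fibers.
have -> : (wd @: B)%SET = finset.pblock pi (wd i).
  by apply/eqP; rewrite eqEcard sub cardE (card_imset _ wd_inj) leqnn.
by rewrite pblock_mem// (cover_partition pip) inE.
Qed.

Section Join.
Variables (alpha : {set {set 'I_m}}) (beta : {set {set 'I_n}}).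
Hypothesis alpha_part : is_part alpha.
Hypothesis beta_part : finset.partition beta new_elements.
Let pi := (lift_part alpha :|: beta)%SET.

Lemma join_part : is_part pi.
Proof. by have [] := partition_union (lift_partition alpha_part) beta_part. Qed.

Lemma join_disjoint : (lift_part alpha :&: beta)%SET = finset.set0.
Proof. by have [] := partition_union (lift_partition alpha_part) beta_part. Qed.

Lemma join_pblock i : finset.pblock pi (wd i) = (wd @: finset.pblock alpha i)%SET.
Proof.
apply: (def_pblock (partition_trivIset join_part)).
  rewrite inE imset_f//; apply: pblock_mem.
  by rewrite (cover_partition alpha_part) inE.
by rewrite imset_f// mem_pblock_part.
Qed.

Lemma join_restrict : restrict_partition le_mn pi = alpha.
Proof.
rewrite (restrict_fibers _ join_part); apply/eqP/(fibers_pblockE _ alpha_part) => i j.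
by rewrite /= !join_pblock (inj_eq (imset_inj wd_inj)).
Qed.

Lemma join_block_sizes : exists t, block_sizes pi = block_sizes alpha ++ t.
Proof.
exists [seq #|finset.pblock pi i| | i <- enum 'I_n & is_min pi i && (m <= i)%N].
rewrite {1}/block_sizes (blocks_restrict join_part) join_restrict map_cat.
rewrite -!map_comp; congr (_ ++ _); rewrite /block_sizes /blocks -map_comp.
by apply: eq_map => i /=; rewrite join_pblock card_imset//; exact: wd_inj.
Qed.

Lemma part_sizes_lift : perm_eq (part_sizes (lift_part alpha)) (block_sizes alpha).
Proof.
rewrite perm_sym; apply: perm_trans (block_sizes_perm alpha_part) _.
rewrite /part_sizes (_ : [seq #|B| | B : {set 'I_m} <- enum alpha] =
   [seq #|B| | B : {set 'I_n} <- [seq (wd @: B)%SET | B : {set 'I_m} <- enum alpha]]); last first.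
  by rewrite -map_comp; apply: eq_map => B /=; rewrite card_imset//; exact: wd_inj.
apply: perm_map; apply: uniq_perm; rewrite ?enum_uniq ?map_inj_uniq ?enum_uniq//.
  exact: imset_inj wd_inj.
move=> B; rewrite mem_enum; apply/mapP/imsetP => -[C Ca ->]; exists C => //.
  by rewrite -mem_enum.
by rewrite mem_enum.
Qed.

Lemma join_sizes_perm :
  perm_eq (block_sizes pi) (block_sizes alpha ++ part_sizes beta).
Proof.
apply: perm_trans (block_sizes_perm join_part) _.
apply: perm_trans (part_sizes_setU join_disjoint) _.
by rewrite perm_cat2r part_sizes_lift.
Qed.

End Join.

End Extension.

(** Add the blocks one by one, each made of consecutive new elements. *)
Lemma block_sizes_exist (s : seq nat) n : all (leq 1) s -> sumn s = n ->
  exists2 pi : {set {set 'I_n}}, is_part pi & block_sizes pi = s.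
Proof.
elim/last_ind: s n => [|s x IH] n.
  move=> _ /= <-; exists finset.set0.
    apply/and3P; split; rewrite ?inE//; last by rewrite /finset.trivIset /finset.cover !big_set0 cards0.
    by apply/eqP/setP => -[].
  by rewrite /block_sizes /blocks (size0nil (size_enum_ord 0)).
rewrite all_rcons sumn_rcons => /andP[x0 s0] sn.
have [alpha ap aE] := IH _ s0 erefl.
have le : (sumn s <= n)%N by rewrite -sn leq_addr.
have bp : finset.partition [set new_elements (sumn s) n]%SET (new_elements (sumn s) n).
  apply/and3P; split; rewrite ?finset.cover1 ?finset.trivIset1 ?inE//.
  rewrite eq_sym -card_gt0 card_new_elements//; lia.
exists (lift_part le alpha :|: [set new_elements (sumn s) n])%SET.
  exact: join_part.
have [t tE] := join_block_sizes le ap bp.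
have /perm_size := join_sizes_perm le ap bp.
have := sumn_block_sizes (join_part le ap bp).
rewrite tE aE sumn_cat !size_cat /part_sizes size_map enum_set1 /=.
move=> st /addnI; case: t st {tE} => [//|y [|//]] /=; rewrite addn0 => st _.
by rewrite -cats1; congr (_ ++ [:: _]); lia.
Qed.

(** The partitions summed over on the left are [alpha] together with a partition
    of the new elements into [r] blocks. By [sum_partitions_card] the
    set of new elements may be replaced by any set [A] with as many elements,
    such as a block of another partition. *)
Lemma sum_extensions (R : realFieldType) m n (le_mn : (m <= n)%N)
    (alpha : {set {set 'I_m}}) r (q : seq nat -> R) (T : finType) (A : {set T}) :
  size_symmetric q -> is_part alpha -> #|A| = (n - m)%N ->
  \sum_(pi : {set {set 'I_n}} | is_part pi &&
     [&& restrict_partition le_mn pi == alpha,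
         size (block_sizes pi) == (size (block_sizes alpha) + r)%N &
         take (size (block_sizes alpha)) (block_sizes pi) == block_sizes alpha])
    q (block_sizes pi) =
  \sum_(tau | finset.partition tau A && (#|tau| == r))
    q (block_sizes alpha ++ part_sizes tau).
Proof.
move=> qsym ap cardA.
have bpos : all (leq 1) (block_sizes alpha).
  by rewrite (perm_all _ (block_sizes_perm ap)) (part_sizes_gt0 ap).
pose f t := if size t == r then q (block_sizes alpha ++ t) else 0.
have fsym : size_symmetric f.
  move=> t t' t0 tt'; rewrite /f (perm_size tt'); case: ifP => // _.
  by apply: qsym; rewrite ?all_cat ?bpos// perm_cat2l.
have size_ps (U : finType) (tau : {set {set U}}) : size (part_sizes tau) = #|tau|.
  by rewrite size_map cardE.
rewrite [RHS]big_mkcondr /=.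
under [RHS]eq_bigr => tau _ do rewrite -size_ps -/(f (part_sizes tau)).
rewrite (sum_partitions_card (A' := new_elements m n) fsym) ?card_new_elements//.
rewrite /f; under [RHS]eq_bigr => tau _ do rewrite size_ps.
rewrite -big_mkcondr /=.
rewrite (reindex_onto (fun beta => lift_part le_mn alpha :|: beta)%SET
  (fun pi => pi :\: lift_part le_mn alpha)%SET) /=; last first.
  move=> pi /andP[pip /and3P[/eqP res _ /eqP tk]].
  have sub : lift_part le_mn alpha \subset pi.
    by have := lift_part_sub (le_mn := le_mn) pip; rewrite res; exact.
  by apply/setP => B; rewrite !inE; case: (boolP (B \in lift_part le_mn alpha)) => //= /(fintype.subsetP sub) ->.
apply: eq_big => [beta|beta].
  apply/idP/idP => [/andP[/andP[pip /and3P[_ /eqP sz _]] /eqP dis0]|/andP[bp /eqP br]].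
    have dis : (lift_part le_mn alpha :&: beta)%SET = finset.set0.
      by rewrite -dis0; apply/setP => B; rewrite !inE; case: (B \in lift_part le_mn alpha); rewrite /= ?andbF.
    have bp : finset.partition beta (new_elements m n).
      apply: partition_complement pip dis _.
      exact: cover_partition (lift_partition le_mn ap).
    rewrite bp /=; have := join_sizes_perm le_mn ap bp => /perm_size.
    by rewrite sz size_cat size_ps => /eqP; rewrite eqn_add2l eq_sym.
  have jp := join_part le_mn ap bp.
  rewrite jp (join_restrict le_mn ap bp) eqxx /=.
  rewrite (perm_size (join_sizes_perm le_mn ap bp)) size_cat size_ps br eqxx /=.
  have [t ->] := join_block_sizes le_mn ap bp.
  rewrite take_size_cat// eqxx /=; apply/eqP.
  exact: setUK_disjoint (join_disjoint le_mn ap bp).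
move=> /andP[/andP[pip /and3P[_ /eqP sz _]] /eqP dis0].
have dis : (lift_part le_mn alpha :&: beta)%SET = finset.set0.
  by rewrite -dis0; apply/setP => B; rewrite !inE; case: (B \in lift_part le_mn alpha); rewrite /= ?andbF.
have bp : finset.partition beta (new_elements m n).
  apply: partition_complement pip dis _.
  exact: cover_partition (lift_partition le_mn ap).
apply: qsym; last exact: join_sizes_perm.
by rewrite (perm_all _ (block_sizes_perm pip)) (part_sizes_gt0 pip).
Qed.

(** * The probability of new blocks *)

Section NewBlocks.
Context (R : realType) (d : measure_display) (Om : measurableType d)
  (P : probability Om R) (Pi : forall n, Om -> {set {set 'I_n}})
  (q : seq nat -> R).
Hypothesis eppf : exchangeable_partition_with_eppf P Pi q.

Lemma eppf_size_symmetric : size_symmetric q.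
Proof. by case: eppf => _ _ []. Qed.

Lemma eppf_prob_pred n (p : pred {set {set 'I_n}}) :
  fine (P [set w | p (Pi n w)]) =
  \sum_(pi | is_part pi && p pi) q (block_sizes pi).
Proof.
rewrite (finite_rv_prob P p (eppf_finite_rv eppf (n := n))).
rewrite (bigID (@is_part 'I_n)) /= [X in _ + X]big1 ?addr0.
  by apply: eq_big => [pi|pi /andP[_ pip]]; [rewrite andbC|rewrite (eppf_prob eppf pip)].
move=> pi /andP[_ /negP npip]; rewrite (_ : [set w | _] = set0) ?measure0//.
by apply/seteqP; split=> // w /= e; apply: npip; rewrite -e; exact: (eppf_part eppf).
Qed.

(** By exchangeability all partitions of [sumn s] elements with sizes [s] have the
    same probability and the same probability of being extended by [r] blocks,
    so their number cancels in the conditional probability. If [q s] vanishes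
    then the conditioning event is null, and every term of the sum vanishes with
    it. *)
Lemma eppf_new_blocks n r s (T : finType) (A : {set T}) :
  all (leq 1) s -> (sumn s <= n)%N -> #|A| = (n - sumn s)%N ->
  q s * prob_new_blocks P Pi n r s =
  \sum_(tau | finset.partition tau A && (#|tau| == r)) q (s ++ part_sizes tau).
Proof.
move=> s0 le cardA; rewrite /prob_new_blocks.
set E := [set w | block_sizes (Pi (sumn s) w) = s].
set F := [set w | _ /\ _].
pose cnt := #|[pred alpha : {set {set 'I_(sumn s)}} | is_part alpha && (block_sizes alpha == s)]|.
set S := \sum_(tau | _) _.
have PE : fine (P E) = cnt%:R * q s.
  rewrite (_ : E = [set w | block_sizes (Pi (sumn s) w) == s]); last first.
    by apply/seteqP; split => w /= /eqP.
  rewrite (eppf_prob_pred (fun pi => block_sizes pi == s)).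
  rewrite (eq_bigr (fun=> q s)) => [|pi /andP[_ /eqP -> //]].
  by rewrite mulr_natl sumr_const; congr (_ *+ _); apply: eq_card => pi; rewrite !inE.
have PEF : fine (P (E `&` F)) = cnt%:R * S.
  pose c (pi : {set {set 'I_n}}) := [&& block_sizes (restrict_partition le pi) == s,
    size (block_sizes pi) == (size s + r)%N & take (size s) (block_sizes pi) == s].
  rewrite (_ : E `&` F = [set w | c (Pi n w)]); last first.
    have res w : Pi (sumn s) w = restrict_partition le (Pi n w).
      by case: eppf => -[_ _ h] _ _; exact: h.
    apply/seteqP; split => w /=; rewrite /c /E /F /= res.
      by move=> [-> [-> ->]]; rewrite !eqxx.
    by move=> /and3P[/eqP -> /eqP -> /eqP ->].
  rewrite (eppf_prob_pred c).
  rewrite (partition_big (fun pi => restrict_partition le pi)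
     (fun alpha => is_part alpha && (block_sizes alpha == s))) /=; last first.
    by move=> pi /andP[pip /and3P[cs _ _]]; rewrite restrict_part.
  rewrite (eq_bigr (fun=> S)).
    by rewrite mulr_natl sumr_const; congr (_ *+ _); apply: eq_card => pi; rewrite !inE.
  move=> alpha /andP[ap /eqP aE].
  have := sum_extensions le r eppf_size_symmetric ap cardA; rewrite aE -/S => <-.
  apply: eq_bigl => pi; rewrite /c -andbA; congr (_ && _).
  case: (eqVneq (restrict_partition le pi) alpha) => [->|_]; last by rewrite !andbF.
  by rewrite aE eqxx andbT.
rewrite PE PEF.
have cnt0 : cnt%:R != 0 :> R.
  rewrite pnatr_eq0 -lt0n; apply/card_gt0P.
  have [alpha ap aE] := block_sizes_exist s0 erefl.
  by exists alpha; rewrite inE ap aE eqxx.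
have [q0|q0] := eqVneq (q s) 0; last by field; rewrite q0 cnt0.
(* The event [E] is null, so that [E `&` F] is null too; its probability is a
   positive multiple of the sum [S]. *)
rewrite q0 mul0r.
have : fine (P (E `&` F)) <= 0.
  have mE : measurable E.
    rewrite (_ : E = [set w | block_sizes (Pi (sumn s) w) == s]); last first.
      by apply/seteqP; split => w /= /eqP.
    exact: (finite_rv_pred (fun pi => block_sizes pi == s) (eppf_finite_rv eppf (n := sumn s))).
  have mF : measurable F.
    rewrite (_ : F = [set w | (size (block_sizes (Pi n w)) == (size s + r)%N) &&
       (take (size s) (block_sizes (Pi n w)) == s)]); last first.
      apply/seteqP; split => w /=; rewrite /F /=; first by move=> [-> ->]; rewrite !eqxx.
      by move=> /andP[/eqP -> /eqP ->].
    exact: (finite_rv_pred (fun pi => (size (block_sizes pi) == (size s + r)%N) &&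
       (take (size s) (block_sizes pi) == s)) (eppf_finite_rv eppf (n := n))).
  have <- : fine (P E) = 0 by rewrite PE q0 mulr0.
  apply: fine_le; rewrite ?fin_num_measure//; first exact: measurableI.
  by apply: le_measure; rewrite ?inE//; exact: measurableI.
rewrite PEF => S0.
have : 0 <= fine (P (E `&` F)) by rewrite fine_ge0.
rewrite PEF => S1; apply/esym/eqP.
have : cnt%:R * S == 0 by rewrite eq_le S0 S1.
by rewrite mulf_eq0 (negbTE cnt0).
Qed.

End NewBlocks.

(** * The formulas for the induced partition *)

Lemma perm_omit (T : eqType) (x0 : T) i s : (i < size s)%N ->
  perm_eq s (nth x0 s i :: omit i s).
Proof.
move=> lt_is; rewrite -{1}(cat_take_drop i s) (drop_nth x0)//.
by rewrite /omit perm_sym -cat1s perm_catCA.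
Qed.

Section Blocks.
Variables (n : nat) (pi : {set {set 'I_n}}).
Hypothesis pi_part : is_part pi.
Local Notation B := (nth finset.set0 (blocks pi)).

Lemma size_blocks_card : size (blocks pi) = #|pi|.
Proof. by rewrite (perm_size (blocks_perm pi_part)) cardE. Qed.

Lemma nth_blocks_in i : (i < #|pi|)%N -> B i \in pi.
Proof. by move=> ik; rewrite -mem_blocks// mem_nth// size_blocks_card. Qed.

Lemma card_nth_blocks i : #|B i| = nth 0%N (block_sizes pi) i.
Proof.
have [ik|ki] := ltnP i (size (blocks pi)); first by rewrite (nth_map finset.set0).
by rewrite (nth_default _ ki) cards0 nth_default// size_map.
Qed.

Lemma sum_blocks (V : nmodType) (F : {set 'I_n} -> V) :
  \sum_(C in pi) F C = \sum_(i < #|pi|) F (B i).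
Proof.
rewrite -big_enum -(perm_big _ (blocks_perm pi_part)) (big_nth finset.set0) /=.
by rewrite big_mkord size_blocks_card.
Qed.

Lemma part_sizes_omit i : (i < #|pi|)%N ->
  perm_eq (part_sizes (pi :\ B i)%SET) (omit i (block_sizes pi)).
Proof.
move=> ik; rewrite -(perm_cons #|B i|).
have := part_sizes_setU1 (negbT (finset.setD11 (B i) pi)).
rewrite (finset.setD1K (nth_blocks_in ik)) perm_sym => /perm_trans; apply.
rewrite perm_sym (perm_trans _ (block_sizes_perm pi_part))// card_nth_blocks perm_sym.
by apply: perm_omit; rewrite size_map size_blocks_card.
Qed.

End Blocks.

Lemma partition_card_gt0_le (T : finType) (A : {set T}) tau :
  A != finset.set0 -> finset.partition tau A -> (0 < #|tau| <= #|A|)%N.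
Proof.
move=> A0 taup; apply/andP; split.
  rewrite card_gt0; apply: contraNneq A0 => tau0.
  by rewrite -(cover_partition taup) tau0 /finset.cover big_set0.
rewrite (card_partition taup) -sum1_card; apply: leq_sum => C Ctau.
by rewrite card_gt0; exact: partition_neq0 taup Ctau.
Qed.

(** A partition of a nonempty set has at least one block and at most as many
    blocks as the set has elements. *)
Lemma sum_partition_by_card (R : pzRingType) (a : R) (T : finType) (A : {set T})
    (f : {set {set T}} -> R) : A != finset.set0 ->
  \sum_(tau | finset.partition tau A) a ^+ #|tau| * f tau =
  \sum_(1 <= r < #|A|.+1)
    a ^+ r * \sum_(tau | finset.partition tau A && (#|tau| == r)) f tau.
Proof.
move=> A0.
under [RHS]eq_bigr => r _ do rewrite big_distrr big_mkcondr /=.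
rewrite exchange_big /=; apply: eq_bigr => tau taup.
rewrite -big_mkcond (eq_bigl (fun r => r == #|tau|)) => [|r]; last by rewrite eq_sym.
rewrite big_nat1_eq.
by have /andP[-> h] := partition_card_gt0_le A0 taup; rewrite ltnS h.
Qed.

(** Points are measurable, so the decomposition of [H] applies to them. *)
Lemma atomic_base_masses (R : realType) (X : ptopologicalType) (a : R) (x0 : X)
    (Hc H : probability (borel X) R) :
  polish R X -> diffuse Hc ->
  (forall A : set (borel X), measurable A ->
    H A = (a%:E * \d_(x0 : borel X) A + (1 - a)%:E * Hc A)%E) ->
  (forall x : borel X, x <> x0 -> H [set x] = 0%E) /\
  H [set (x0 : borel X)] = a%:E.
Proof.
move=> /polish_separating_opens[U [U_open U_sep]] Hc0 HE.
have mx (x : borel X) := measurable_point U_open U_sep x.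
split=> [x xx0|]; rewrite HE// Hc0 mule0 adde0 diracE.
  by rewrite memNset ?mule0//= => h; apply: xx0.
by rewrite mem_set// mule1.
Qed.

(** The common form of the two formulas, before the inner sums over the partitions
    [tau] of a block are evaluated. *)
Lemma gSSS_induced_partition_prob (R : realType) (X : ptopologicalType)
    (a : R) (x0 : X) (H : probability (borel X) R) (q : seq nat -> R)
    (d : measure_display) (Om : measurableType d) (P : probability Om R)
    (xi : nat -> {RV P >-> borel X}) (n : nat) (pi : {set {set 'I_n}}) :
  polish R X -> (forall x : borel X, x <> x0 -> H [set x] = 0%E) ->
  H [set (x0 : borel X)] = a%:E -> gSSS q H xi -> size_symmetric q -> is_part pi ->
  let ns := block_sizes pi in let k := size ns in
  P [set w | induced_partition xi n w = pi] =
  ((1 - a) ^+ k * q ns + (1 - a) ^+ k.-1 * \sum_(i < k)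
     \sum_(1 <= r < (nth 0%N ns i).+1) a ^+ r *
       \sum_(tau | finset.partition tau (nth finset.set0 (blocks pi) i) && (#|tau| == r))
          q (omit i ns ++ part_sizes tau))%:E.
Proof.
move=> polX H_atom H_x0 xiP q_sym pip ns k.
have kE : k = #|pi| by rewrite /k size_block_sizes_card.
rewrite (gSSS_pattern_prob pi polX H_atom H_x0 xiP).
rewrite (sum_amalgam a (fun rho => q (block_sizes rho)) pip) kE sum_blocks//.
congr (_ + _ * _)%:E; apply: eq_bigr => i _.
have Bpi := nth_blocks_in pip (ltn_ord i).
rewrite -card_nth_blocks//.
rewrite (sum_partition_by_card a (fun tau => _)); last exact: partition_neq0 pip Bpi.
apply: eq_bigr => r _; congr (_ * _); apply: eq_bigr => tau /andP[taup _].
have [tp dis] := split_block_part pip Bpi taup.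
apply: q_sym.
  by rewrite (perm_all _ (block_sizes_perm tp)); exact: part_sizes_gt0 tp.
apply: (perm_trans (block_sizes_perm tp)); apply: (perm_trans (part_sizes_setU dis)).
by rewrite perm_catC; apply: perm_cat => //; exact: part_sizes_omit.
Qed.

(** The parameters of [V] are the same for all terms. The assumption on [r] keeps
    [s ++ part_sizes tau] from being empty. *)
Lemma gibbs_sum_partitions (R : realType) (sigma : R) V q s r (T : finType)
    (A : {set T}) : gibbs_type sigma V q -> all (leq 1) s -> (0 < r)%N ->
  \sum_(tau | finset.partition tau A && (#|tau| == r)) q (s ++ part_sizes tau) =
  (\prod_(m <- s) rising (1 - sigma) m.-1) *
    (V (sumn s + #|A|)%N (size s + r)%N * gen_stirling sigma #|A| r).
Proof.
move=> [_ _ _ _ qE] s0 r0.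
rewrite -sum_partitions_stirling !big_distrr big_mkcondr /=; apply: eq_bigr => tau taup.
have sz : size (part_sizes tau) = #|tau| by rewrite size_map cardE.
rewrite /block_weight sz; case: eqVneq => [tr|_]; last by rewrite mul0r !mulr0.
have sA : sumn (part_sizes tau) = #|A|.
  by rewrite sumnE big_map big_enum (card_partition taup).
rewrite qE ?all_cat ?s0 ?(part_sizes_gt0 taup)//; last first.
  by rewrite -size_eq0 size_cat sz tr addn_eq0 negb_and -!lt0n r0 orbT.
by rewrite sumn_cat sA size_cat sz tr big_cat /= mul1r mulrCA !mulrA.
Qed.

Lemma prod_omit (R : comPzRingType) (k : nat) (ns : k.-tuple nat) (i : 'I_k) (f : nat -> R) :
  \prod_(m <- omit i ns) f m = \prod_(j < k | j != i) f (tnth ns j).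
Proof.
have -> : omit i ns = [seq tnth ns j | j <- enum 'I_k & j != i].
  rewrite -(rem_filter i (enum_uniq 'I_k)) remE index_enum_ord map_cat map_take map_drop.
  by rewrite map_tnth_enum.
by rewrite big_map big_filter big_enum_cond.
Qed.

Theorem proposition5 (R : realType) (X : ptopologicalType)
    (a : R) (x0 : X) (Hc H : probability (borel X) R) (q : seq nat -> R)
    (d1 : measure_display) (Om1 : measurableType d1) (P1 : probability Om1 R)
    (xi : nat -> {RV P1 >-> borel X})
    (d2 : measure_display) (Om2 : measurableType d2) (P2 : probability Om2 R)
    (Pi : forall n, Om2 -> {set {set 'I_n}})
    (n k : nat) (ns : k.-tuple nat) (pi : {set {set 'I_n}}) :
  polish R X ->
  0 < a < 1 ->
  diffuse Hc ->
  (forall A : set (borel X), measurable A ->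
    H A = (a%:E * \d_(x0 : borel X) A + (1 - a)%:E * Hc A)%E) ->
  gSSS q H xi ->
  exchangeable_partition_with_eppf P2 Pi q ->
  (0 < n)%N ->
  finset.partition pi [set: 'I_n]%SET ->
  block_sizes pi = ns ->
  P1 [set w | induced_partition xi n w = pi] =
    ((1 - a) ^+ k * q ns +
     (1 - a) ^+ k.-1 *
       \sum_(i < k) q (omit i ns) *
         \sum_(1 <= r < (tnth ns i).+1)
           a ^+ r * prob_new_blocks P2 Pi n r (omit i ns))%:E /\
  forall (sigma : R) (V : nat -> nat -> R), gibbs_type sigma V q ->
  P1 [set w | induced_partition xi n w = pi] =
    ((1 - a) ^+ k * (V n k * \prod_(j < k) rising (1 - sigma) (tnth ns j).-1) +
     (1 - a) ^+ k.-1 *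
       \sum_(i < k)
         (\prod_(j < k | j != i) rising (1 - sigma) (tnth ns j).-1) *
         \sum_(1 <= r < (tnth ns i).+1)
           a ^+ r * V n (k.-1 + r)%N * gen_stirling sigma (tnth ns i) r)%:E.
Proof.
move=> polX _ Hc0 HE xiP Pi_q n0 pip nsE.
have [H_atom H_x0] := atomic_base_masses polX Hc0 HE.
have q_sym := eppf_size_symmetric Pi_q.
have := gSSS_induced_partition_prob polX H_atom H_x0 xiP q_sym pip.
cbv zeta; rewrite nsE size_tuple => ->.
have pos : all (leq 1) ns.
  by rewrite -nsE (perm_all _ (block_sizes_perm pip)); exact: part_sizes_gt0 pip.
have sum_ns : sumn ns = n by rewrite -nsE sumn_block_sizes.
have ns_omit (i : 'I_k) : perm_eq ns (tnth ns i :: omit i ns).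
  by rewrite (tnth_nth 0%N); apply: perm_omit; rewrite size_tuple.
have pos_omit (i : 'I_k) : all (leq 1) (omit i ns).
  by have := pos; rewrite (perm_all _ (ns_omit i)) => /andP[].
have sum_omit (i : 'I_k) : n = (tnth ns i + sumn (omit i ns))%N.
  by rewrite -sum_ns (perm_sumn (ns_omit i)).
have size_omit (i : 'I_k) : size (omit i ns) = k.-1.
  by have /(congr1 predn) := perm_size (ns_omit i); rewrite size_tuple /= => <-.
have card_B (i : 'I_k) : #|nth finset.set0 (blocks pi) i| = tnth ns i.
  by rewrite card_nth_blocks nsE -tnth_nth.
split=> [|sigma V qV]; congr (_ + _ * _)%:E.
- apply: eq_bigr => i _; rewrite -tnth_nth big_distrr /=; apply: eq_bigr => r _.
  have le_omit : (sumn (omit i ns) <= n)%N by rewrite [leqRHS](sum_omit i) leq_addl.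
  have card_diff : #|nth finset.set0 (blocks pi) i| = (n - sumn (omit i ns))%N.
    by rewrite card_B {1}(sum_omit i) addnK.
  by rewrite mulrCA (eppf_new_blocks Pi_q r (pos_omit i) le_omit card_diff).
- have [_ _ _ _ ->//] := qV.
    by rewrite sum_ns size_tuple big_tuple.
  by apply: contraTneq n0 => ns0; rewrite -sum_ns ns0.
- apply: eq_bigr => i _; rewrite -tnth_nth big_distrr /=.
  apply: eq_big_nat => r /andP[r0 _].
  rewrite (gibbs_sum_partitions _ qV)// card_B prod_omit size_omit addnC -sum_omit.
  by rewrite mulrCA !mulrA.
Qed.
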